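(* Let $(\mathcal{T}_1,\dots,\mathcal{T}_n)$, $\mathcal{T}_j=(T_{j,t})_{t\ge0}$, be a tuple of commuting normal contractive semigroups on a Hilbert space $\mathcal{H}$. Then it is jointly unitarily equivalent to a model $n$-normal contractive semigroup; that is, there exist a semifinite measure space $(X,\mu)$, functions $\psi_1,\dots,\psi_n\in L^\infty(X,\mu)$ with $\|\psi_j\|_\infty\le1$ and $\mu(\{x:\psi_j(x)=1\})=0$ for each $j$, and a unitary $\gamma:\mathcal{H}\to L^2(X,\mu)$ such that $T_{j,t}=\gamma^*M_{\varphi_t\circ\psi_j}\gamma$ for all $t\ge0$ and $j=1,\dots,n$.
   Context: A contractive semigroup is a strongly continuous one-parameter semigroup $(T_t)_{t\ge0}$ of contractions with $T_0=I$; it is normal if each $T_t$ is normal. Semigroups $(T_{i,t})$ and $(T_{j,t})$ commute if $T_{i,t}T_{j,t}=T_{j,t}T_{i,t}$ for all $t\ge0$. $\varphi_t(w)=e^{t\frac{w+1}{w-1}}$ for $w\in\overline{\mathbb{D}}\setminus\{1\}$, $(\varphi_t\circ\psi)(x)=\varphi_t(\psi(x))$, and $M_f$ is multiplication by $f$ on $L^2(X,\mu)$. *)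

(* Defs.v *)
(* mathcomp-analysis (measure theory, integration) +
   mathcomp-real-closed complex numbers R[i]. *)
From HB Require Import structures.
From mathcomp Require Import all_boot all_order all_algebra.
From mathcomp Require Import all_classical all_reals all_analysis.
From mathcomp Require Import complex.
Set Implicit Arguments. Unset Strict Implicit. Unset Printing Implicit Defensive.
Import Order.TTheory GRing.Theory Num.Theory.
Local Open Scope ring_scope.
Local Open Scope classical_set_scope.
Local Open Scope complex_scope.

Section Defs.
Variable R : realType.
Local Notation C := R[i].

(** squared modulus |z|^2 of a complex number *)
Definition cnorm2 (z : C) : R := (complex.Re z) ^+ 2 + (complex.Im z) ^+ 2.

(** complex exponential e^(a+ib) = e^a (cos b + i sin b) *)
Definition cexp (z : C) : C :=
  (expR (complex.Re z) * cos (complex.Im z)) +i* (expR (complex.Re z) * sin (complex.Im z)).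

(** phi_t(w) = exp(t (w+1)/(w-1)) for w <> 1; the value at w = 1 is
    irrelevant (set to 0), since it is only used on a.e.-sets avoiding 1 *)
Definition phi (t : R) (w : C) : C :=
  if w == 1 then 0 else cexp (t%:C * ((w + 1) / (w - 1))).

(** ---------- Complex Hilbert spaces ---------- *)
Section Hilbert.
Variable V : lmodType C.
Variable ip : V -> V -> C.

Definition is_inner_product : Prop :=
  [/\ (forall (a : C) (x y z : V), ip (a *: x + y) z = a * ip x z + ip y z),
      (forall x y : V, ip y x = (ip x y)^*),
      (forall x : V, complex.Im (ip x x) = 0 /\ 0 <= complex.Re (ip x x)) &
      (forall x : V, ip x x = 0 -> x = 0)].

Definition hnorm (x : V) : R := Num.sqrt (complex.Re (ip x x)).

Definition hcomplete : Prop :=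
  forall u : nat -> V,
    (forall e : R, 0 < e -> exists N : nat, forall m k : nat,
        (N <= m)%N -> (N <= k)%N -> hnorm (u m - u k) < e) ->
    exists l : V, forall e : R, 0 < e -> exists N : nat, forall k : nat,
        (N <= k)%N -> hnorm (u k - l) < e.

Definition is_hilbert : Prop := is_inner_product /\ hcomplete.

Definition linear_op (A : V -> V) : Prop :=
  forall (a : C) (x y : V), A (a *: x + y) = a *: A x + A y.

(** B is the (Hilbert) adjoint of A *)
Definition is_adjoint (A B : V -> V) : Prop :=
  forall x y : V, ip (A x) y = ip x (B y).

(** A is normal: A A^* = A^* A *)
Definition normal_op (A : V -> V) : Prop :=
  exists B : V -> V, is_adjoint A B /\ (forall x, A (B x) = B (A x)).

(** strongly continuous one-parameter semigroup of contractions, T_0 = I *)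
Definition contractive_semigroup (T : R -> V -> V) : Prop :=
  [/\ (forall t, 0 <= t -> linear_op (T t)),
      (forall t (h : V), 0 <= t -> hnorm (T t h) <= hnorm h),
      (forall h : V, T 0 h = h),
      (forall s t (h : V), 0 <= s -> 0 <= t -> T (s + t) h = T s (T t h)) &
      (forall (h : V) t, 0 <= t -> forall e : R, 0 < e ->
         exists2 d : R, 0 < d & forall s, 0 <= s -> `|s - t| < d ->
           hnorm (T s h - T t h) < e)].

Definition normal_contractive_semigroup (T : R -> V -> V) : Prop :=
  contractive_semigroup T /\ (forall t, 0 <= t -> normal_op (T t)).

Definition semigroups_commute (T1 T2 : R -> V -> V) : Prop :=
  forall t (h : V), 0 <= t -> T1 t (T2 t h) = T2 t (T1 t h).
End Hilbert.

(** ---------- Measure-theoretic side ---------- *)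
Section Meas.
Context {d : measure_display} {X : measurableType d}.
Variable mu : {measure set X -> \bar R}.

Definition semifinite : Prop :=
  forall A : set X, measurable A -> mu A = +oo%E ->
    exists B : set X, [/\ measurable B, B `<=` A & (0 < mu B < +oo)%E].

(** measurability of a complex-valued function (real and imaginary parts) *)
Definition cmeasurable (f : X -> C) : Prop :=
  measurable_fun setT (fun x => complex.Re (f x)) /\
  measurable_fun setT (fun x => complex.Im (f x)).

(** f is (a representative of) an element of L^2(X, mu) *)
Definition cL2 (f : X -> C) : Prop :=
  cmeasurable f /\ ((\int[mu]_x (cnorm2 (f x))%:E) < +oo)%E.

(** psi is an element of L^oo(X, mu) with ||psi||_oo <= 1 *)
Definition Linf_ball (psi : X -> C) : Prop :=
  cmeasurable psi /\ {ae mu, forall x, cnorm2 (psi x) <= 1}.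

(** gamma : H -> L^2(X,mu) is a unitary (functions taken up to a.e. equality) *)
Definition unitary_to_L2 (V : lmodType C) (ip : V -> V -> C)
    (gamma : V -> X -> C) : Prop :=
  [/\ (forall h : V, cL2 (gamma h)),
      (forall (a : C) (h k : V),
          {ae mu, forall x, gamma (a *: h + k) x = a * gamma h x + gamma k x}),
      (forall h : V,
          ((\int[mu]_x (cnorm2 (gamma h x))%:E) = ((hnorm ip h) ^+ 2)%:E)%E) &
      (forall f : X -> C, cL2 f -> exists h : V, {ae mu, forall x, gamma h x = f x})].
End Meas.
End Defs.

(* Main.v *)
(** The semigroups enter only through the countable commuting family of normal
    contractions T_{j,t} with t = 2^-m.  For a normal operator B, the closed
    subspace {x | |B^k x| <= D e^k for some D and all k} is invariant under every
    bounded operator commuting with B, and so is its orthogonal projection; it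
    is the spectral subspace of the disk of radius e.  Taking B = N - c for the
    operators N of the family, the corners c = 0, 1, i, 1 + i of the unit square
    and rational e yields countably many commuting projections P_k which generate
    the family as far as closed invariant subspaces are concerned, without
    Fuglede's theorem.

    By Zorn's lemma the space is an orthogonal sum of subspaces cyclic for the
    P_k.  The cyclic subspace of v is L^2 of the interval [0, |v|^2[ with Lebesgue
    measure on the sigma-algebra generated by a binary tree of intervals whose
    lengths are the |E v|^2, for E a product of P_k's and (1 - P_k)'s.
    The direct sum of these intervals is a semifinite measure space on whose
    L^2 every contraction generated by the P_k in this sense is a multiplication.

    This applies to the T_{j,2^-m} and to the average B_j over [0, 1] of the
    semigroup e^{-t} T_{j,t}, which equals (A_j - 1)^-1 (e^{-1} T_{j,1} - 1) for the
    generator A_j of T_j.  The quotient of the multipliers of e^{-1} T_{j,1} - 1 and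
    B_j is thus that of A_j - 1, and psi_j is the Cayley transform of the
    multiplier of A_j.  Pointwise, the multipliers of the e^{-t} T_{j,t} for t = 2^-m
    form a sequence of successive square roots whose difference quotients have
    that of A_j - 1 as a cluster value, so they are its exponentials; strong
    continuity then yields phi_t o psi_j for every t >= 0. *)
Require Import Defs.
From HB Require Import structures.
From mathcomp Require Import all_boot all_order all_algebra.
From mathcomp Require Import all_classical all_reals all_analysis.
From mathcomp Require Import measurable_realfun complex.
From mathcomp Require Import ring lra.
Set Implicit Arguments. Unset Strict Implicit. Unset Printing Implicit Defensive.
Import Order.TTheory GRing.Theory Num.Theory.
Import numFieldNormedType.Exports.
Import ComplexField.Normc.
Local Open Scope ring_scope.
Local Open Scope classical_set_scope.
Local Open Scope complex_scope.

Section RealLimits.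
Variable R : realType.
Implicit Types a b : nat -> R.

Lemma squeeze_cvg0 a b : (forall k, 0 <= a k <= b k) ->
  b @ \oo --> (0 : R) -> a @ \oo --> (0 : R).
Proof.
by move=> ab b0; apply: (squeeze_cvgr _ (cvg_cst (0 : R)) b0); exact: nearW.
Qed.

Lemma cvg0_le a (x y : R) : a @ \oo --> (0 : R) ->
  (forall k, x <= y + a k) -> x <= y.
Proof.
move=> a0 xya; have ya : (fun k => y + a k) @ \oo --> y.
  by rewrite -[X in _ --> X]addr0; apply: cvgD => //; exact: cvg_cst.
by rewrite -(cvg_lim _ ya)//; apply: limr_ge; [apply/cvg_ex; exists y|exact: nearW].
Qed.

Lemma cvg0_ltP a : (forall k, 0 <= a k) ->
  a @ \oo --> (0 : R) <->
  forall e : R, 0 < e -> exists N, forall k, (N <= k)%N -> a k < e.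
Proof.
move=> a0; split=> [/cvgrPdist_lt ac e e0|ac].
  by have [N _ HN] := ac e e0; exists N => k /HN; rewrite sub0r normrN ger0_norm.
apply/cvgrPdist_lt => e e0; have [N HN] := ac e e0; exists N => // k /= Nk.
by rewrite sub0r normrN ger0_norm// HN.
Qed.

End RealLimits.

Section ComplexNumbers.
Variable R : realType.
Local Notation C := R[i].
Implicit Types z w : C.

Lemma complex_ext z w : complex.Re z = complex.Re w ->
  complex.Im z = complex.Im w -> z = w.
Proof. by case: z w => [a b] [c d] /= -> ->. Qed.

Lemma Re_add z w : complex.Re (z + w) = complex.Re z + complex.Re w.
Proof. exact: raddfD. Qed.

Lemma Im_add z w : complex.Im (z + w) = complex.Im z + complex.Im w.
Proof. exact: raddfD. Qed.

Lemma Re_opp z : complex.Re (- z) = - complex.Re z.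
Proof. exact: raddfN. Qed.

Lemma Im_opp z : complex.Im (- z) = - complex.Im z.
Proof. exact: raddfN. Qed.

Lemma Re_mul z w : complex.Re (z * w) =
  complex.Re z * complex.Re w - complex.Im z * complex.Im w.
Proof. by case: z w => [a b] [c d]. Qed.

Lemma Im_mul z w : complex.Im (z * w) =
  complex.Re z * complex.Im w + complex.Im z * complex.Re w.
Proof. by case: z w => [a b] [c d]. Qed.

Lemma Re_conjc z : complex.Re (conjc z) = complex.Re z.
Proof. by case: z. Qed.

Lemma Im_conjc z : complex.Im (conjc z) = - complex.Im z.
Proof. by case: z. Qed.

Definition ReImE := (Re_add, Im_add, Re_opp, Im_opp, Re_mul, Im_mul, Re_conjc, Im_conjc).

Lemma cnorm2E z : cnorm2 z = normc z ^+ 2.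
Proof. by case: z => a b; rewrite /= sqr_sqrtr ?addr_ge0 ?sqr_ge0. Qed.

Lemma normc_ge0 z : 0 <= normc z.
Proof. by case: z => a b; exact: sqrtr_ge0. Qed.

Lemma normc_real (r : R) : normc r%:C = `|r|.
Proof. by rewrite /= expr0n addr0 sqrtr_sqr. Qed.

Lemma normcX z n : normc (z ^+ n) = normc z ^+ n.
Proof. by elim: n => [|n IH]; rewrite ?expr0 ?normc1// !exprS normcM IH. Qed.

Lemma normc_distC z w : normc (z - w) = normc (w - z).
Proof. by rewrite -normcN opprB. Qed.

Lemma normc_le_ReIm z : normc z <= `|complex.Re z| + `|complex.Im z|.
Proof.
rewrite -ler_sqr ?nnegrE ?normc_ge0 ?addr_ge0// -cnorm2E sqrrD.
by rewrite !real_normK ?num_real// addrAC lerDl mulrn_wge0 ?mulr_ge0.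
Qed.

Lemma Re_le_normc z : `|complex.Re z| <= normc z.
Proof.
rewrite -ler_sqr ?nnegrE ?normc_ge0// real_normK ?num_real// -cnorm2E.
by rewrite lerDl sqr_ge0.
Qed.

Lemma Im_le_normc z : `|complex.Im z| <= normc z.
Proof.
rewrite -ler_sqr ?nnegrE ?normc_ge0// real_normK ?num_real// -cnorm2E.
by rewrite lerDr sqr_ge0.
Qed.

Lemma mulr_conjc z : z * conjc z = (normc z ^+ 2)%:C.
Proof. by rewrite -cnorm2E; apply: complex_ext; rewrite !ReImE /cnorm2 /=; ring. Qed.

End ComplexNumbers.

(** * Inner product spaces *)

Record innerProduct (R : realType) (V : lmodType R[i]) := InnerProduct {
  ip_form :> V -> V -> R[i];
  ip_formP : is_inner_product ip_form }.

Record hilbertForm (R : realType) (V : lmodType R[i]) := HilbertForm {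
  hilbert_ip :> innerProduct V;
  hilbert_complete : hcomplete hilbert_ip }.

Section InnerProduct.
Variables (R : realType) (V : lmodType R[i]) (ip : innerProduct V).
Local Notation hn := (hnorm ip).
Implicit Types (a : R[i]) (x y z : V).

Definition rip x y : R := complex.Re (ip x y).

Lemma ip_linear a x y z : ip (a *: x + y) z = a * ip x z + ip y z.
Proof. by case: (ip_formP ip). Qed.

Lemma ipC x y : ip y x = conjc (ip x y).
Proof. by case: (ip_formP ip). Qed.

Lemma ipDl x y z : ip (x + y) z = ip x z + ip y z.
Proof. by rewrite -{1}[x]scale1r ip_linear mul1r. Qed.

Lemma ip0l z : ip 0 z = 0.
Proof. by apply: (addrI (ip 0 z)); rewrite -ipDl !addr0. Qed.

Lemma ipZl a x z : ip (a *: x) z = a * ip x z.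
Proof. by rewrite -[a *: x]addr0 ip_linear ip0l addr0. Qed.

Lemma ipNl x z : ip (- x) z = - ip x z.
Proof. by rewrite -scaleN1r ipZl mulN1r. Qed.

Lemma ipBl x y z : ip (x - y) z = ip x z - ip y z.
Proof. by rewrite ipDl ipNl. Qed.

Lemma ipDr x y z : ip x (y + z) = ip x y + ip x z.
Proof. by rewrite ipC ipDl (ipC y x) (ipC z x) -rmorphD. Qed.

Lemma ip0r z : ip z 0 = 0.
Proof. by rewrite ipC ip0l conjc0. Qed.

Lemma ipZr a x z : ip x (a *: z) = conjc a * ip x z.
Proof. by rewrite ipC ipZl (ipC z x) -rmorphM. Qed.

Lemma ipNr x z : ip x (- z) = - ip x z.
Proof. by rewrite ipC ipNl (ipC z x) -rmorphN. Qed.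

Lemma ipBr x y z : ip x (y - z) = ip x y - ip x z.
Proof. by rewrite ipDr ipNr. Qed.

Lemma ip_suml I (r : seq I) (F : I -> V) z :
  ip (\sum_(i <- r) F i) z = \sum_(i <- r) ip (F i) z.
Proof. by apply: (big_morph (fun x => ip x z)) => [x y|]; rewrite ?ipDl ?ip0l. Qed.

Lemma ip_sumr I (r : seq I) (F : I -> V) z :
  ip z (\sum_(i <- r) F i) = \sum_(i <- r) ip z (F i).
Proof. by apply: (big_morph (ip z)) => [x y|]; rewrite ?ipDr ?ip0r. Qed.

Lemma ip_eq0_sym x y : ip x y = 0 -> ip y x = 0.
Proof. by move=> xy0; rewrite ipC xy0 conjc0. Qed.

Lemma hnorm_ge0 x : 0 <= hn x. Proof. exact: sqrtr_ge0. Qed.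
#[local] Hint Resolve hnorm_ge0 : core.

Lemma hnorm_sqr x : hn x ^+ 2 = rip x x.
Proof. by have [_ _ /(_ x)[_ x0] _] := ip_formP ip; rewrite sqr_sqrtr. Qed.

Lemma ip_self x : ip x x = (hn x ^+ 2)%:C.
Proof.
have [_ _ /(_ x)[x_im _] _] := ip_formP ip.
by rewrite hnorm_sqr; apply: complex_ext.
Qed.

Lemma hnorm_eq0 x : hn x = 0 -> x = 0.
Proof.
by have [_ _ _ def] := ip_formP ip; move=> x0; apply: def; rewrite ip_self x0 expr0n.
Qed.

Lemma hnorm0 : hn 0 = 0. Proof. by rewrite /hnorm ip0l sqrtr0. Qed.

Lemma hnorm_gt0 x : x != 0 -> 0 < hn x.
Proof. by rewrite lt0r hnorm_ge0 andbT; apply: contra => /eqP/hnorm_eq0 ->. Qed.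

Lemma hnorm_le_sqr x (e : R) : 0 <= e -> (hn x <= e) = (hn x ^+ 2 <= e ^+ 2).
Proof. by move=> e0; rewrite ler_sqr ?nnegrE. Qed.

Lemma ip_ext x y : (forall z, ip x z = ip y z) -> x = y.
Proof.
move=> xy; apply/eqP; rewrite -subr_eq0; apply/eqP/hnorm_eq0/eqP.
by rewrite -sqrf_eq0 hnorm_sqr /rip ipBl xy subrr.
Qed.

Lemma ip_extr x y : (forall z, ip z x = ip z y) -> x = y.
Proof. by move=> xy; apply: ip_ext => z; rewrite ipC xy [RHS]ipC. Qed.

Lemma ripC x y : rip x y = rip y x.
Proof. by rewrite /rip ipC Re_conjc. Qed.

Lemma ripNl x y : rip (- x) y = - rip x y.
Proof. by rewrite /rip ipNl Re_opp. Qed.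

Lemma ripDl x y z : rip (x + y) z = rip x z + rip y z.
Proof. by rewrite /rip ipDl Re_add. Qed.

Lemma ripDr x y z : rip x (y + z) = rip x y + rip x z.
Proof. by rewrite /rip ipDr Re_add. Qed.

Lemma ripBl x y z : rip (x - y) z = rip x z - rip y z.
Proof. by rewrite ripDl ripNl. Qed.

Lemma ripZl (r : R) x y : rip (r%:C *: x) y = r * rip x y.
Proof. by rewrite /rip ipZl Re_mul /= mul0r subr0. Qed.

Lemma ripZr (r : R) x y : rip x (r%:C *: y) = r * rip x y.
Proof. by rewrite /rip ipZr Re_mul /= oppr0 mul0r subr0. Qed.

Lemma ripNr x y : rip x (- y) = - rip x y.
Proof. by rewrite /rip ipNr Re_opp. Qed.

Lemma Im_ip x y : complex.Im (ip x y) = rip x ('i%C *: y).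
Proof. by rewrite /rip ipZr Re_mul /=; ring. Qed.

Lemma hnormN x : hn (- x) = hn x.
Proof. by rewrite /hnorm ipNl ipNr opprK. Qed.

Lemma hnorm_distC x y : hn (x - y) = hn (y - x).
Proof. by rewrite -hnormN opprB. Qed.

Lemma hnormZ a x : hn (a *: x) = normc a * hn x.
Proof.
rewrite /hnorm ipZl ipZr mulrA mulr_conjc Re_mul /= mul0r subr0.
by rewrite sqrtrM ?sqr_ge0// sqrtr_sqr ger0_norm ?normc_ge0.
Qed.

Lemma hnormZr (r : R) x : hn (r%:C *: x) = `|r| * hn x.
Proof. by rewrite hnormZ normc_real. Qed.

Lemma hnormD_sqr x y : hn (x + y) ^+ 2 = hn x ^+ 2 + hn y ^+ 2 + 2 * rip x y.
Proof.
by rewrite !hnorm_sqr ripDl !ripDr (ripC y x); ring.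
Qed.

Lemma hnormB_sqr x y : hn (x - y) ^+ 2 = hn x ^+ 2 + hn y ^+ 2 - 2 * rip x y.
Proof. by rewrite hnormD_sqr hnormN ripNr mulrN. Qed.

Lemma pythagoras x y : ip x y = 0 -> hn (x + y) ^+ 2 = hn x ^+ 2 + hn y ^+ 2.
Proof. by move=> xy0; rewrite hnormD_sqr /rip xy0 mulr0 addr0. Qed.

Lemma parallelogram x y :
  hn (x + y) ^+ 2 + hn (x - y) ^+ 2 = 2 * hn x ^+ 2 + 2 * hn y ^+ 2.
Proof. by rewrite hnormD_sqr hnormB_sqr; ring. Qed.

Lemma rip_le x y : rip x y <= hn x * hn y.
Proof.
have [->|x0] := eqVneq x 0; first by rewrite /rip ip0l hnorm0 mul0r.
have [->|y0] := eqVneq y 0; first by rewrite /rip ip0r hnorm0 mulr0.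
have xy0 : 0 < hn x * hn y by rewrite mulr_gt0 ?hnorm_gt0.
have : 0 <= hn ((hn y)%:C *: x - (hn x)%:C *: y) ^+ 2 by exact: sqr_ge0.
rewrite hnormB_sqr ripZl ripZr !hnormZr !ger0_norm// => sq_ge0.
rewrite -(ler_pM2l xy0); nra.
Qed.

Lemma normr_rip_le x y : `|rip x y| <= hn x * hn y.
Proof. by rewrite ler_norml rip_le andbT lerNl -ripNr -(hnormN y) rip_le. Qed.

Lemma hnormD_le x y : hn (x + y) <= hn x + hn y.
Proof.
rewrite hnorm_le_sqr ?addr_ge0// hnormD_sqr sqrrD -mulr_natl.
by have := rip_le x y; lra.
Qed.

Lemma hnormB_le x y : hn (x - y) <= hn x + hn y.
Proof. by rewrite -(hnormN y) hnormD_le. Qed.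

Lemma hnorm_dist_triangle y x z : hn (x - z) <= hn (x - y) + hn (y - z).
Proof. by rewrite -{1}[x](subrK y) -addrA hnormD_le. Qed.

Lemma hnorm_dist_ge x y : `|hn x - hn y| <= hn (x - y).
Proof.
have ge u v : hn u - hn v <= hn (u - v) by rewrite lerBlDr -{1}[u](subrK v) hnormD_le.
by rewrite ler_norml ge andbT lerNl opprB hnorm_distC ge.
Qed.

Lemma apollonius x y z :
  hn (x - y) ^+ 2 + 4 * hn (z - 2^-1%:C *: (x + y)) ^+ 2 =
  2 * hn (z - x) ^+ 2 + 2 * hn (z - y) ^+ 2.
Proof.
rewrite -parallelogram addrC; congr (_ + _ ^+ 2); last first.
  by rewrite (hnorm_distC x); congr hn; rewrite opprB [RHS]addrC addrA subrK.
rewrite -[4 in LHS](_ : `|2 : R| ^+ 2 = _); last by rewrite ger0_norm//; ring.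
rewrite -exprMn -hnormZr; congr (hn _ ^+ 2).
rewrite scalerBr scalerA -rmorphM mulfV ?pnatr_eq0// scale1r.
by rewrite rmorphD rmorph1 scalerDl scale1r opprD addrACA.
Qed.

Lemma orth_of_nearest x y :
  (forall t : R, hn x <= hn (x - t%:C *: y)) -> rip x y = 0.
Proof.
move=> x_min; have y1 : 0 < hn y ^+ 2 + 1 by rewrite ltr_wpDl ?sqr_ge0.
pose t := rip x y / (hn y ^+ 2 + 1).
have tE : rip x y = t * (hn y ^+ 2 + 1) by rewrite /t divfK// gt_eqF.
have := x_min t; rewrite hnorm_le_sqr// hnormB_sqr hnormZr exprMn real_normK ?num_real//.
rewrite ripZr tE => min_t.
have t2 : t ^+ 2 * (hn y ^+ 2 + 2) <= 0 by nra.
suff /eqP -> : t == 0 by rewrite mul0r.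
rewrite -sqrf_eq0 eq_le sqr_ge0 andbT -(pmulr_lle0 _ (_ : 0 < hn y ^+ 2 + 2))//.
by rewrite ltr_wpDl ?sqr_ge0.
Qed.

(** * Convergence *)

Definition hcvg (u : nat -> V) (l : V) : Prop :=
  (fun k => hn (u k - l)) @ \oo --> (0 : R).

Lemma hcvgP u l : hcvg u l <->
  forall e : R, 0 < e -> exists N, forall k, (N <= k)%N -> hn (u k - l) < e.
Proof. by apply: cvg0_ltP => k. Qed.

Lemma hcvg_majorized u l (b : nat -> R) : (forall k, hn (u k - l) <= b k) ->
  b @ \oo --> (0 : R) -> hcvg u l.
Proof. by move=> ub; apply: squeeze_cvg0 => k; rewrite hnorm_ge0 ub. Qed.

Lemma hcvg_cst l : hcvg (fun=> l) l.
Proof. by rewrite /hcvg subrr hnorm0; exact: cvg_cst. Qed.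

Lemma hcvgD u v l m : hcvg u l -> hcvg v m -> hcvg (fun k => u k + v k) (l + m).
Proof.
move=> ul vm; apply: (@hcvg_majorized _ _ (fun k => hn (u k - l) + hn (v k - m))).
  by move=> k; rewrite opprD addrACA hnormD_le.
by rewrite -[X in _ --> X](addr0 0); exact: cvgD.
Qed.

Lemma hcvg_subseq (phi : nat -> nat) u l : (forall k, (k <= phi k)%N) ->
  hcvg u l -> hcvg (u \o phi) l.
Proof.
move=> phi_ge /hcvgP ul; apply/hcvgP => e /ul[N uN]; exists N => k Nk.
exact/uN/(leq_trans Nk).
Qed.

Lemma hcvg_hnorm u l : hcvg u l -> (fun k => hn (u k)) @ \oo --> hn l.
Proof.
move=> ul; apply/cvgrPdistC_lt => e e0; have [N HN] := (hcvgP _ _).1 ul e e0.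
by exists N => // k /HN; exact/le_lt_trans/hnorm_dist_ge.
Qed.

Lemma hcvg_hnorm_le u l (K : R) : hcvg u l -> (forall k, hn (u k) <= K) -> hn l <= K.
Proof.
move=> /hcvg_hnorm ul uK; rewrite -(cvg_lim _ ul)//.
by apply: limr_le; [apply/cvg_ex; exists (hn l)|exact: nearW].
Qed.

Lemma hcvg_unique u l m : hcvg u l -> hcvg u m -> l = m.
Proof.
move=> ul um; apply/eqP; rewrite -subr_eq0; apply/eqP/hnorm_eq0/le_anti.
rewrite hnorm_ge0 andbT.
apply: (@cvg0_le _ (fun k => hn (u k - l) + hn (u k - m))) => [|k].
  by rewrite -[X in _ --> X](addr0 0); exact: cvgD.
by rewrite add0r (hnorm_distC (u k) l) hnorm_dist_triangle.
Qed.

Lemma hcvg_rip u l z : hcvg u l -> (fun k => rip (u k) z) @ \oo --> rip l z.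
Proof.
move=> ul; apply/subr_cvg0/norm_cvg0P.
apply: (@squeeze_cvg0 _ _ (fun k => hn (u k - l) * hn z)) => [k|].
  by rewrite normr_ge0 -ripBl normr_rip_le.
by rewrite -(mul0r (hn z)); exact: cvgMl.
Qed.
End InnerProduct.

#[local] Hint Extern 0 (is_true (0 <= hnorm _ _)) => solve [exact: hnorm_ge0] : core.

(** * Operators and closed subspaces *)

Section LinearOperators.
Variables (R : realType) (V : lmodType R[i]).
Implicit Types (A B : V -> V) (M : V -> Prop).

Section LinearOperator.
Variable A : V -> V.
Hypothesis A_lin : linear_op A.

Lemma linop0 : A 0 = 0.
Proof.
have := A_lin 1 0 0; rewrite !scale1r !addr0 => A0.
by apply: (addrI (A 0)); rewrite -A0 addr0.
Qed.

Lemma linopD x y : A (x + y) = A x + A y.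
Proof. by rewrite -{1}[x]scale1r A_lin scale1r. Qed.

Lemma linopZ a x : A (a *: x) = a *: A x.
Proof. by rewrite -[a *: x]addr0 A_lin linop0 addr0. Qed.

Lemma linopN x : A (- x) = - A x.
Proof. by rewrite -scaleN1r linopZ scaleN1r. Qed.

Lemma linopB x y : A (x - y) = A x - A y.
Proof. by rewrite linopD linopN. Qed.

Lemma linop_iter k : linear_op (iter k A).
Proof. by elim: k => [|k IH] a x y //=; rewrite IH A_lin. Qed.

End LinearOperator.

Lemma linear_op_comp A B : linear_op A -> linear_op B -> linear_op (A \o B).
Proof. by move=> A_lin B_lin a x y /=; rewrite B_lin A_lin. Qed.

Lemma linear_op_lincomb a b A B : linear_op A -> linear_op B ->
  linear_op (fun x => a *: A x + b *: B x).
Proof.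
move=> A_lin B_lin c x y; rewrite A_lin B_lin !scalerDr !scalerA addrACA.
by rewrite (mulrC a) (mulrC b).
Qed.

Lemma linear_op_sub A B : linear_op A -> linear_op B -> linear_op (fun x => A x - B x).
Proof. by move=> Al Bl a x y; rewrite Al Bl opprD addrACA scalerBr. Qed.

Definition op_comm A B : Prop := forall x, A (B x) = B (A x).

Lemma op_comm_iter A B k : op_comm A B -> op_comm A (iter k B).
Proof. by move=> AB; elim: k => //= k IH x; rewrite AB IH. Qed.

Definition invariant A M : Prop := forall x, M x -> M (A x).

Lemma invariant_iter A M k : invariant A M -> invariant (iter k A) M.
Proof. by move=> AM; elim: k => //= k IH x Mx; apply/AM/IH. Qed.

Definition subspace M : Prop := M 0 /\ forall a x y, M x -> M y -> M (a *: x + y).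

Section Subspace.
Variable M : V -> Prop.
Hypothesis M_sub : subspace M.

Lemma subspaceZ a x : M x -> M (a *: x).
Proof. by move=> Mx; rewrite -[_ *: _]addr0; apply: M_sub.2 => //; exact: M_sub.1. Qed.

Lemma subspaceD x y : M x -> M y -> M (x + y).
Proof. by move=> Mx My; rewrite -[x]scale1r; apply: M_sub.2. Qed.

Lemma subspaceB x y : M x -> M y -> M (x - y).
Proof. by move=> Mx My; rewrite addrC -scaleN1r; apply: M_sub.2. Qed.

Lemma subspace_sum I (r : seq I) (F : I -> V) :
  (forall i, M (F i)) -> M (\sum_(i <- r) F i).
Proof.
by move=> MF; apply: big_ind => //; [exact: M_sub.1|exact: subspaceD].
Qed.

End Subspace.
End LinearOperators.

Section InnerProductOperators.
Variables (R : realType) (V : lmodType R[i]) (ip : innerProduct V).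
Local Notation hn := (hnorm ip).
Local Notation rip := (rip ip).
Local Notation hcvg := (hcvg ip).
Implicit Types (A B : V -> V) (M : V -> Prop).

Definition bounded_by (K : R) A : Prop := forall x, hn (A x) <= K * hn x.

Definition contraction A : Prop := forall x, hn (A x) <= hn x.

Lemma contraction_bounded A : contraction A -> bounded_by 1 A.
Proof. by move=> A1 x; rewrite mul1r. Qed.

Lemma bounded_iter K A k : 0 <= K -> bounded_by K A -> bounded_by (K ^+ k) (iter k A).
Proof.
move=> K0 AK x; elim: k => [|k IH]; first by rewrite mul1r.
by rewrite exprS -mulrA (le_trans (AK _))// ler_wpM2l.
Qed.

Lemma bounded_comp K L A B : 0 <= K -> bounded_by K A -> bounded_by L B ->
  bounded_by (K * L) (A \o B).
Proof. by move=> K0 AK BL x; rewrite (le_trans (AK _))// -mulrA ler_wpM2l. Qed.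

Lemma hcvg_op K A u l : linear_op A -> bounded_by K A -> hcvg u l ->
  hcvg (fun k => A (u k)) (A l).
Proof.
move=> A_lin AK ul; apply: (@hcvg_majorized _ _ _ _ _ (fun k => K * hn (u k - l))).
  by move=> k; rewrite -linopB.
by rewrite -(mulr0 K); exact: cvgMr.
Qed.

Lemma hcvgZ a u l : hcvg u l -> hcvg (fun k => a *: u k) (a *: l).
Proof.
apply: (@hcvg_op (normc a) (fun x => a *: x)) => [b x y|x]; last by rewrite hnormZ.
by rewrite scalerDr !scalerA mulrC.
Qed.

Lemma adjoint_linear A B : is_adjoint ip A B -> linear_op B.
Proof. by move=> AB a x y; apply: (ip_extr (ip := ip)) => z; rewrite -AB !ipDr !ipZr -!AB. Qed.

Lemma adjoint_sym A B : is_adjoint ip A B -> is_adjoint ip B A.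
Proof. by move=> AB x y; rewrite ipC -AB -ipC. Qed.

Lemma adjoint_comm A A' B B' : is_adjoint ip A A' -> is_adjoint ip B B' ->
  op_comm A B -> op_comm A' B'.
Proof.
by move=> AA' BB' AB x; apply: (ip_extr (ip := ip)) => z; rewrite -AA' -!BB' -AA' AB.
Qed.

Lemma ip_lim u w l m x z : hcvg u l -> hcvg w m ->
  (forall k, ip (u k) z = ip x (w k)) -> ip l z = ip x m.
Proof.
move=> ul wm uw; apply: complex_ext.
  apply: (cvg_unique _ (hcvg_rip (z := z) ul)) => //.
  rewrite -/(rip x m) ripC.
  have -> : (fun k => rip (u k) z) = (fun k => rip (w k) x).
    by apply/funext => k; rewrite (ripC ip (w k)) /rip uw.
  exact: hcvg_rip.
rewrite Im_ip ipC Im_conjc Im_ip.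
apply: (cvg_unique _ (hcvg_rip (z := 'i%C *: z) ul)) => //.
have -> : (fun k => rip (u k) ('i%C *: z)) = (fun k => - rip (w k) ('i%C *: x)).
  by apply/funext => k; rewrite -!Im_ip uw ipC Im_conjc.
by apply: cvgN; exact: hcvg_rip.
Qed.

Definition strong_lim (A : nat -> V -> V) (L : V -> V) : Prop :=
  forall x, hcvg (fun k => A k x) (L x).

Section StrongLimit.
Variables (A : nat -> V -> V) (L : V -> V).
Hypothesis AL : strong_lim A L.

Lemma strong_lim_linear : (forall k, linear_op (A k)) -> linear_op L.
Proof.
move=> A_lin a x y; apply: (hcvg_unique (AL _)).
rewrite (_ : (fun k => _) = (fun k => a *: A k x + A k y)); last first.
  by apply/funext => k; rewrite A_lin.
exact: hcvgD (hcvgZ a (AL x)) (AL y).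
Qed.

Lemma strong_lim_contraction : (forall k, contraction (A k)) -> contraction L.
Proof. by move=> A1 x; apply: (hcvg_hnorm_le (AL x)) => k; exact: A1. Qed.

Lemma strong_lim_adjoint : (forall k, is_adjoint ip (A k) (A k)) -> is_adjoint ip L L.
Proof. by move=> A_adj x y; apply: (ip_lim (AL x) (AL y)) => k; exact: A_adj. Qed.

Lemma strong_lim_comm K S : linear_op S -> bounded_by K S ->
  (forall k, op_comm S (A k)) -> op_comm S L.
Proof.
move=> S_lin SK SA x; apply: (hcvg_unique (hcvg_op S_lin SK (AL x))).
by rewrite (_ : (fun k => _) = (fun k => A k (S x)))//; apply/funext => k; exact: SA.
Qed.

End StrongLimit.

Lemma strong_lim_comp (A B : nat -> V -> V) (L M : V -> V) : strong_lim A L -> strong_lim B M ->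
  (forall k, linear_op (A k)) -> (forall k, contraction (A k)) ->
  strong_lim (fun k => A k \o B k) (L \o M).
Proof.
move=> AL BM A_lin A_contr x.
apply: (@hcvg_majorized _ _ _ _ _
  (fun k => hn (B k x - M x) + hn (A k (M x) - L (M x)))) => [k /=|].
  apply: le_trans (hnorm_dist_triangle ip (A k (M x)) _ _) _.
  by rewrite lerD2r -linopB// A_contr.
by rewrite -[X in _ --> X](addr0 0); apply: cvgD; [exact: BM|exact: AL].
Qed.

Definition hclosed M : Prop := forall u l, hcvg u l -> (forall k, M (u k)) -> M l.

Definition closed_subspace M : Prop := subspace M /\ hclosed M.

Lemma hclosed_approx M x : hclosed M ->
  (forall e : R, 0 < e -> exists2 y, M y & hn (x - y) <= e) -> M x.
Proof.
move=> M_closed approx.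
have /choice[u ux] : forall k, exists y, M y /\ hn (x - y) <= k.+1%:R^-1.
  by move=> k; have [|y ? ?] := approx k.+1%:R^-1; [rewrite invr_gt0|exists y].
apply: (M_closed u) => [|k]; last by have [] := ux k.
apply: (hcvg_majorized (b := fun k => k.+1%:R^-1) _ (@cvg_harmonic R)) => k.
by rewrite hnorm_distC; have [] := ux k.
Qed.

Definition hclosure M (x : V) : Prop := exists2 u, hcvg u x & forall k, M (u k).

Lemma hclosure_dist M x (e : R) : hclosure M x -> 0 < e -> exists2 y, M y & hn (y - x) < e.
Proof. by move=> [u /hcvgP ux Mu] /ux[N uN]; exists (u N); rewrite ?uN. Qed.

Lemma closed_subspace_hclosure M : subspace M -> closed_subspace (hclosure M).
Proof.
move=> M_sub; split; first split.
- by exists (fun=> 0) => [|k]; [exact: hcvg_cst|exact: M_sub.1].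
- move=> a x y [u ux Mu] [v vy Mv]; exists (fun k => a *: u k + v k) => [|k].
    exact: hcvgD (hcvgZ a ux) vy.
  exact: M_sub.2.
- move=> u l ul Mu; have /choice[y uy] : forall k, exists y, M y /\ hn (y - u k) < k.+1%:R^-1.
    move=> k; have [|y ? ?] := hclosure_dist (Mu k) (e := k.+1%:R^-1); first by rewrite invr_gt0.
    by exists y.
  exists y => [|k]; last by have [] := uy k.
  apply: (@hcvg_majorized _ _ _ _ _ (fun k => k.+1%:R^-1 + hn (u k - l))) => [k|].
    apply: le_trans (hnorm_dist_triangle ip (u k) _ _) _.
    by rewrite lerD2r ltW//; have [] := uy k.
  by rewrite -[X in _ --> X](addr0 0); apply: cvgD => //; exact: cvg_harmonic.
Qed.

End InnerProductOperators.

(** * Orthogonal projections *)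

Section OrthogonalProjections.
Variables (R : realType) (V : lmodType R[i]) (ip : innerProduct V).
Local Notation hn := (hnorm ip).
Local Notation rip := (rip ip).
Implicit Types (P : V -> V).

Definition is_oproj P : Prop :=
  [/\ linear_op P, forall x, P (P x) = P x & is_adjoint ip P P].

Lemma oproj_orth P x y : is_oproj P -> ip (P x) (y - P y) = 0.
Proof. by case=> P_lin P_idem P_adj; rewrite P_adj linopB// P_idem subrr ip0r. Qed.

Lemma oproj_pythagoras P x : is_oproj P ->
  hn x ^+ 2 = hn (P x) ^+ 2 + hn (x - P x) ^+ 2.
Proof. by move=> PP; rewrite -pythagoras ?oproj_orth// addrC subrK. Qed.

Lemma oproj_contraction P : is_oproj P -> contraction ip P.
Proof. by move=> PP x; rewrite hnorm_le_sqr// (oproj_pythagoras x PP) lerDl sqr_ge0. Qed.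

Lemma oprojC P : is_oproj P -> is_oproj (fun x => x - P x).
Proof.
case=> P_lin P_idem P_adj; split=> [|x|x y].
- exact: (@linear_op_sub _ _ id).
- by rewrite linopB// P_idem subrr subr0.
- by rewrite ipBl ipBr P_adj.
Qed.

Definition commuting_oprojs (P : nat -> V -> V) : Prop :=
  (forall k, is_oproj (P k)) /\ forall k l, op_comm (P k) (P l).

End OrthogonalProjections.

Section HilbertProjection.
Variables (R : realType) (V : lmodType R[i]) (ip : hilbertForm V).
Local Notation hn := (hnorm ip).
Local Notation rip := (rip ip).
Local Notation hcvg := (hcvg ip).

Lemma hcauchy_cvg u :
  (forall e : R, 0 < e -> exists N, forall k, (N <= k)%N -> hn (u k - u N) <= e) ->
  exists l, hcvg u l.
Proof.
move=> u_cauchy; have [e e0|l ul] := @hilbert_complete _ _ ip u.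
  have [|N uN] := u_cauchy (e / 4); first by rewrite divr_gt0.
  exists N => m k Nm Nk; apply: (le_lt_trans (hnorm_dist_triangle ip (u N) _ _)).
  have := uN m Nm; have := uN k Nk; rewrite (hnorm_distC ip (u k)); lra.
by exists l; apply/hcvgP.
Qed.

Section Projection.
Variable M : V -> Prop.
Hypothesis M_closed : closed_subspace ip M.
Let M_sub : subspace M := M_closed.1.

Lemma nearest_exists x : exists2 p, M p & forall y, M y -> hn (x - p) <= hn (x - y).
Proof.
pose D := [set hn (x - y) | y in M]; pose d := inf D.
have D_inf : has_inf D.
  split; first by exists (hn (x - 0)), 0 => //; exact: M_sub.1.
  by exists 0 => _ [y _ <-].
have d_le y : M y -> d <= hn (x - y).
  by move=> My; apply: ge_inf; [exact: D_inf.2|exists y].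
have d0 : 0 <= d by apply: lb_le_inf D_inf.1 _ => _ [y _ <-].
have /choice[u uM] : forall k, exists y, M y /\ hn (x - y) < d + k.+1%:R^-1.
  move=> k; have k0 : 0 < k.+1%:R^-1 :> R by rewrite invr_gt0.
  by have [_ [y My <-] yd] := inf_adherent k0 D_inf; exists y.
pose b k : R := k.+1%:R^-1.
have ud2 k : hn (x - u k) ^+ 2 <= d ^+ 2 + (2 * d + 1) * b k.
  have b0 : 0 <= b k by rewrite invr_ge0.
  have b1 : b k <= 1 by rewrite invf_le1// ler1n.
  have := (uM k).2; rewrite -/(b k) => /ltW; have := hnorm_ge0 ip (x - u k); nra.
have [p up] : exists p, hcvg u p.
  apply: hcauchy_cvg => e e0.
  have d1 : 0 < 4 * (2 * d + 1) by rewrite mulr_gt0// ltr_wpDl// mulr_ge0.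
  have [N _ bN] := near_infty_natSinv_lt (PosNum (divr_gt0 (exprn_gt0 2 e0) d1)).
  exists N => k Nk; rewrite hnorm_le_sqr ?(ltW e0)//.
  have mid : M (2^-1%:C *: (u k + u N)).
    by apply: subspaceZ => //; apply: subspaceD => //; [exact: (uM k).1|exact: (uM N).1].
  have := apollonius ip (u k) (u N) x; have := d_le _ mid.
  have := ud2 k; have := ud2 N; have := bN k Nk; have := bN N (leqnn N); rewrite /= -!/(b _).
  rewrite !ltr_pdivlMr// => ? ? ? ? ?; nra.
exists p; first by apply: (M_closed.2 _ _ up) => k; exact: (uM k).1.
move=> y /d_le; apply: le_trans.
apply: (@cvg0_le _ (fun k => b k + hn (u k - p))) => [|k].
  by rewrite -[X in _ --> X](addr0 0); apply: cvgD => //; exact: cvg_harmonic.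
rewrite addrA (le_trans (hnorm_dist_triangle ip (u k) _ _))// lerD2r ltW//.
exact: (uM k).2.
Qed.

Lemma proj_exists x : exists p, M p /\ forall y, M y -> ip (x - p) y = 0.
Proof.
have [p Mp p_min] := nearest_exists x; exists p; split=> // y My.
have orth z : M z -> rip (x - p) z = 0.
  move=> Mz; apply: orth_of_nearest => t; rewrite -addrA -opprD; apply: p_min.
  by apply: subspaceD => //; exact: subspaceZ.
apply: complex_ext; first exact: orth.
by rewrite Im_ip orth//; exact: subspaceZ.
Qed.

End Projection.

Definition proj (M : V -> Prop) (x : V) : V :=
  xget 0 [set p | M p /\ forall y, M y -> ip (x - p) y = 0].

Section ProjectionTheory.
Variable M : V -> Prop.
Hypothesis M_closed : closed_subspace ip M.
Let M_sub : subspace M := M_closed.1.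

Let projP x : M (proj M x) /\ forall y, M y -> ip (x - proj M x) y = 0.
Proof.
have [p xp] := proj_exists M_closed x.
exact: (@xgetI _ 0 [set p | M p /\ forall y, M y -> ip (x - p) y = 0] p xp).
Qed.

Lemma proj_in x : M (proj M x). Proof. exact: (projP x).1. Qed.

Lemma proj_orth x y : M y -> ip (x - proj M x) y = 0.
Proof. exact: (projP x).2. Qed.

Lemma proj_unique x p : M p -> (forall y, M y -> ip (x - p) y = 0) -> proj M x = p.
Proof.
move=> Mp xp; have Md : M (proj M x - p) by apply: subspaceB => //; exact: proj_in.
apply/eqP; rewrite -subr_eq0; apply/eqP/(hnorm_eq0 (ip := ip))/eqP; rewrite -sqrf_eq0 hnorm_sqr.
rewrite /rip {1}(_ : proj M x - p = (x - p) - (x - proj M x)).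
  by rewrite ipBl xp// proj_orth// subr0.
by rewrite opprB [RHS]addrC addrA subrK.
Qed.

Lemma proj_id x : M x -> proj M x = x.
Proof. by move=> Mx; apply: proj_unique => // y _; rewrite subrr ip0l. Qed.

Lemma proj_oproj : is_oproj ip (proj M).
Proof.
split=> [a x y|x|x y].
- apply: proj_unique; first by apply: M_sub.2; exact: proj_in.
  move=> z Mz; rewrite opprD addrACA -scalerBr ipDl ipZl !proj_orth//.
  by rewrite mulr0 addr0.
- exact/proj_id/proj_in.
- have /eqP := proj_orth x (proj_in y); rewrite ipBl subr_eq0 => /eqP ->.
  by have /ip_eq0_sym/eqP := proj_orth y (proj_in x); rewrite ipBr subr_eq0 => /eqP.
Qed.

Lemma proj_comm A A' : linear_op A -> is_adjoint ip A A' ->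
  invariant A M -> invariant A' M -> op_comm (proj M) A.
Proof.
move=> A_lin AA' AM A'M x; apply: proj_unique; first exact/AM/proj_in.
by move=> y My; rewrite -linopB// AA' proj_orth//; exact: A'M.
Qed.

Lemma closed_subspace_total :
  (forall x, (forall y, M y -> ip x y = 0) -> x = 0) -> forall x, M x.
Proof.
move=> M_total x; have := proj_in x; suff <- : x = proj M x by [].
by apply/eqP; rewrite -subr_eq0; apply/eqP/M_total => y; exact: proj_orth.
Qed.

End ProjectionTheory.
End HilbertProjection.

(** * Square roots of positive operators *)

Section SquareRoot.
Variables (R : realType) (V : lmodType R[i]) (ip : hilbertForm V).
Local Notation hn := (hnorm ip).
Local Notation rip := (rip ip).
Local Notation hcvg := (hcvg ip).
Variable Z : V -> V.
Hypothesis Z_lin : linear_op Z.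
Hypothesis Z_adj : is_adjoint ip Z Z.
Hypothesis Z_contr : contraction ip Z.

(* If Y = (Z + Y^2) / 2 then (1 - Y)^2 = 1 - Z.  The increments of the iteration
   towards Y are dominated by those of the scalar iteration for Z = 1. *)
Fixpoint sqrt_iter (k : nat) (x : V) : V :=
  if k is j.+1 then 2^-1%:C *: (Z x + sqrt_iter j (sqrt_iter j x)) else 0.

Fixpoint sqrt_iter_bound (k : nat) : R :=
  if k is j.+1 then 2^-1 * (1 + sqrt_iter_bound j ^+ 2) else 0.

Local Notation Y := sqrt_iter.
Local Notation b := sqrt_iter_bound.

Lemma sqrt_iter_bound_itv k : 0 <= b k <= 1.
Proof. by elim: k => [|k /andP[? ?]] /=; rewrite ?lexx ?ler01//; apply/andP; split; nra. Qed.

Let b_ge0 k : 0 <= b k. Proof. by have /andP[] := sqrt_iter_bound_itv k. Qed.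
Let b_le1 k : b k <= 1. Proof. by have /andP[] := sqrt_iter_bound_itv k. Qed.

Lemma sqrt_iter_bound_nd : {homo b : j k / (j <= k)%N >-> j <= k}.
Proof.
apply: homo_leq => // [|k]; first exact: le_trans.
by have := b_ge0 k; have := b_le1 k; rewrite /=; nra.
Qed.

Lemma sqrt_iter_linear k : linear_op (Y k).
Proof.
elim: k => [|k IH] a x y /=; first by rewrite scaler0 addr0.
rewrite !IH Z_lin addrACA -[a *: _ + a *: _]scalerDr [LHS]scalerDr.
by congr (_ + _); rewrite !scalerA mulrC.
Qed.

Lemma sqrt_iter_bounded k : bounded_by ip (b k) (Y k).
Proof.
elim: k => [|k IH] x /=; first by rewrite mul0r hnorm0.
rewrite hnormZr ger0_norm ?invr_ge0// -mulrA ler_pM2l ?invr_gt0//.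
apply: le_trans (hnormD_le _ _ _) _; rewrite mulrDl mul1r lerD// expr2 -mulrA.
by apply: le_trans (IH _) _; rewrite ler_wpM2l.
Qed.

Lemma sqrt_iter_contraction k : contraction ip (Y k).
Proof. by move=> x; rewrite (le_trans (sqrt_iter_bounded _ _))// ler_piMl. Qed.

Lemma sqrt_iter_step k x : hn (Y k.+1 x - Y k x) <= (b k.+1 - b k) * hn x.
Proof.
elim: k x => [|k IH] x.
  rewrite /= !subr0 addr0 expr0n addr0 mulr1 hnormZr ger0_norm ?invr_ge0//.
  by rewrite ler_pM2l ?invr_gt0.
have YS j : Y j.+1 x = 2^-1%:C *: (Z x + Y j (Y j x)) by [].
have bS j : b j.+1 = 2^-1 * (1 + b j ^+ 2) by [].
rewrite 2!YS -scalerBr hnormZr ger0_norm ?invr_ge0// 2!bS -mulrBr -mulrA.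
rewrite ler_pM2l ?invr_gt0//.
have -> : Z x + Y k.+1 (Y k.+1 x) - (Z x + Y k (Y k x)) =
    Y k.+1 (Y k.+1 x - Y k x) + (Y k.+1 (Y k x) - Y k (Y k x)).
  by rewrite opprD addrACA subrr add0r (linopB (@sqrt_iter_linear _)) addrA subrK.
apply: le_trans (hnormD_le _ _ _) _.
have outer : hn (Y k.+1 (Y k.+1 x - Y k x)) <= b k.+1 * ((b k.+1 - b k) * hn x).
  by apply: le_trans (sqrt_iter_bounded _ _) _; rewrite ler_wpM2l.
have inner : hn (Y k.+1 (Y k x) - Y k (Y k x)) <= (b k.+1 - b k) * (b k * hn x).
  apply: le_trans (IH _) _; rewrite ler_wpM2l ?sqrt_iter_bounded//.
  by rewrite subr_ge0 sqrt_iter_bound_nd.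
by move: (lerD outer inner); rewrite -!bS; nra.
Qed.

Lemma sqrt_iter_dist j k x : (j <= k)%N -> hn (Y k x - Y j x) <= (b k - b j) * hn x.
Proof.
elim: k => [|k IH]; first by rewrite leqn0 => /eqP ->; rewrite !subrr hnorm0 mul0r.
rewrite leq_eqVlt => /orP[/eqP ->|jk]; first by rewrite !subrr hnorm0 mul0r.
apply: le_trans (hnorm_dist_triangle ip (Y k x) _ _) _.
by apply: le_trans (lerD (sqrt_iter_step _ _) (IH jk)) _; rewrite -mulrDl addrA subrK.
Qed.

Lemma sqrt_iter_cvg x : exists l, hcvg (fun k => Y k x) l.
Proof.
apply: hcauchy_cvg => e e0; have x1 : 0 < hn x + 1 by rewrite ltr_wpDl.
have b_sup : has_sup (range b).
  by split; [exists (b 0), 0%N|exists 1 => _ [k _ <-]; exact: b_le1].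
have [_ [N _ <-] bN] := sup_adherent (divr_gt0 e0 x1) b_sup.
exists N => k Nk; apply: le_trans (sqrt_iter_dist x Nk) _.
have bk : b k <= sup (range b) by apply: sup_upper_bound => //; exists k.
apply: (@le_trans _ _ (e / (hn x + 1) * hn x)); first by rewrite ler_wpM2r//; lra.
by rewrite mulrAC ler_pdivrMr// mulrDr mulr1 lerDl ltW.
Qed.

Lemma sqrt_iter_adjoint k : is_adjoint ip (Y k) (Y k).
Proof.
elim: k => [|k IH] x y /=; first by rewrite ip0l ip0r.
by rewrite ipZl ipZr ipDl ipDr Z_adj !IH conjc_real.
Qed.

Lemma sqrt_iter_comm A : linear_op A -> op_comm A Z -> forall k, op_comm A (Y k).
Proof.
move=> A_lin AZ; elim=> [|k IH] x /=; first exact: linop0.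
by rewrite linopZ// linopD// AZ !IH.
Qed.

Lemma positive_sqrt_exists : exists S : V -> V,
  [/\ linear_op S, is_adjoint ip S S, forall x, 0 <= rip (S x) x,
      forall x, S (S x) = x - Z x &
      forall A K, linear_op A -> bounded_by ip K A -> op_comm A Z -> op_comm A S].
Proof.
have /choice[L YL] := sqrt_iter_cvg.
have L_lin : linear_op L := strong_lim_linear YL sqrt_iter_linear.
have L_contr : contraction ip L := strong_lim_contraction YL sqrt_iter_contraction.
have L_adj : is_adjoint ip L L := strong_lim_adjoint YL sqrt_iter_adjoint.
have L_fix x : L x = 2^-1%:C *: (Z x + L (L x)).
  have YSL : hcvg (fun k => Y k.+1 x) (L x) by exact: (hcvg_subseq leqnSn (YL x)).
  apply: (hcvg_unique YSL); apply/hcvgZ/hcvgD; first exact: hcvg_cst.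
  exact: (strong_lim_comp YL YL sqrt_iter_linear sqrt_iter_contraction).
exists (fun x => x - L x); split.
- exact: (@linear_op_sub _ _ id).
- by move=> x y; rewrite ipBl ipBr L_adj.
- move=> x; rewrite ripBl -hnorm_sqr subr_ge0.
  by rewrite (le_trans (rip_le _ _ _))// expr2 ler_wpM2r.
- move=> x; have -> : Z x = L x + L x - L (L x).
    have half : 2^-1 + 2^-1 = 1 :> R by lra.
    by rewrite {1 2}L_fix -scalerDl -rmorphD /= half scale1r addrK.
  by rewrite linopB// -addrA -opprD addrA.
- move=> A K A_lin AK AZ x; rewrite linopB//; congr (_ - _).
  exact: (strong_lim_comm YL A_lin AK (sqrt_iter_comm A_lin AZ)).
Qed.

End SquareRoot.

Section SpectralSign.
Variables (R : realType) (V : lmodType R[i]) (ip : hilbertForm V).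
Local Notation hn := (hnorm ip).
Local Notation rip := (rip ip).
Implicit Types A B : V -> V.

Lemma abs_op_exists A : linear_op A -> is_adjoint ip A A -> contraction ip A ->
  exists S : V -> V,
  [/\ linear_op S, is_adjoint ip S S, forall x, 0 <= rip (S x) x,
      forall x, S (S x) = A (A x) &
      forall B K, linear_op B -> bounded_by ip K B -> op_comm B A -> op_comm B S].
Proof.
move=> A_lin A_adj A_contr; pose Z x := x - A (A x).
have Z_lin : linear_op Z.
  exact: (@linear_op_sub _ _ id (A \o A) _ (linear_op_comp A_lin A_lin)).
have Z_adj : is_adjoint ip Z Z by move=> x y; rewrite ipBl ipBr !A_adj.
have Z_contr : contraction ip Z.
  move=> x; rewrite hnorm_le_sqr// hnormB_sqr /rip -A_adj -/(rip _ _) -hnorm_sqr.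
  have : hn (A (A x)) ^+ 2 <= hn (A x) ^+ 2 by rewrite -hnorm_le_sqr.
  by have := sqr_ge0 (hn (A x)); lra.
have [S [S_lin S_adj S_ge0 SS S_comm]] := positive_sqrt_exists Z_lin Z_adj Z_contr.
exists S; split=> // [x|B K B_lin BK BA]; first by rewrite SS opprB addrC subrK.
by apply: (S_comm B K B_lin BK) => x; rewrite /Z (linopB B_lin) !BA.
Qed.

(* The subspace is the kernel of |A| - A; it contains the range of |A| + A. *)
Lemma spectral_sign A K : linear_op A -> is_adjoint ip A A -> bounded_by ip K A -> 0 < K ->
  exists M : V -> Prop,
  [/\ forall B L, linear_op B -> bounded_by ip L B -> op_comm B A -> invariant B M,
      forall y, M y -> 0 <= rip (A y) y &
      forall x, (forall y, M y -> ip x y = 0) -> rip (A x) x <= 0].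
Proof.
move=> A_lin A_adj AK K0; pose A1 x := K^-1%:C *: A x.
have A1E x y : rip (A1 x) y = K^-1 * rip (A x) y by rewrite ripZl.
have A1_lin : linear_op A1.
  by move=> a x y; rewrite /A1 A_lin scalerDr !scalerA mulrC.
have A1_adj : is_adjoint ip A1 A1.
  by move=> x y; rewrite ipZl ipZr A_adj conjc_real.
have A1_contr : contraction ip A1.
  by move=> x; rewrite hnormZr gtr0_norm ?invr_gt0// ler_pdivrMl.
have [S [S_lin S_adj S_ge0 SS S_comm]] := abs_op_exists A1_lin A1_adj A1_contr.
have SA : op_comm A1 S.
  by apply: (S_comm A1 1) => //; exact: contraction_bounded.
exists (fun y => S y = A1 y); split.
- move=> B L B_lin BL BA y Sy; have BA1 : op_comm B A1.
    by move=> x; rewrite /A1 (linopZ B_lin) BA.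
  by rewrite -(S_comm B L)// Sy BA1.
- by move=> y Sy; have := S_ge0 y; rewrite Sy A1E pmulr_rge0 ?invr_gt0.
- move=> x x_orth; suff Sx : S x = - A1 x.
    have := S_ge0 x; rewrite Sx ripNl A1E oppr_ge0 pmulr_rle0 ?invr_gt0//.
  apply/eqP; rewrite -addr_eq0; apply/eqP/(ip_ext (ip := ip)) => z.
  rewrite ip0l ipDl S_adj A1_adj -ipDr; apply: x_orth.
  by rewrite (linopD S_lin) SS (linopD A1_lin) SA addrC.
Qed.

(* Cauchy-Schwarz for the form <D z, w>: |D z|^2 <= k <D z, z> <= k^2 |z|^2. *)
Lemma form_bound_op_bound (D : V -> V) (M : V -> Prop) (k : R) :
  linear_op D -> is_adjoint ip D D -> subspace M -> invariant D M -> 0 < k ->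
  (forall z, M z -> 0 <= rip (D z) z <= k * hn z ^+ 2) ->
  forall z, M z -> hn (D z) <= k * hn z.
Proof.
move=> D_lin D_adj M_sub DM k0 form z Mz; pose w := (- k)%:C *: z + D z.
have Mw : M w by apply: M_sub.2 => //; exact: DM.
have wE : rip (D w) w =
    rip (D (D z)) (D z) - 2 * k * hn (D z) ^+ 2 + k ^+ 2 * rip (D z) z.
  have DDz : rip (D (D z)) z = hn (D z) ^+ 2 by rewrite hnorm_sqr /rip D_adj.
  by rewrite /w D_lin !(ripDl, ripDr, ripZl, ripZr) DDz hnorm_sqr; ring.
rewrite hnorm_le_sqr ?mulr_ge0 ?(ltW k0)// exprMn.
have /andP[w_ge0 _] := form w Mw; have /andP[_ Dz_le] := form _ (DM _ Mz).
have /andP[_ z_le] := form z Mz; rewrite wE in w_ge0.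
have k2z : k ^+ 2 * rip (D z) z <= k ^+ 2 * (k * hn z ^+ 2) by rewrite ler_wpM2l ?sqr_ge0.
by rewrite -(ler_pM2l k0); lra.
Qed.

End SpectralSign.

(** * Spectral subspaces of a normal operator *)

Section LogConvex.
Variable R : realType.

Lemma logconvex_growth (a : nat -> R) (e D : R) :
  (forall k, 0 <= a k) -> (forall k, a k.+1 ^+ 2 <= a k * a k.+2) -> 0 <= e ->
  (forall k, a k <= D * e ^+ k) -> a 1 <= e * a 0.
Proof.
move=> a0 a_logc e0 aD; rewrite leNgt; apply/negP => a1_gt.
have a1p : 0 < a 1 by rewrite (le_lt_trans _ a1_gt) ?mulr_ge0.
have a0p : 0 < a 0.
  rewrite lt0r a0 andbT; apply/eqP => a00; have := a_logc 0; rewrite a00 mul0r.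
  by apply/negP; rewrite -ltNge exprn_gt0.
pose r := a 1 / a 0; have r0 : 0 < r by rewrite divr_gt0.
have er : e < r by rewrite ltr_pdivlMr.
have ratio k : 0 < a k /\ r * a k <= a k.+1.
  elim: k => [|k [ak IH]]; first by rewrite /r divfK ?gt_eqF.
  have akS : 0 < a k.+1 by apply: lt_le_trans IH; exact: mulr_gt0.
  split=> //; rewrite -(ler_pM2l ak); apply: le_trans (a_logc k).
  by rewrite expr2 mulrA ler_pM2r// mulrC.
have geo k : a 0 * r ^+ k <= a k.
  elim: k => [|k IH]; first by rewrite mulr1.
  by rewrite exprS mulrCA (le_trans _ (ratio k).2)// ler_pM2l.
suff : a 0 <= 0 by rewrite leNgt a0p.
have q1 : `|e / r| < 1 by rewrite ger0_norm ?divr_ge0 ?(ltW r0)// ltr_pdivrMr// mul1r.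
apply: (cvg0_le (cvg_geometric D q1)) => k /=.
rewrite add0r expr_div_n mulrA ler_pdivlMr ?exprn_gt0//.
exact: le_trans (geo k) (aD k).
Qed.

End LogConvex.

Section NormalOperator.
Variables (R : realType) (V : lmodType R[i]) (ip : hilbertForm V).
Local Notation hn := (hnorm ip).
Local Notation rip := (rip ip).
Local Notation hcvg := (hcvg ip).

(* For a normal [B] this is the range of the spectral projection of the closed
   disk of radius [e]; unlike the projection, the condition is visibly stable
   under every bounded operator commuting with [B]. *)
Definition specsub (B : V -> V) (e : R) (x : V) : Prop :=
  exists D : R, forall k, hn (iter k B x) <= D * e ^+ k.

Lemma specsub_comm B S K e : 0 <= K -> bounded_by ip K S -> op_comm S B ->
  invariant S (specsub B e).
Proof.
move=> K0 SK SB x [D xD]; exists (K * D) => k.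
by rewrite -(op_comm_iter k SB) (le_trans (SK _))// -mulrA ler_wpM2l.
Qed.

Definition normal_with (B B' : V -> V) : Prop :=
  [/\ linear_op B, is_adjoint ip B B' & op_comm B B'].

Section SpectralSubspace.
Variables B B' : V -> V.
Hypothesis B_normal : normal_with B B'.
Variable K : R.
Hypothesis K0 : 0 <= K.
Hypothesis BK : bounded_by ip K B.

Let B_lin : linear_op B. Proof. by case: B_normal. Qed.
Let BB' : is_adjoint ip B B'. Proof. by case: B_normal. Qed.
Let B_comm : op_comm B B'. Proof. by case: B_normal. Qed.
Let B'_lin : linear_op B'. Proof. exact: adjoint_linear BB'. Qed.
Let B'B : is_adjoint ip B' B. Proof. exact: adjoint_sym. Qed.

Lemma normal_hnorm x : hn (B' x) = hn (B x).
Proof. by rewrite /hnorm -BB' B_comm B'B. Qed.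

Let B'K : bounded_by ip K B'. Proof. by move=> x; rewrite normal_hnorm. Qed.

Lemma normal_hnorm_iter k x : hn (iter k B' x) = hn (iter k B x).
Proof.
elim: k x => //= k IH x; rewrite normal_hnorm.
by rewrite (op_comm_iter k B_comm) IH -iterSr.
Qed.

Lemma specsub_adj e x : specsub B' e x <-> specsub B e x.
Proof. by split=> -[D xD]; exists D => k; have := xD k; rewrite normal_hnorm_iter. Qed.

Lemma normal_hnorm_logconvex x : hn (B x) ^+ 2 <= hn x * hn (B (B x)).
Proof.
by rewrite hnorm_sqr /rip BB' -/(rip _ _) -normal_hnorm rip_le.
Qed.

Lemma specsub_inv e : invariant B (specsub B e).
Proof. exact: (specsub_comm K0 BK). Qed.

Lemma specsub_le e x : 0 <= e -> specsub B e x -> hn (B x) <= e * hn x.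
Proof.
move=> e0 [D xD]; apply: (@logconvex_growth _ (fun k => hn (iter k B x)) _ D) => // k.
exact: normal_hnorm_logconvex.
Qed.

Lemma specsub_iter_le e x : 0 <= e -> specsub B e x ->
  forall k, hn (iter k B x) <= hn x * e ^+ k.
Proof.
move=> e0 Mx; elim=> [|k IH]; first by rewrite mulr1.
rewrite iterS exprS mulrCA; apply: le_trans (specsub_le e0 _) _; last by rewrite ler_wpM2l.
exact: (invariant_iter k (@specsub_inv e)).
Qed.

Lemma specsub_closed e : 0 <= e -> closed_subspace ip (specsub B e).
Proof.
move=> e0; split; first split.
- by exists 0 => k; rewrite mul0r (linop0 (linop_iter B_lin k)) hnorm0.
- move=> a x y [D xD] [D' yD']; exists (normc a * D + D') => k.
  rewrite (linop_iter B_lin) (le_trans (hnormD_le _ _ _))// mulrDl lerD//.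
  by rewrite hnormZ -mulrA ler_wpM2l ?normc_ge0.
- move=> u l ul Mu; exists (hn l + 1) => k.
  have uk := hcvg_op (linop_iter B_lin k) (bounded_iter k K0 BK) ul.
  have [N lN] := (hcvgP _ _ _).1 ul 1 ltr01.
  apply: (@hcvg_hnorm_le _ _ ip (fun j => iter k B (u (N + j)%N))).
    by apply: (hcvg_subseq (phi := addn N)) uk => j; exact: leq_addl.
  move=> j; apply: le_trans (specsub_iter_le e0 (Mu _) k) _.
  rewrite ler_wpM2r ?exprn_ge0//; have := lN (N + j)%N (leq_addr _ _).
  by have := hnorm_dist_ge ip (u (N + j)%N) l; rewrite ler_norml => /andP[_]; lra.
Qed.

Lemma specsub_bound x : specsub B K x.
Proof. by exists (hn x) => k; rewrite mulrC bounded_iter. Qed.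

Lemma specsub_mono e e' x : 0 <= e -> e <= e' -> specsub B e x -> specsub B e' x.
Proof.
move=> e0 ee' Mx; exists (hn x) => k; apply: le_trans (specsub_iter_le e0 Mx k) _.
by rewrite ler_wpM2l// lerXn2r// nnegrE// (le_trans e0).
Qed.

Lemma specsub0 x : specsub B 0 x -> B x = 0.
Proof.
move=> /(specsub_le (lexx 0)); rewrite mul0r => Bx0.
by apply: (hnorm_eq0 (ip := ip)); apply/le_anti; rewrite Bx0 hnorm_ge0.
Qed.

Definition gram x : V := B' (B x).

Lemma gram_linear : linear_op gram.
Proof. exact: (linear_op_comp B'_lin B_lin). Qed.

Lemma gram_adjoint : is_adjoint ip gram gram.
Proof. by move=> x y; rewrite B'B BB'. Qed.

Lemma gram_rip x : rip (gram x) x = hn (B x) ^+ 2.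
Proof. by rewrite hnorm_sqr /rip B'B. Qed.

Lemma gram_comm : op_comm B gram.
Proof. by move=> x; rewrite /gram B_comm. Qed.

Lemma specsub_gram e : invariant gram (specsub B e).
Proof.
move=> x /specsub_inv; apply: (specsub_comm K0 B'K) => y.
by rewrite B_comm.
Qed.

Section GramShift.
Variable e : R.

Definition gram_shift x : V := gram x - (e ^+ 2)%:C *: x.

Lemma gram_shift_linear : linear_op gram_shift.
Proof.
apply: linear_op_sub gram_linear _ => a x y.
by rewrite scalerDr !scalerA mulrC.
Qed.

Lemma gram_shift_adjoint : is_adjoint ip gram_shift gram_shift.
Proof. by move=> x y; rewrite ipBl ipBr ipZl ipZr gram_adjoint conjc_real. Qed.

Lemma gram_shift_rip x : rip (gram_shift x) x = hn (B x) ^+ 2 - e ^+ 2 * hn x ^+ 2.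
Proof.
by rewrite ripBl gram_rip ripZl -hnorm_sqr.
Qed.

Lemma gram_shift_comm : op_comm B gram_shift.
Proof. by move=> x; rewrite /gram_shift linopB// linopZ// gram_comm. Qed.

Lemma gram_shift_bounded : bounded_by ip (K ^+ 2 + e ^+ 2) gram_shift.
Proof.
move=> x; rewrite (le_trans (hnormB_le _ _ _))// mulrDl lerD//.
  by rewrite expr2; exact: (bounded_comp K0 B'K BK).
by rewrite hnormZr ger0_norm ?sqr_ge0.
Qed.

End GramShift.

Lemma specsub_orth e x : 0 <= e -> (forall y, specsub B e y -> ip x y = 0) ->
  e * hn x <= hn (B x).
Proof.
move=> e0 x_orth; have Kp : 0 < K ^+ 2 + e ^+ 2 + 1 by rewrite ltr_wpDl ?addr_ge0 ?sqr_ge0.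
pose A y := - gram_shift e y.
have A_lin : linear_op A.
  by move=> a y z; rewrite /A gram_shift_linear opprD scalerN.
have A_adj : is_adjoint ip A A.
  by move=> y z; rewrite ipNl ipNr gram_shift_adjoint.
have AK : bounded_by ip (K ^+ 2 + e ^+ 2 + 1) A.
  move=> y; rewrite hnormN (le_trans (gram_shift_bounded _ _))//.
  by rewrite ler_wpM2r// lerDl.
have BA : op_comm B A by move=> y; rewrite /A linopN// gram_shift_comm.
have [M [M_inv M_ge0 M_orth]] := spectral_sign A_lin A_adj AK Kp.
have BM : invariant B M := M_inv B K B_lin BK BA.
have B_le y : M y -> hn (B y) <= e * hn y.
  move=> /M_ge0; rewrite ripNl gram_shift_rip opprB subr_ge0 -exprMn.
  by rewrite -hnorm_le_sqr ?mulr_ge0.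
have M_specsub y : M y -> specsub B e y.
  move=> My; exists (hn y); elim=> [|k IH]; first by rewrite mulr1.
  rewrite iterS exprS mulrCA (le_trans (B_le _ _)) ?ler_wpM2l//.
  exact: (invariant_iter k BM).
have := M_orth x (fun y My => x_orth y (M_specsub y My)).
by rewrite ripNl gram_shift_rip opprB subr_le0 -exprMn ler_sqr ?nnegrE ?mulr_ge0.
Qed.

Definition specsub_between (e e' : R) (z : V) : Prop :=
  specsub B e' z /\ forall y, specsub B e y -> ip z y = 0.

Lemma specsub_between_subspace e e' : 0 <= e' -> subspace (specsub_between e e').
Proof.
move=> e'0; have [[M0 M_lin] _] := specsub_closed e'0.
split=> [|a z w [Mz z_orth] [Mw w_orth]]; first by split=> // y _; rewrite ip0l.
split=> [|y My]; first exact: M_lin.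
by rewrite ip_linear z_orth// w_orth// mulr0 addr0.
Qed.

Lemma specsub_between_gram e e' : invariant gram (specsub_between e e').
Proof.
move=> z [Mz z_orth]; split=> [|y My]; first exact: specsub_gram.
by rewrite gram_adjoint z_orth//; exact: specsub_gram.
Qed.

Lemma gram_specsub_between e e' z : 0 <= e -> e < e' -> specsub_between e e' z ->
  hn (gram z - (e ^+ 2)%:C *: z) <= (e' ^+ 2 - e ^+ 2) * hn z.
Proof.
move=> e0 ee'; have e'0 : 0 <= e' by rewrite (le_trans e0)// ltW.
have M_sub := specsub_between_subspace e e'0.
apply: (form_bound_op_bound (@gram_shift_linear e) (@gram_shift_adjoint e) M_sub).
- move=> w Mw; rewrite /gram_shift addrC -scaleNr.
  by apply: M_sub.2 => //; exact: specsub_between_gram.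
- by rewrite subr_gt0 ltrXn2r.
- move=> w [Mw w_orth]; rewrite gram_shift_rip subr_ge0 mulrBl lerD2r -!exprMn.
  by rewrite !ler_sqr ?nnegrE ?mulr_ge0// specsub_orth ?specsub_le.
Qed.

End SpectralSubspace.
End NormalOperator.

Section GramRiemannSum.
Variables (R : realType) (V : lmodType R[i]) (ip : hilbertForm V).
Local Notation hn := (hnorm ip).
Variables B B' : V -> V.
Hypothesis B_normal : normal_with ip B B'.
Variable K : R.
Hypothesis K0 : 0 <= K.
Hypothesis BK : bounded_by ip K B.
Local Notation G := (gram B B').
Local Notation specproj e := (proj ip (specsub ip B e)).

Let specP e (e0 : 0 <= e) := specsub_closed B_normal K0 BK e0.

Section Partition.
Variable e : nat -> R.
Hypothesis e_ge0 : forall i, 0 <= e i.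
Hypothesis e_incr : forall i, e i < e i.+1.

Definition gram_riemann_sum (m : nat) (x : V) : V :=
  \sum_(i < m) (e i ^+ 2)%:C *: (specproj (e i.+1) x - specproj (e i) x).

Let specproj_mono i z : specsub ip B (e i) z -> specsub ip B (e i.+1) z.
Proof. by apply: (specsub_mono B_normal K0 BK) => //; exact: ltW. Qed.

Lemma specproj_increment i x :
  specsub_between ip B (e i) (e i.+1) (specproj (e i.+1) x - specproj (e i) x).
Proof.
split=> [|z Mz].
  apply: (subspaceB (specP (e_ge0 _)).1); first exact: (proj_in (specP _)).
  exact/specproj_mono/(proj_in (specP _)).
rewrite (_ : _ - _ = (x - specproj (e i) x) - (x - specproj (e i.+1) x)).
  rewrite ipBl !(proj_orth (specP _)) ?subrr//; exact: specproj_mono.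
by rewrite opprB [RHS]addrC addrA subrK.
Qed.

Lemma gram_riemann_sum_specsub m x : specsub ip B (e m) (gram_riemann_sum m x).
Proof.
elim: m => [|m IH]; first by rewrite /gram_riemann_sum big_ord0; exact: (specP _).1.1.
rewrite /gram_riemann_sum big_ord_recr /=.
apply: (subspaceD (specP (e_ge0 _)).1); first exact: specproj_mono.
by apply: (subspaceZ (specP (e_ge0 _)).1); exact: (specproj_increment _ _).1.
Qed.

Lemma gram_riemann_sum_error (kap : R) m x : e 0 = 0 -> 0 <= kap ->
  (forall i, (i < m)%N -> e i.+1 ^+ 2 - e i ^+ 2 <= kap) ->
  hn (G (specproj (e m) x) - gram_riemann_sum m x) <= kap * hn (specproj (e m) x).
Proof.
move=> e00 kap0; have G_lin := gram_linear B_normal.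
have [_ BB' _] := B_normal; elim: m => [_|m IH mesh].
  have Mx : specsub ip B 0 (specproj (e 0) x) by rewrite -[0]e00; exact: (proj_in (specP _)).
  rewrite /gram_riemann_sum big_ord0 subr0 /gram (specsub0 B_normal Mx).
  by rewrite (linop0 (adjoint_linear BB')) hnorm0 mulr_ge0.
pose p := specproj (e m) x; pose q := specproj (e m.+1) x - p.
have pqE : specproj (e m.+1) x = p + q by rewrite addrC subrK.
have q_between : specsub_between ip B (e m) (e m.+1) q := specproj_increment m x.
have Mp : specsub ip B (e m) p by exact: (proj_in (specP _)).
pose r := G p - gram_riemann_sum m x; pose s := G q - (e m ^+ 2)%:C *: q.
have Mr : specsub ip B (e m) r.
  apply: (subspaceB (specP (e_ge0 _)).1); last exact: gram_riemann_sum_specsub.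
  exact: (specsub_gram B_normal K0 BK).
have s_orth : ip r s = 0.
  apply: ip_eq0_sym; rewrite ipBl ipZl (q_between.2 _ Mr) mulr0 subr0.
  exact: (specsub_between_gram B_normal K0 BK q_between).2.
have -> : G (specproj (e m.+1) x) - gram_riemann_sum m.+1 x = r + s.
  rewrite /gram_riemann_sum big_ord_recr /= -/p -/q pqE (linopD G_lin) opprD.
  by rewrite addrACA.
have r_le : hn r <= kap * hn p by apply: IH => i /ltnW; exact: mesh.
have s_le : hn s <= kap * hn q.
  apply: (le_trans (gram_specsub_between B_normal K0 BK _ _ q_between)) => //.
  by rewrite ler_wpM2r// mesh.
have pq_orth : ip p q = 0 by exact/ip_eq0_sym/(q_between.2 _ Mp).
rewrite pqE hnorm_le_sqr ?mulr_ge0// exprMn (pythagoras s_orth) (pythagoras pq_orth).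
by rewrite mulrDr -!exprMn lerD// ler_sqr ?nnegrE ?mulr_ge0.
Qed.

End Partition.

Lemma gram_invariant (W : V -> Prop) : closed_subspace ip W ->
  (forall k i, invariant (specproj (i%:R / k.+1%:R)) W) -> invariant G W.
Proof.
move=> [W_sub W_closed] W_inv x Wx; pose N := (Num.truncn K).+1.
have KN : K <= N%:R by rewrite ltW// truncnS_gt.
apply: hclosed_approx W_closed _ => d d0.
pose k := Num.truncn (2 * N%:R * hn x / d).
have k_large : 2 * N%:R * hn x / k.+1%:R <= d.
  by rewrite ler_pdivrMr// -ler_pdivrMl// mulrC ltW// truncnS_gt.
pose e i : R := i%:R / k.+1%:R.
have e_ge0 i : 0 <= e i by rewrite divr_ge0.
have e_incr i : e i < e i.+1 by rewrite ltr_pM2r ?invr_gt0// ltr_nat.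
pose m := (N * k.+1)%N; have em : e m = N%:R by rewrite /e natrM mulfK ?pnatr_eq0.
have e_le i : (i <= m)%N -> e i <= N%:R by rewrite -em ler_pM2r ?invr_gt0// ler_nat.
exists (gram_riemann_sum e m x).
  apply: subspace_sum => // i; apply: subspaceZ => //.
  by apply: subspaceB => //; exact: W_inv.
have Px : specproj (e m) x = x.
  apply: (proj_id (specP (e_ge0 m))); rewrite em.
  exact: (specsub_mono B_normal K0 BK K0 KN (specsub_bound K0 BK x)).
have mesh i : (i < m)%N -> e i.+1 ^+ 2 - e i ^+ 2 <= 2 * N%:R / k.+1%:R.
  move=> im; rewrite subr_sqr {1 2}/e -mulrBl -natrB// subSnn mul1r mulrC.
  rewrite ler_pM2r ?invr_gt0// [2 * _]mulr_natl [N%:R *+ 2]mulr2n.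
  by rewrite lerD// e_le// ltnW.
have := gram_riemann_sum_error e_ge0 e_incr x _ _ mesh.
rewrite Px => /(_ (mul0r _) (divr_ge0 (mulr_ge0 _ _) _)) err.
by apply: le_trans (err _ _ _) _ => //; rewrite mulrAC.
Qed.

End GramRiemannSum.

Section NormalInvariant.
Variables (R : realType) (V : lmodType R[i]) (ip : hilbertForm V).
Local Notation hn := (hnorm ip).
Local Notation C := R[i].

Definition shift_op (A : V -> V) (c : C) (x : V) : V := A x - c *: x.

Lemma shift_op_linear A c : linear_op A -> linear_op (shift_op A c).
Proof.
move=> A_lin; apply: linear_op_sub A_lin _ => a x y.
by rewrite scalerDr !scalerA mulrC.
Qed.

Lemma shift_op_comm A S c : linear_op S -> op_comm S A -> op_comm S (shift_op A c).
Proof. by move=> S_lin SA x; rewrite /shift_op linopB// linopZ// SA. Qed.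

Lemma shift_op_bounded A K c : bounded_by ip K A -> bounded_by ip (K + normc c) (shift_op A c).
Proof.
by move=> AK x; rewrite mulrDl (le_trans (hnormB_le _ _ _))// hnormZ lerD.
Qed.

Section Polarization.
Variables N N' : V -> V.
Hypothesis N_normal : normal_with ip N N'.

Let N_lin : linear_op N. Proof. by case: N_normal. Qed.
Let NN' : is_adjoint ip N N'. Proof. by case: N_normal. Qed.
Let N'_lin : linear_op N'. Proof. exact: adjoint_linear NN'. Qed.

Lemma shift_op_normal c : normal_with ip (shift_op N c) (shift_op N' (conjc c)).
Proof.
have [_ _ N_comm] := N_normal; split; first exact: shift_op_linear.
  by move=> x y; rewrite ipBl ipBr ipZl ipZr NN' conjcK.
move=> x; rewrite /shift_op (linopB N_lin) (linopB N'_lin) (linopZ N_lin) (linopZ N'_lin).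
by rewrite N_comm; apply: (ip_ext (ip := ip)) => z; rewrite !(ipBl, ipZl); ring.
Qed.

Definition shift_gram c := gram (shift_op N c) (shift_op N' (conjc c)).

Lemma shift_gramE c x : shift_gram c x =
  N' (N x) - c *: N' x - conjc c *: N x + (c * conjc c) *: x.
Proof.
rewrite /shift_gram /gram /shift_op (linopB N'_lin) (linopZ N'_lin).
by apply: (ip_ext (ip := ip)) => z; rewrite !(ipDl, ipBl, ipZl, ipNl); ring.
Qed.

Lemma normal_polarization x : N x = 2^-1 *:
  ((shift_gram 0 x - shift_gram 1 x + x)
   - 'i%C *: (shift_gram 'i%C x - shift_gram 0 x - x)).
Proof.
have conj_i : conjc 'i%C = - 'i%C :> C by apply: complex_ext; rewrite /= ?oppr0.
have sqr_i : 'i%C * 'i%C = -1 :> C by apply: complex_ext => /=; ring.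
rewrite !shift_gramE conjc0 conjc1 conj_i; apply: (ip_ext (ip := ip)) => z.
by rewrite !(ipZl, ipDl, ipBl, ipNl); field: sqr_i.
Qed.

Variable K : R.
Hypothesis K0 : 0 <= K.
Hypothesis NK : bounded_by ip K N.

Definition corner (b : bool * bool) : C := (b.1%:R) +i* (b.2%:R).

Lemma normal_invariant (W : V -> Prop) : closed_subspace ip W ->
  (forall b k i, invariant (proj ip (specsub ip (shift_op N (corner b)) (i%:R / k.+1%:R))) W) ->
  invariant N W.
Proof.
move=> W_closed W_inv x Wx; have [W_sub _] := W_closed.
have W_gram b : W (shift_gram (corner b) x).
  apply: (gram_invariant (shift_op_normal _) _ (shift_op_bounded (corner b) NK)) => //.
  by rewrite addr_ge0 ?normc_ge0.
have W0 : W (shift_gram 0 x) := W_gram (false, false).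
have W1 : W (shift_gram 1 x) := W_gram (true, false).
have Wi : W (shift_gram 'i%C x) := W_gram (false, true).
rewrite normal_polarization; apply: subspaceZ => //; apply: subspaceB => //.
  by apply: subspaceD => //; exact: subspaceB.
by apply: subspaceZ => //; apply: subspaceB => //; exact: subspaceB.
Qed.

End Polarization.
End NormalInvariant.

(** * Commuting families of spectral projections *)

Section SpectralFamily.
Variables (R : realType) (V : lmodType R[i]) (ip : hilbertForm V).
Local Notation hn := (hnorm ip).

Lemma specproj_comm B B' K S S' L e : normal_with ip B B' -> 0 <= K -> bounded_by ip K B ->
  linear_op S -> is_adjoint ip S S' -> 0 <= L -> bounded_by ip L S -> bounded_by ip L S' ->
  op_comm S B -> 0 <= e -> op_comm (proj ip (specsub ip B e)) S.
Proof.
move=> B_normal K0 BK S_lin SS' L0 SL S'L SB e0; have [_ BB' _] := B_normal.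
apply: (proj_comm (specsub_closed B_normal K0 BK e0) S_lin SS').
  exact: specsub_comm SL SB.
move=> x /(specsub_adj B_normal) Mx; apply/(specsub_adj B_normal).
exact: (specsub_comm L0 S'L (adjoint_comm SS' BB' SB)).
Qed.

(* For bounded [N], this says that [N] belongs to the von Neumann algebra generated by
   the projections [P k]. *)
Definition subordinate (P : nat -> V -> V) (N : V -> V) : Prop :=
  (forall k, op_comm (P k) N) /\
  forall W, closed_subspace ip W -> (forall k, invariant (P k) W) -> invariant N W.

Variables (I : countType) (N : I -> V -> V).
Hypothesis N_lin : forall i, linear_op (N i).
Hypothesis N_normal : forall i, normal_op ip (N i).
Hypothesis N_contr : forall i, contraction ip (N i).
Hypothesis N_comm : forall i j, op_comm (N i) (N j).

Theorem spectral_family :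
  exists2 P, commuting_oprojs ip P & forall i, subordinate P (N i).
Proof.
have /choice[N' NN'] := N_normal.
have Nn i : normal_with ip (N i) (N' i) by have [] := NN' i.
have N1 i : bounded_by ip 1 (N i) := contraction_bounded (N_contr i).
have N'1 i : bounded_by ip 1 (N' i) by move=> x; rewrite (normal_hnorm (Nn i)); exact: N1.
have c0 c : 0 <= 1 + normc c :> R by rewrite addr_ge0 ?normc_ge0.
pose S (t : I * (bool * bool) * (nat * nat)) := shift_op (N t.1.1) (corner R t.1.2).
pose e (t : I * (bool * bool) * (nat * nat)) : R := t.2.2%:R / t.2.1.+1%:R.
have e0 t : 0 <= e t by rewrite divr_ge0.
pose Q t := proj ip (specsub ip (S t) (e t)).
have Q_oproj t : is_oproj ip (Q t).
  apply: proj_oproj; exact: (specsub_closed (shift_op_normal (Nn _) _) (c0 _)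
    (shift_op_bounded _ (N1 _)) (e0 t)).
have Q_comm t A A' : linear_op A -> is_adjoint ip A A' -> contraction ip A ->
    contraction ip A' -> op_comm A (N t.1.1) -> op_comm (Q t) A.
  move=> A_lin AA' A1 A'1 AN.
  apply: (specproj_comm (shift_op_normal (Nn _) _) (c0 _) (shift_op_bounded _ (N1 _))
    A_lin AA' ler01) => //.
  - exact: contraction_bounded.
  - exact: contraction_bounded.
  - exact: shift_op_comm.
have QN t i : op_comm (Q t) (N i).
  apply: (Q_comm t _ (N' i)) => //; first by have [] := NN' i.
  by move=> x; rewrite -[leRHS]mul1r; exact: N'1.
have QQ t s : op_comm (Q t) (Q s).
  have Qs_contr := oproj_contraction (Q_oproj s); have [Qs_lin _ Qs_adj] := Q_oproj s.
  by apply: (Q_comm t _ (Q s)) => // x; rewrite QN.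
pose P k := if unpickle k is Some t then Q t else id.
exists P; [split=> [k|k l]|move=> i; split=> [k|W W_closed W_inv]].
- by rewrite /P; case: unpickle => [t //|]; split.
- by rewrite /P; case: unpickle => // t; case: unpickle.
- by rewrite /P; case: unpickle.
- apply: (normal_invariant (Nn i) ler01 (N1 i) W_closed) => b k j.
  by have := W_inv (pickle ((i, b), (k, j))); rewrite /P pickleK.
Qed.

End SpectralFamily.

(** * The binary tree of products of commuting projections *)

Section ProjectionTree.
Variables (R : realType) (V : lmodType R[i]) (ip : innerProduct V).
Local Notation hn := (hnorm ip).
Variable P : nat -> V -> V.
Hypothesis P_comm : commuting_oprojs ip P.

Definition branch (k : nat) (b : bool) (x : V) : V := if b then P k x else x - P k x.

Fixpoint treeproj (k : nat) (p : seq bool) (x : V) : V :=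
  if p is b :: q then treeproj k.+1 q (branch k b x) else x.

(* [treeproj k p x] is represented by the indicator of a subinterval of
   [0, |x|^2[ of length |treeproj k p x|^2: the left child of a node gets the
   left part of the interval of the node. *)
Fixpoint tree_start (k : nat) (p : seq bool) (x : V) : R :=
  if p is b :: q then
    (if b then hn (branch k false x) ^+ 2 else 0) + tree_start k.+1 q (branch k b x)
  else 0.

Definition tree_itv (k : nat) (p : seq bool) (x : V) : set R :=
  `[tree_start k p x, tree_start k p x + hn (treeproj k p x) ^+ 2[.

Let P_lin k : linear_op (P k). Proof. by case: (P_comm.1 k). Qed.

Lemma branch_oproj k b : is_oproj ip (branch k b).
Proof. by case: b; [exact: P_comm.1|apply: oprojC; exact: P_comm.1]. Qed.

Lemma branch_comm S k b : linear_op S -> (forall k, op_comm (P k) S) ->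
  op_comm (branch k b) S.
Proof. by move=> S_lin PS x; case: b; rewrite /branch ?linopB// PS. Qed.

Lemma treeproj_comm S k p : linear_op S -> (forall k, op_comm (P k) S) ->
  op_comm (treeproj k p) S.
Proof. by move=> S_lin PS; elim: p k => //= b p IH k x; rewrite branch_comm// IH. Qed.

Lemma treeproj_branch j p k b : op_comm (treeproj j p) (branch k b).
Proof.
have [branch_lin _ _] := branch_oproj k b; apply: treeproj_comm => // l x.
by rewrite (branch_comm _ _ (P_lin l))// => m; exact: P_comm.2.
Qed.

Lemma treeproj_oproj k p : is_oproj ip (treeproj k p).
Proof.
elim: p k => [|b p IH] k; first by split.
have [p_lin p_idem p_adj] := IH k.+1; have [b_lin b_idem b_adj] := branch_oproj k b.
split=> [|x|x y] /=.
- exact: linear_op_comp p_lin b_lin.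
- by rewrite -treeproj_branch p_idem b_idem.
- by rewrite p_adj b_adj treeproj_branch.
Qed.

Lemma ip_treeproj k p x : ip x (treeproj k p x) = (hn (treeproj k p x) ^+ 2)%:C.
Proof.
have [_ p_idem p_adj] := treeproj_oproj k p.
by rewrite -{1}p_idem -p_adj ip_self.
Qed.

Lemma branch_hnorm_sqr k x :
  hn x ^+ 2 = hn (branch k false x) ^+ 2 + hn (branch k true x) ^+ 2.
Proof. by rewrite addrC -(oproj_pythagoras _ (P_comm.1 k)). Qed.

Lemma branch_idem k b x : branch k b (branch k b x) = branch k b x.
Proof. by case: (branch_oproj k b). Qed.

Lemma branch_negb k b x : branch k b (branch k (~~ b) x) = 0.
Proof.
have [_ P_idem _] := P_comm.1 k.
by case: b; rewrite /branch /= ?(linopB (P_lin k)) P_idem subrr ?subr0.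
Qed.

Lemma tree_start_ge0 k p x : 0 <= tree_start k p x.
Proof.
by elim: p k x => //= b p IH k x; rewrite addr_ge0//; case: b => //; exact: sqr_ge0.
Qed.

Lemma tree_end_le k p x : tree_start k p x + hn (treeproj k p x) ^+ 2 <= hn x ^+ 2.
Proof.
elim: p k x => [|b p IH] k x /=; first by rewrite add0r.
rewrite (branch_hnorm_sqr k x) -addrA; apply: le_trans (lerD (lexx _) (IH _ _)) _.
by case: b; rewrite ?add0r// lerDl sqr_ge0.
Qed.

Lemma tree_itvP k p x r : tree_itv k p x r <->
  tree_start k p x <= r < tree_start k p x + hn (treeproj k p x) ^+ 2.
Proof. by rewrite /tree_itv /= in_itv. Qed.

Lemma tree_itv_nil k x r : tree_itv k [::] x r <-> 0 <= r < hn x ^+ 2.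
Proof. by rewrite tree_itvP /= add0r. Qed.

Lemma tree_itv_cons k b p x r : tree_itv k (b :: p) x r <->
  tree_itv k.+1 p (branch k b x) (r - (if b then hn (branch k false x) ^+ 2 else 0)).
Proof.
by rewrite !tree_itvP /= lerBrDl ltrBlDl addrA.
Qed.

Lemma tree_itv_sub k p x : tree_itv k p x `<=` tree_itv k [::] x.
Proof.
move=> r /tree_itvP/andP[lo hi]; apply/tree_itv_nil.
by rewrite (le_trans (tree_start_ge0 k p x))// (lt_le_trans hi)// tree_end_le.
Qed.

Lemma tree_itv_branch k p q b x :
  tree_itv k (b :: p) x `&` tree_itv k (~~ b :: q) x = set0.
Proof.
rewrite -subset0 => r [/tree_itv_cons/tree_itv_sub/tree_itv_nil + ].
move=> + /tree_itv_cons/tree_itv_sub/tree_itv_nil.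
by case: b => /= /andP[? ?] /andP[? ?]; lra.
Qed.

Lemma tree_trichotomy k p q x :
  [\/ tree_itv k p x `<=` tree_itv k q x /\
        treeproj k p (treeproj k q x) = treeproj k p x,
      tree_itv k q x `<=` tree_itv k p x /\
        treeproj k p (treeproj k q x) = treeproj k q x |
      tree_itv k p x `&` tree_itv k q x = set0 /\
        treeproj k p (treeproj k q x) = 0].
Proof.
elim: p k q x => [|b p IH] k q x.
  by apply: Or32; split=> //; exact: tree_itv_sub.
case: q => [|c q]; first by apply: Or31; split=> //; exact: tree_itv_sub.
have [->|bc] := eqVneq c b; last first.
  have -> : c = ~~ b by case: b c bc => -[].
  apply: Or33; split; first exact: tree_itv_branch.
  rewrite /= -treeproj_branch branch_negb.
  have [p_lin _ _] := treeproj_oproj k.+1 p; have [q_lin _ _] := treeproj_oproj k.+1 q.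
  by rewrite (linop0 q_lin) (linop0 p_lin).
rewrite /= -treeproj_branch branch_idem; set y := branch k b x.
have [[sub ->]|[sub ->]|[disj ->]] := IH k.+1 q y.
- by apply: Or31; split=> // r /tree_itv_cons/sub/tree_itv_cons.
- by apply: Or32; split=> // r /tree_itv_cons/sub/tree_itv_cons.
- apply: Or33; split=> //; rewrite -subset0 => r [/tree_itv_cons pr /tree_itv_cons qr].
  by move/seteqP: disj => [disj _]; exact: (disj _ (conj pr qr)).
Qed.

Lemma subspace_treeproj (M : V -> Prop) : subspace M ->
  forall j k x, (forall p, M (treeproj k p x)) -> M (P (k + j) x).
Proof.
move=> M_sub; elim=> [|j IH] k x Mx; first by rewrite addn0; exact: (Mx [:: true]).
have -> : x = branch k true x + branch k false x by rewrite addrC subrK.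
rewrite linopD// addnS -addSn; apply: subspaceD => //; apply: IH => p.
  exact: (Mx (true :: p)).
exact: (Mx (false :: p)).
Qed.

Definition orthogonal_cyclic (S : set V) : Prop :=
  forall u v p, S u -> S v -> u != v -> ip u (treeproj 0 p v) = 0.

Definition cyclic_total (S : set V) : Prop :=
  forall w, (forall v p, S v -> ip w (treeproj 0 p v) = 0) -> w = 0.

Lemma orthogonal_cyclic_total_exists : exists S, orthogonal_cyclic S /\ cyclic_total S.
Proof.
have [S [S_orth S_max]] : exists S, orthogonal_cyclic S /\
    forall S', S `<` S' -> ~ orthogonal_cyclic S'.
  apply: Zorn_bigcup => F F_orth F_tot u v p [A FA Au] [B FB Bv] uv.
  have [AB|BA] := F_tot _ _ FA FB.
  - by apply: (F_orth B) => //; exact: AB.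
  - by apply: (F_orth A) => //; exact: BA.
exists S; split=> // w w_orth; have [Sw|Sw] := pselect (S w).
  apply: (hnorm_eq0 (ip := ip)); apply/eqP; rewrite -sqrf_eq0 hnorm_sqr.
  by rewrite /rip (w_orth w [::]).
have w_orth' v p : S v -> ip v (treeproj 0 p w) = 0.
  by move=> Sv; have [_ _ <-] := treeproj_oproj 0 p; apply/ip_eq0_sym/w_orth.
exfalso; apply: (S_max (S `|` [set w])).
  by split=> [v|/(_ w) Sw']; [left|apply/Sw/Sw'; right].
move=> u v p [Su|->] [Sv|->] uv; [exact: S_orth|exact: w_orth'|exact: w_orth|].
by rewrite eqxx in uv.
Qed.

End ProjectionTree.

(** * Square-integrable functions *)

Section ComplexIndicator.
Variables (R : realType) (X : Type).
Implicit Types A B : set X.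

Definition cindic A (x : X) : R[i] := (\1_A x)%:C.

Lemma cindic_in A x : A x -> cindic A x = 1.
Proof. by move=> Ax; rewrite /cindic indicE mem_set. Qed.

Lemma cindic_out A x : ~ A x -> cindic A x = 0.
Proof. by move=> Ax; rewrite /cindic indicE memNset. Qed.

Lemma cindicI A B x : cindic (A `&` B) x = cindic A x * cindic B x.
Proof. by rewrite /cindic indicI rmorphM. Qed.

Lemma cindicD A B x : B `<=` A -> cindic (A `\` B) x = cindic A x - cindic B x.
Proof.
move=> BA; have [Bx|Bx] := pselect (B x).
  by rewrite cindic_out ?(cindic_in (BA _ Bx)) ?cindic_in ?subrr// => -[].
rewrite (cindic_out Bx) subr0; have [Ax|Ax] := pselect (A x).
  by rewrite !cindic_in.
by rewrite !cindic_out// => -[].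
Qed.

Lemma cnorm2_cindic A x : cnorm2 (cindic A x) = \1_A x.
Proof.
by rewrite cnorm2E normc_real ger0_norm// indicE; case: (_ \in _); rewrite ?expr1n ?expr0n.
Qed.

Lemma normc_cindic_le1 A x : normc (cindic A x) <= 1.
Proof. by rewrite normc_real ger0_norm// indicE; case: (_ \in _); rewrite ?ler01. Qed.

End ComplexIndicator.

Section SquareIntegrable.
Context {d : measure_display} {X : measurableType d} {R : realType}.
Variable mu : {measure set X -> \bar R}.
Local Notation C := R[i].
Implicit Types f g : X -> C.

Lemma cmeasurable_cst (a : C) : cmeasurable (fun _ : X => a).
Proof. by split; exact: measurable_cst. Qed.

Lemma cmeasurableD f g : cmeasurable f -> cmeasurable g -> cmeasurable (fun x => f x + g x).
Proof.
move=> [Re_f Im_f] [Re_g Im_g]; split.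
- by under eq_fun do rewrite Re_add; exact: measurable_funD.
- by under eq_fun do rewrite Im_add; exact: measurable_funD.
Qed.

Lemma cmeasurableM f g : cmeasurable f -> cmeasurable g -> cmeasurable (fun x => f x * g x).
Proof.
move=> [Re_f Im_f] [Re_g Im_g]; split.
- by under eq_fun do rewrite Re_mul; apply: measurable_funB; exact: measurable_funM.
- by under eq_fun do rewrite Im_mul; apply: measurable_funD; exact: measurable_funM.
Qed.

Lemma cmeasurableZ a f : cmeasurable f -> cmeasurable (fun x => a * f x).
Proof. by apply: cmeasurableM; exact: cmeasurable_cst. Qed.

Lemma cmeasurableB f g : cmeasurable f -> cmeasurable g -> cmeasurable (fun x => f x - g x).
Proof.
move=> mf /(cmeasurableZ (-1)); under eq_fun do rewrite mulN1r.
exact: cmeasurableD.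
Qed.

Lemma cmeasurable_real (u : X -> R) : measurable_fun setT u ->
  cmeasurable (fun x => (u x)%:C).
Proof. by move=> mu_; split => //=; exact: measurable_cst. Qed.

Lemma cmeasurable_indic (A : set X) : measurable A -> cmeasurable (@cindic R X A).
Proof. by move=> mA; apply: cmeasurable_real; exact: measurable_indic. Qed.

Lemma measurable_cnorm2 f : cmeasurable f -> measurable_fun setT (fun x => cnorm2 (f x)).
Proof. by move=> [Re_f Im_f]; apply: measurable_funD; exact: measurable_funX. Qed.

Lemma measurable_normc f : cmeasurable f -> measurable_fun setT (fun x => normc (f x)).
Proof.
move=> mf; rewrite (_ : (fun x => _) = (fun x => cnorm2 (f x) `^ 2^-1)).
  by apply: (measurableT_comp (measurable_powR _)); exact: measurable_cnorm2.
apply/funext => x.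
by rewrite powR12_sqrt cnorm2E ?sqr_ge0// sqrtr_sqr ger0_norm ?normc_ge0.
Qed.

Lemma cmeasurableV f : cmeasurable f -> cmeasurable (fun x => (f x)^-1).
Proof.
move=> mf; have fV x : (f x)^-1 = (cnorm2 (f x) `^ (-1))%:C * conjc (f x).
  have [->|f0] := eqVneq (f x) 0; first by rewrite invr0 conjc0 mulr0.
  apply: (mulfI f0); rewrite mulfV// mulrCA mulr_conjc -cnorm2E powR_inv1; last first.
    by rewrite cnorm2E sqr_ge0.
  rewrite -rmorphM mulVf// cnorm2E sqrf_eq0; apply: contraNneq f0 => /eq0_normc ->.
  by rewrite eqxx.
under eq_fun do rewrite fV; apply: cmeasurableM.
  apply: cmeasurable_real; apply: (measurableT_comp (measurable_powR _)).
  exact: measurable_cnorm2.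
case: mf => Re_f Im_f; split; first by under eq_fun do rewrite Re_conjc.
by under eq_fun do rewrite Im_conjc; exact: measurableT_comp.
Qed.

Lemma cmeasurable_eq0 f : cmeasurable f -> measurable [set x | f x = 0].
Proof.
move=> /measurable_cnorm2 mf; have := mf measurableT [set 0] (measurable_set1 _).
rewrite setTI; congr measurable; apply/seteqP; split=> x /=; rewrite cnorm2E.
  by move/eqP; rewrite sqrf_eq0 => /eqP/eq0_normc.
by move=> ->; rewrite normc0 expr0n.
Qed.

Let cnorm2_EFin_ge0 f x : (0 <= (cnorm2 (f x))%:E)%E.
Proof. by rewrite lee_fin cnorm2E sqr_ge0. Qed.

Let measurable_cnorm2_EFin f : cmeasurable f ->
  measurable_fun setT (fun x => (cnorm2 (f x))%:E).
Proof. by move=> /measurable_cnorm2 mf; exact/measurable_EFinP. Qed.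

Definition l2norm f : R := Num.sqrt (fine (\int[mu]_x (cnorm2 (f x))%:E)).

Lemma l2norm_ge0 f : 0 <= l2norm f. Proof. exact: sqrtr_ge0. Qed.

Lemma l2norm0 : l2norm (fun=> 0) = 0.
Proof.
rewrite /l2norm; under eq_integral do rewrite cnorm2E normc0 expr0n.
by rewrite integral0 sqrtr0.
Qed.

Lemma integral_cnorm2_ge0 f : (0 <= \int[mu]_x (cnorm2 (f x))%:E)%E.
Proof. by apply: integral_ge0. Qed.

Lemma integral_cnorm2 f : cL2 mu f ->
  (\int[mu]_x (cnorm2 (f x))%:E)%E = (l2norm f ^+ 2)%:E.
Proof.
move=> [mf f_fin]; rewrite sqr_sqrtr ?fine_ge0 ?integral_cnorm2_ge0//.
by rewrite fineK// ge0_fin_numE ?integral_cnorm2_ge0.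
Qed.

Lemma cL2_l2norm_le f (K : R) : cmeasurable f -> 0 <= K ->
  (\int[mu]_x (cnorm2 (f x))%:E <= (K ^+ 2)%:E)%E -> cL2 mu f /\ l2norm f <= K.
Proof.
move=> mf K0 fK; have L2f : cL2 mu f by split=> //; exact: le_lt_trans fK (ltry _).
by split=> //; move: fK; rewrite integral_cnorm2// lee_fin ler_sqr ?nnegrE ?l2norm_ge0.
Qed.

Lemma l2norm_ae_le (K : R) f g : cmeasurable f -> cL2 mu g -> 0 <= K ->
  {ae mu, forall x, normc (f x) <= K * normc (g x)} ->
  cL2 mu f /\ l2norm f <= K * l2norm g.
Proof.
move=> mf L2g K0 fg; have [mg _] := L2g.
apply: cL2_l2norm_le => //; first by rewrite mulr_ge0 ?l2norm_ge0.
rewrite exprMn EFinM -integral_cnorm2// -ge0_integralZl_EFin ?sqr_ge0//; last first.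
  exact: measurable_cnorm2_EFin.
apply: ae_ge0_le_integral => //.
- exact: measurable_cnorm2_EFin.
- by move=> x _; rewrite mule_ge0// lee_fin sqr_ge0.
- by apply: measurable_funeM; exact: measurable_cnorm2_EFin.
apply: filterS fg => x fg_x _; rewrite -EFinM lee_fin !cnorm2E -exprMn.
by rewrite ler_sqr ?nnegrE ?mulr_ge0 ?normc_ge0.
Qed.

Lemma l2norm_le f g : cmeasurable f -> cL2 mu g ->
  {ae mu, forall x, normc (f x) <= normc (g x)} -> cL2 mu f /\ l2norm f <= l2norm g.
Proof.
move=> mf L2g fg; rewrite -[l2norm g]mul1r; apply: l2norm_ae_le => //.
by apply: filterS fg => x; rewrite mul1r.
Qed.

Lemma l2norm_ae_eq f g : cL2 mu f -> cmeasurable g -> {ae mu, forall x, f x = g x} ->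
  cL2 mu g /\ l2norm g = l2norm f.
Proof.
move=> L2f mg fg; have [|L2g gf_le] := l2norm_le mg L2f; first by apply: filterS fg => x ->.
split=> //; apply/le_anti; rewrite gf_le; have [|//] := l2norm_le L2f.1 L2g.
by apply: filterS fg => x ->.
Qed.

Lemma l2norm_mul_le (K : R) g f : cmeasurable g -> {ae mu, forall x, normc (g x) <= K} ->
  0 <= K -> cL2 mu f ->
  cL2 mu (fun x => g x * f x) /\ l2norm (fun x => g x * f x) <= K * l2norm f.
Proof.
move=> mg gK K0 L2f; apply: l2norm_ae_le (cmeasurableM mg L2f.1) L2f K0 _.
by apply: filterS gK => x gxK; rewrite normcM ler_wpM2r ?normc_ge0.
Qed.

Lemma l2normZ_le a f : cL2 mu f ->
  cL2 mu (fun x => a * f x) /\ l2norm (fun x => a * f x) <= normc a * l2norm f.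
Proof.
by apply: l2norm_mul_le; [exact: cmeasurable_cst|exact: nearW|exact: normc_ge0].
Qed.

Lemma cL2Z a f : cL2 mu f -> cL2 mu (fun x => a * f x).
Proof. by move=> /(l2normZ_le a)[]. Qed.

Lemma l2norm_distC f g : l2norm (fun x => f x - g x) = l2norm (fun x => g x - f x).
Proof.
by congr (Num.sqrt (fine _)); apply: eq_integral => x _; rewrite !cnorm2E normc_distC.
Qed.

Lemma Lnorm_normc f : cL2 mu f ->
  ('N[mu]_2%:E[EFin \o (fun x => normc (f x))] = (l2norm f)%:E)%E.
Proof.
move=> L2f; rewrite unlock /Lnorm.
under eq_integral => x _.
  rewrite /= ger0_norm ?normc_ge0// powR_mulrn ?normc_ge0// -cnorm2E.
  over.
rewrite integral_cnorm2// poweR_EFin powR12_sqrt ?sqr_ge0//.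
by rewrite sqrtr_sqr ger0_norm// l2norm_ge0.
Qed.

Lemma l2normD_le f g : cL2 mu f -> cL2 mu g ->
  cL2 mu (fun x => f x + g x) /\ l2norm (fun x => f x + g x) <= l2norm f + l2norm g.
Proof.
move=> L2f L2g; have mf := measurable_normc L2f.1; have mg := measurable_normc L2g.1.
apply: cL2_l2norm_le; [exact: cmeasurableD L2f.1 L2g.1|by rewrite addr_ge0 ?l2norm_ge0|].
have := minkowski_EFin mu mf mg (ler1n R 2); rewrite !Lnorm_normc// -EFinD => mink.
pose u x := normc (f x) + normc (g x).
have u0 x : 0 <= u x by rewrite addr_ge0 ?normc_ge0.
have uE : (\int[mu]_x (u x ^+ 2)%:E = 'N[mu]_2%:E[EFin \o u] `^ 2)%E.
  rewrite poweR_Lnorm//; apply: eq_integral => x _.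
  by rewrite /= ger0_norm// powR_mulrn.
apply: (@le_trans _ _ (\int[mu]_x (u x ^+ 2)%:E)%E).
  apply: ge0_le_integral => //.
  - by move=> x _; rewrite lee_fin cnorm2E sqr_ge0.
  - exact: (measurable_cnorm2_EFin (cmeasurableD L2f.1 L2g.1)).
  - by apply/measurable_EFinP/measurable_funX; exact: measurable_funD.
  - by move=> x _; rewrite lee_fin cnorm2E ler_sqr ?nnegrE ?normc_ge0// le_normcD.
have sum_ge0 : 0 <= l2norm f + l2norm g by rewrite addr_ge0 ?l2norm_ge0.
rewrite uE -(powR_mulrn _ sum_ge0) -poweR_EFin gt0_ler_poweR//.
- by rewrite in_itv /= Lnorm_ge0 leey.
- by rewrite in_itv /= lee_fin sum_ge0 leey.
Qed.

Lemma l2normB_le f g : cL2 mu f -> cL2 mu g ->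
  cL2 mu (fun x => f x - g x) /\ l2norm (fun x => f x - g x) <= l2norm f + l2norm g.
Proof.
move=> L2f L2g; have [|L2N lN] := l2norm_le (cmeasurableZ (-1) L2g.1) L2g.
  by apply: nearW => x; rewrite mulN1r normcN.
have [L2B lB] := l2normD_le L2f L2N; move: L2B lB; under eq_fun do rewrite mulN1r.
by move=> L2B lB; split=> //; apply: le_trans lB _; rewrite lerD2l.
Qed.

Lemma cL2D f g : cL2 mu f -> cL2 mu g -> cL2 mu (fun x => f x + g x).
Proof. by move=> L2f L2g; case: (l2normD_le L2f L2g). Qed.

Lemma cL2B f g : cL2 mu f -> cL2 mu g -> cL2 mu (fun x => f x - g x).
Proof. by move=> L2f L2g; case: (l2normB_le L2f L2g). Qed.

Lemma l2norm_dist_triangle g f h : cL2 mu f -> cL2 mu g -> cL2 mu h ->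
  l2norm (fun x => f x - h x) <= l2norm (fun x => f x - g x) + l2norm (fun x => g x - h x).
Proof.
move=> L2f L2g L2h; have [_] := l2normD_le (cL2B L2f L2g) (cL2B L2g L2h).
by congr (_ <= _); congr l2norm; apply/funext => x; rewrite addrA subrK.
Qed.

Lemma l2norm_dist_ge f g : cL2 mu f -> cL2 mu g ->
  `|l2norm f - l2norm g| <= l2norm (fun x => f x - g x).
Proof.
have ge u v : cL2 mu u -> cL2 mu v -> l2norm u - l2norm v <= l2norm (fun x => u x - v x).
  move=> L2u L2v; rewrite lerBlDr; have [_] := l2normD_le (cL2B L2u L2v) L2v.
  by under [X in l2norm X <= _]eq_fun do rewrite subrK.
by move=> L2f L2g; rewrite ler_norml ge// andbT lerNl opprB l2norm_distC ge.
Qed.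

Lemma l2norm_eq0 f : cL2 mu f -> l2norm f = 0 -> {ae mu, forall x, f x = 0}.
Proof.
move=> L2f f0; have mf := measurable_cnorm2_EFin L2f.1.
have : ae_eq mu setT (fun x => (cnorm2 (f x))%:E) (cst 0%E).
  apply/ae_eq_integral_abs => //; under eq_integral do rewrite gee0_abs//.
  by rewrite integral_cnorm2// f0 expr0n.
apply: filterS => x /(_ Logic.I) /= /eqP; rewrite eqe cnorm2E sqrf_eq0.
by move=> /eqP/eq0_normc.
Qed.

Lemma integral_cnorm2_indic A : measurable A ->
  (\int[mu]_x (cnorm2 (cindic R A x))%:E)%E = mu A.
Proof.
move=> mA; under eq_integral do rewrite cnorm2_cindic.
by rewrite integral_indic// setIT.
Qed.

Lemma cL2_indic A : measurable A -> (mu A < +oo)%E -> cL2 mu (@cindic R X A).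
Proof. by move=> mA Afin; split; [exact: cmeasurable_indic|rewrite integral_cnorm2_indic]. Qed.

End SquareIntegrable.

Section LimitInferior.
Context {R : realType}.
Implicit Types u : nat -> \bar R.
Local Open Scope ereal_scope.

Lemma limn_einf_ge0 u : (forall n, 0 <= u n) -> 0 <= limn_einf u.
Proof.
move=> u0; rewrite limn_einf_lim; apply: lime_ge; first exact: is_cvg_einfs.
by apply: nearW => n; apply: le_ereal_inf_tmp => _ [k _ <-].
Qed.

Lemma limn_einf_le u x : (forall n, u n <= x) -> limn_einf u <= x.
Proof.
move=> ux; rewrite limn_einf_lim; apply: lime_le; first exact: is_cvg_einfs.
by apply: nearW => n; apply: ge_ereal_inf; exists (u n) => //; exists n => /=.
Qed.

Lemma limn_einf_lt_frequently u x : limn_einf u < x ->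
  forall N, exists2 n, (N <= n)%N & u n < x.
Proof.
rewrite limn_einf_lim (cvg_lim _ (@cvg_einfs_sup R u))// => u_lt N.
have [|_ [n Nn <-] un] := @ereal_inf_lt _ (sdrop u N) x; last by exists n.
by apply: le_lt_trans u_lt; apply: ereal_sup_ubound; exists N.
Qed.

Lemma measurable_limn_einf d (T : measurableType d) (f : nat -> T -> \bar R) :
  (forall n, measurable_fun setT (f n)) ->
  measurable_fun setT (fun x => limn_einf (f ^~ x)).
Proof.
move=> mf; apply: measurableT_comp; first exact: oppe_measurable.
by apply: measurable_fun_limn_esup => n; exact: measurableT_comp.
Qed.

End LimitInferior.

Section ComplexConvergence.
Variable R : realType.
Implicit Types (z : nat -> R[i]) (w : R[i]).

Definition ccvg z w : Prop := (fun n => normc (z n - w)) @ \oo --> (0 : R).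

Lemma ccvg_Re z w : ccvg z w -> (fun n => complex.Re (z n)) @ \oo --> complex.Re w.
Proof.
move=> zw; apply/subr_cvg0/norm_cvg0P; apply: squeeze_cvg0 zw => n.
by rewrite normr_ge0 -Re_opp -Re_add Re_le_normc.
Qed.

Lemma ccvg_Im z w : ccvg z w -> (fun n => complex.Im (z n)) @ \oo --> complex.Im w.
Proof.
move=> zw; apply/subr_cvg0/norm_cvg0P; apply: squeeze_cvg0 zw => n.
by rewrite normr_ge0 -Im_opp -Im_add Im_le_normc.
Qed.

Lemma ccvg_ReIm z w : (fun n => complex.Re (z n)) @ \oo --> complex.Re w ->
  (fun n => complex.Im (z n)) @ \oo --> complex.Im w -> ccvg z w.
Proof.
move=> /subr_cvg0/(norm_cvg0P _).2 Re_zw /subr_cvg0/(norm_cvg0P _).2 Im_zw.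
apply: (@squeeze_cvg0 _ _ (fun n => `|complex.Re (z n) - complex.Re w| +
                                  `|complex.Im (z n) - complex.Im w|)) => [n|].
  by rewrite normc_ge0 -Re_opp -Re_add -Im_opp -Im_add normc_le_ReIm.
by rewrite -[X in _ --> X](addr0 0); exact: cvgD.
Qed.

Lemma ccvg_normc z w : ccvg z w -> (fun n => normc (z n)) @ \oo --> normc w.
Proof.
have dist_ge u v : normc u - normc v <= normc (u - v).
  by rewrite lerBlDr -{1}[u](subrK v) le_normcD.
move=> zw; apply/subr_cvg0/norm_cvg0P; apply: squeeze_cvg0 zw => n.
by rewrite normr_ge0 ler_norml dist_ge andbT lerNl opprB normc_distC dist_ge.
Qed.

Lemma cvg_of_geometric_increments (u : nat -> R) (c : R) :
  (forall n, `|u n.+1 - u n| <= c * 2^-1 ^+ n) -> cvgn u.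
Proof.
move=> u_incr; have u_series : cvgn (series (telescope u)).
  apply: normed_cvg; apply: (@series_le_cvg _ _ (geometric c 2^-1)) => //= [n|].
    by rewrite /geometric /= (le_trans _ (u_incr n)).
  by apply: is_cvg_geometric_series; rewrite ger0_norm ?invr_ge0// invf_lt1// ltr1n.
have -> : u = (fun n => u 0 + series (telescope u) n) by apply/funext => n; exact: eq_sum_telescope.
by apply: is_cvgD => //; exact: is_cvg_cst.
Qed.

Lemma ccvg_of_geometric_increments z (c : R) :
  (forall n, normc (z n.+1 - z n) <= c * 2^-1 ^+ n) -> exists w, ccvg z w.
Proof.
move=> z_incr.
have /cvg_ex[a Re_z] : cvgn (fun n => complex.Re (z n)).
  apply: (@cvg_of_geometric_increments _ c) => n; apply: le_trans (z_incr n).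
  by rewrite -Re_opp -Re_add Re_le_normc.
have /cvg_ex[b Im_z] : cvgn (fun n => complex.Im (z n)).
  apply: (@cvg_of_geometric_increments _ c) => n; apply: le_trans (z_incr n).
  by rewrite -Im_opp -Im_add Im_le_normc.
by exists (a +i* b); exact: ccvg_ReIm.
Qed.
End ComplexConvergence.

Section L2Convergence.
Context {d : measure_display} {X : measurableType d} {R : realType}.
Variable mu : {measure set X -> \bar R}.
Local Notation C := R[i].
Local Notation l2norm := (l2norm mu).
Implicit Types f g : X -> C.

Definition l2cvg (f : nat -> X -> C) g : Prop :=
  (fun n => l2norm (fun x => f n x - g x)) @ \oo --> (0 : R).

Lemma l2cvg_l2norm (f : nat -> X -> C) g : (forall n, cL2 mu (f n)) -> cL2 mu g ->
  l2cvg f g -> (fun n => l2norm (f n)) @ \oo --> l2norm g.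
Proof.
move=> L2f L2g fg; apply/subr_cvg0/norm_cvg0P; apply: squeeze_cvg0 fg => n.
by rewrite normr_ge0 l2norm_dist_ge.
Qed.

Lemma l2cvg_lin a (f1 f2 : nat -> X -> C) g1 g2 :
  (forall n, cL2 mu (f1 n)) -> (forall n, cL2 mu (f2 n)) -> cL2 mu g1 -> cL2 mu g2 ->
  l2cvg f1 g1 -> l2cvg f2 g2 ->
  l2cvg (fun n x => a * f1 n x + f2 n x) (fun x => a * g1 x + g2 x).
Proof.
move=> L2f1 L2f2 L2g1 L2g2 fg1 fg2.
apply: (@squeeze_cvg0 _ _ (fun n => normc a * l2norm (fun x => f1 n x - g1 x) +
                                    l2norm (fun x => f2 n x - g2 x))) => [n|].
  rewrite l2norm_ge0 /=.
  have L2d1 := cL2B (L2f1 n) L2g1; have L2d2 := cL2B (L2f2 n) L2g2.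
  under [X in l2norm X <= _]eq_fun do rewrite opprD addrACA -mulrBr.
  by rewrite (le_trans (l2normD_le (cL2Z a L2d1) L2d2).2)// lerD2r (l2normZ_le a L2d1).2.
rewrite -[X in _ --> X](addr0 0) -{1}(mulr0 (normc a)).
by apply: cvgD => //; exact: cvgMr.
Qed.

Lemma ae_lim_cmeasurable (f : nat -> X -> C) : (forall n, cmeasurable (f n)) ->
  {ae mu, forall x, exists w, ccvg (fun n => f n x) w} ->
  exists2 g, cmeasurable g & {ae mu, forall x, ccvg (fun n => f n x) (g x)}.
Proof.
move=> mf [Z [mZ Z0 f_cvg]]; pose A := ~` Z; have mA : measurable A := measurableC mZ.
have f_lim x : A x -> exists w, ccvg (fun n => f n x) w.
  by move=> Ax; apply: contrapT => no_lim; apply: Ax; exact: f_cvg.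
have /choice[h fh] : forall x, exists w, A x -> ccvg (fun n => f n x) w.
  move=> x; have [Ax|nAx] := pselect (A x); last by exists 0.
  by have [w ?] := f_lim x Ax; exists w.
pose g x := cindic R A x * h x.
have fg x : ccvg (fun n => cindic R A x * f n x) (g x).
  rewrite /g; have [Ax|nAx] := pselect (A x).
    by rewrite cindic_in// mul1r; under eq_fun do rewrite mul1r; exact: fh.
  rewrite /ccvg; under eq_fun do rewrite cindic_out// !mul0r subrr normc0.
  exact: cvg_cst.
have mAf n : cmeasurable (fun x => cindic R A x * f n x).
  by apply: cmeasurableM => //; exact: cmeasurable_indic.
exists g; first split.
- apply: (@measurable_fun_cvg _ _ _ _ (fun n x => complex.Re (cindic R A x * f n x))).
    by move=> n; case: (mAf n).
  by move=> x _; exact: ccvg_Re (fg x).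
- apply: (@measurable_fun_cvg _ _ _ _ (fun n x => complex.Im (cindic R A x * f n x))).
    by move=> n; case: (mAf n).
  by move=> x _; exact: ccvg_Im (fg x).
exists Z; split=> // x /= not_cvg; apply: contrapT => Ax; apply: not_cvg.
by have := fg x; rewrite cindic_in//; under eq_fun do rewrite mul1r.
Qed.

Lemma l2norm_fatou (h : nat -> X -> C) g (K : R) : (forall n, cL2 mu (h n)) ->
  cmeasurable g -> (forall n, l2norm (h n) <= K) ->
  {ae mu, forall x, ccvg (fun n => h n x) (g x)} -> cL2 mu g /\ l2norm g <= K.
Proof.
move=> L2h mg hK hg; have K0 : 0 <= K := le_trans (l2norm_ge0 _ _) (hK 0).
have mh n : measurable_fun setT (fun x => (cnorm2 (h n x))%:E).
  by apply/measurable_EFinP/measurable_cnorm2; case: (L2h n).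
apply: cL2_l2norm_le => //.
apply: (@le_trans _ _ (\int[mu]_x limn_einf (fun n => (cnorm2 (h n x))%:E))%E).
  apply: ae_ge0_le_integral => //.
  - by move=> x _; rewrite lee_fin cnorm2E sqr_ge0.
  - exact/measurable_EFinP/measurable_cnorm2.
  - by move=> x _; apply: limn_einf_ge0 => n; rewrite lee_fin cnorm2E sqr_ge0.
  - exact: measurable_limn_einf.
  apply: filterS hg => x hgx _.
  have hgx2 : (fun n => (cnorm2 (h n x))%:E) @ \oo --> (cnorm2 (g x))%:E.
    apply: cvg_EFin; first exact: nearW.
    under eq_fun do rewrite cnorm2E expr2; rewrite cnorm2E expr2.
    by apply: cvgM; exact: ccvg_normc.
  by rewrite is_cvg_limn_einfE ?(cvg_lim _ hgx2)//; apply/cvg_ex; exists (cnorm2 (g x))%:E.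
apply: le_trans (fatou mu measurableT mh _) _;
  first by move=> n x _; rewrite lee_fin cnorm2E sqr_ge0.
apply: limn_einf_le => n.
by rewrite integral_cnorm2// lee_fin ler_sqr ?nnegrE ?l2norm_ge0.
Qed.

Lemma l2_dominated (f : nat -> X -> C) g G :
  (forall n, cmeasurable (f n)) -> cmeasurable g -> cL2 mu G ->
  {ae mu, forall x n, normc (f n x - g x) <= normc (G x)} ->
  {ae mu, forall x, ccvg (fun n => f n x) (g x)} -> l2cvg f g.
Proof.
move=> mf mg [mG G_fin] dom fg.
have mfg n := measurable_cnorm2 (cmeasurableB (mf n) mg).
have ge0 z : (0 <= (cnorm2 z)%:E :> \bar R)%E by rewrite lee_fin cnorm2E sqr_ge0.
have [|||||_ _] := @dominated_convergence _ _ _ mu _ measurableT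
  (fun n x => (cnorm2 (f n x - g x))%:E) (cst 0%E) (fun x => (cnorm2 (G x))%:E).
- by move=> n; exact/measurable_EFinP.
- exact: measurable_cst.
- apply: filterS fg => x fgx _; apply: cvg_EFin; first exact: nearW.
  rewrite (_ : fine \o _ = (fun n => normc (f n x - g x) * normc (f n x - g x))).
    by rewrite -[X in _ --> X](mulr0 0); exact: cvgM.
  by apply/funext => n; rewrite /= cnorm2E expr2.
- apply/integrableP; split; first exact/measurable_EFinP/measurable_cnorm2.
  by under eq_integral do rewrite gee0_abs//.
- apply: filterS dom => x domx n _; rewrite gee0_abs// lee_fin !cnorm2E.
  by rewrite ler_sqr ?nnegrE ?normc_ge0.
rewrite integral0 => /fine_cvg int_cvg.
by have := continuous_cvg _ (@sqrt_continuous R 0) int_cvg; rewrite sqrtr0; exact.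
Qed.

Lemma integral_weighted_cnorm2_le g (c : R) n : cL2 mu g -> l2norm g <= c * 4^-1 ^+ n ->
  (\int[mu]_x (4 ^+ n * cnorm2 (g x))%:E <= (2 * c ^+ 2 / (2 ^ n.+1)%:R)%:E)%E.
Proof.
move=> L2g g_le; under eq_integral do rewrite EFinM.
rewrite ge0_integralZl_EFin// ?exprn_ge0//; last 2 first.
- by move=> x _; rewrite lee_fin cnorm2E sqr_ge0.
- by apply/measurable_EFinP/measurable_cnorm2; case: L2g.
rewrite integral_cnorm2// -EFinM lee_fin.
have g_sqr : l2norm g ^+ 2 <= (c * 4^-1 ^+ n) ^+ 2.
  by rewrite ler_sqr ?nnegrE ?l2norm_ge0//; exact: le_trans (l2norm_ge0 _ _) g_le.
have q4 : 4 ^+ n * 4^-1 ^+ n = 1 :> R by rewrite -exprMn mulfV ?expr1n ?pnatr_eq0.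
have q2 : 4^-1 ^+ n <= 2^-1 ^+ n :> R.
  by rewrite lerXn2r ?nnegrE ?invr_ge0//; lra.
have -> : 2 * c ^+ 2 / (2 ^ n.+1)%:R = c ^+ 2 * 2^-1 ^+ n.
  by rewrite natrX [2 ^+ n.+1]exprS exprVn invfM mulrA; congr (_ * _); field.
apply: (@le_trans _ _ (c ^+ 2 * 4^-1 ^+ n)); last by rewrite ler_wpM2l ?sqr_ge0.
apply: (le_trans (ler_wpM2l (exprn_ge0 n (ler0n _ 4)) g_sqr)).
by rewrite exprMn mulrCA [_ ^+ 2 in X in _ * X]expr2 [4 ^+ n * _]mulrA q4 mul1r.
Qed.

Lemma l2_geometric_increments (f : nat -> X -> C) (c : R) :
  (forall n, cL2 mu (f n)) ->
  (forall n, l2norm (fun x => f n.+1 x - f n x) <= c * 4^-1 ^+ n) ->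
  {ae mu, forall x, exists c', forall n, normc (f n.+1 x - f n x) <= c' * 2^-1 ^+ n}.
Proof.
move=> L2f f_incr; pose delta n x := f n.+1 x - f n x.
have L2d n : cL2 mu (delta n) := cL2B (L2f n.+1) (L2f n).
pose h n x := (4 ^+ n * cnorm2 (delta n x))%:E.
have h0 n x : (0 <= h n x)%E by rewrite lee_fin mulr_ge0 ?exprn_ge0 ?cnorm2E ?sqr_ge0.
have md n : measurable_fun setT (fun x => (cnorm2 (delta n x))%:E).
  by apply/measurable_EFinP/measurable_cnorm2; case: (L2d n).
have mh n : measurable_fun setT (h n).
  by rewrite /h; under eq_fun do rewrite EFinM; exact: measurable_funeM.
pose F x := (\sum_(n <oo) h n x)%E.
have F0 x : (0 <= F x)%E by exact: nneseries_ge0.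
have mF : measurable_fun setT F by exact: ge0_emeasurable_sum.
have int_h n : (\int[mu]_x h n x <= (2 * c ^+ 2 / (2 ^ n.+1)%:R)%:E)%E.
  exact: integral_weighted_cnorm2_le (L2d n) (f_incr n).
have int_F : (\int[mu]_x F x < +oo)%E.
  rewrite integral_nneseries//; apply: le_lt_trans (ltry (2 * c ^+ 2)).
  apply: le_trans (lee_nneseries _ (fun n _ => int_h n)) _ => [n _ _|].
    exact: integral_ge0.
  by apply: epsilon_trick0; rewrite mulr_ge0 ?sqr_ge0.
have F_int : mu.-integrable setT F.
  by apply/integrableP; split=> //; under eq_integral do rewrite gee0_abs//.
apply: filterS (integrable_ae measurableT F_int) => x /(_ Logic.I) Fx.
exists (Num.sqrt (fine (F x))) => n.
rewrite -ler_sqr ?nnegrE ?normc_ge0 ?mulr_ge0 ?sqrtr_ge0 ?exprn_ge0 ?invr_ge0//.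
rewrite exprMn sqr_sqrtr ?fine_ge0// -cnorm2E -/(delta n x).
have hF : (h n x <= F x)%E.
  apply: le_trans (nneseries_lim_ge n.+1 _) => //=.
  by rewrite big_nat_recr//= leeDr// sume_ge0.
move: hF; rewrite /h -(fineK Fx) lee_fin mulrC => hF.
rewrite -exprM mulnC exprM exprVn -[_ ^+ n]/((2 ^+ 2)^-1 ^+ n) -natrX exprVn.
by rewrite ler_pdivlMr ?exprn_gt0.
Qed.

Theorem l2_complete (f : nat -> X -> C) (c : R) : (forall n, cL2 mu (f n)) ->
  (forall n, l2norm (fun x => f n.+1 x - f n x) <= c * 4^-1 ^+ n) ->
  exists2 g, cL2 mu g & l2cvg f g.
Proof.
move=> L2f f_incr.
have c0 : 0 <= c by have := le_trans (l2norm_ge0 _ _) (f_incr 0); rewrite mulr1.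
have f_dist n m : l2norm (fun x => f n x - f (n + m)%N x) <= 2 * c * 4^-1 ^+ n.
  apply: (@le_trans _ _ (2 * c * (4^-1 ^+ n - 4^-1 ^+ (n + m)))); last first.
    by rewrite ler_wpM2l ?mulr_ge0// gerBl exprn_ge0 ?invr_ge0.
  elim: m => [|m IH].
    by rewrite addn0 subrr mulr0; under [X in l2norm X]eq_fun do rewrite subrr; rewrite l2norm0.
  rewrite addnS; apply: le_trans (l2norm_dist_triangle (L2f _) (L2f (n + m)%N) (L2f _)) _.
  have := f_incr (n + m)%N; rewrite l2norm_distC exprS.
  have : 0 <= c * 4^-1 ^+ (n + m) by rewrite mulr_ge0// exprn_ge0 ?invr_ge0.
  lra.
have [g mg fg] : exists2 g, cmeasurable g & {ae mu, forall x, ccvg (fun n => f n x) (g x)}.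
  apply: ae_lim_cmeasurable => [n|]; first exact: (L2f n).1.
  apply: filterS (l2_geometric_increments L2f f_incr) => x [c' xc'].
  exact: ccvg_of_geometric_increments xc'.
have fg_le n : cL2 mu (fun x => f n x - g x) /\
    l2norm (fun x => f n x - g x) <= 2 * c * 4^-1 ^+ n.
  apply: (@l2norm_fatou (fun m x => f n x - f (n + m)%N x)) => // [m||].
  - exact: cL2B.
  - exact: cmeasurableB (L2f n).1 mg.
  - apply: filterS fg => x fgx.
    rewrite /ccvg (_ : (fun m => _) = (fun m => normc (f (m + n)%N x - g x))); last first.
      by apply/funext => m; rewrite normc_distC addnC; congr normc; ring.
    by move: fgx; rewrite /ccvg -(cvg_shiftn n (fun m => normc (f m x - g x))).
exists g.
  have := cL2B (L2f 0) (fg_le 0).1; congr cL2; apply/funext => x; ring.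
apply: (@squeeze_cvg0 _ _ (geometric (2 * c) 4^-1)) => [n|].
  by rewrite l2norm_ge0 (fg_le n).2.
by apply: cvg_geometric; rewrite ger0_norm ?invr_ge0// invf_lt1// ltr1n.
Qed.

End L2Convergence.

(** * Isometries from a Hilbert space to an L2 space *)

Section L2Isometry.
Variables (R : realType) (V : lmodType R[i]) (ip : innerProduct V).
Context {d : measure_display} {X : measurableType d}.
Variable mu : {measure set X -> \bar R}.
Local Notation C := R[i].
Local Notation hn := (hnorm ip).

Definition l2_isometry (gamma : V -> X -> C) : Prop :=
  [/\ forall h, cL2 mu (gamma h),
      forall a h k, {ae mu, forall x, gamma (a *: h + k) x = a * gamma h x + gamma k x} &
      forall h, l2norm mu (gamma h) = hn h].

End L2Isometry.

Section IsometryFromGenerators.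
Variables (R : realType) (V : lmodType R[i]) (ip : innerProduct V).
Context {d : measure_display} {X : measurableType d}.
Variable mu : {measure set X -> \bar R}.
Local Notation C := R[i].
Local Notation hn := (hnorm ip).
Local Notation l2norm := (l2norm mu).

Variables (K : Type) (vec : K -> V) (A : K -> set X).
Hypothesis mA : forall k, measurable (A k).
Hypothesis A_fin : forall k, (mu (A k) < +oo)%E.
Hypothesis ip_vec : forall k l, ip (vec k) (vec l) = (fine (mu (A k `&` A l)))%:C.

Definition lvec (s : seq (C * K)) : V := \sum_(t <- s) t.1 *: vec t.2.
Definition lfun (s : seq (C * K)) (x : X) : C := \sum_(t <- s) t.1 * cindic R (A t.2) x.
Definition lscale (a : C) (s : seq (C * K)) := [seq (a * t.1, t.2) | t <- s].

Lemma lvec_lin a s t : lvec (lscale a s ++ t) = a *: lvec s + lvec t.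
Proof.
rewrite /lvec big_cat big_map scaler_sumr; congr (_ + _).
by apply: eq_bigr => u _; rewrite scalerA.
Qed.

Lemma lfun_lin a s t x : lfun (lscale a s ++ t) x = a * lfun s x + lfun t x.
Proof.
rewrite /lfun big_cat big_map mulr_sumr; congr (_ + _).
by apply: eq_bigr => u _; rewrite mulrA.
Qed.

Lemma lvec_subspace : subspace (fun h => exists s, h = lvec s).
Proof.
split; first by exists [::]; rewrite /lvec big_nil.
by move=> a _ _ [s ->] [t ->]; exists (lscale a s ++ t); rewrite lvec_lin.
Qed.

Lemma lfun_cL2 s : cL2 mu (lfun s).
Proof.
elim: s => [|t s IH]; rewrite /lfun.
  under eq_fun do rewrite big_nil; split; first exact: cmeasurable_cst.
  by under eq_integral do rewrite cnorm2E normc0 expr0n; rewrite integral0 ltry.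
under eq_fun do rewrite big_cons; apply: cL2D => //.
exact/cL2Z/cL2_indic.
Qed.

Let coef (a b : C) : R := complex.Re (a * conjc b).

Lemma hnorm_lvec_sqr s : hn (lvec s) ^+ 2 =
  \sum_(t <- s) \sum_(u <- s) coef t.1 u.1 * fine (mu (A t.2 `&` A u.2)).
Proof.
rewrite hnorm_sqr /rip /lvec ip_suml raddf_sum; apply: eq_bigr => t _ /=.
rewrite ip_sumr raddf_sum; apply: eq_bigr => u _ /=.
by rewrite ipZl ipZr ip_vec mulrA Re_mul /= mulr0 subr0.
Qed.

Lemma cnorm2_lfun s x : cnorm2 (lfun s x) =
  \sum_(t <- s) \sum_(u <- s) coef t.1 u.1 * \1_(A t.2 `&` A u.2) x.
Proof.
have -> : cnorm2 (lfun s x) = complex.Re (lfun s x * conjc (lfun s x)).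
  by rewrite mulr_conjc cnorm2E.
rewrite /lfun mulr_suml raddf_sum; apply: eq_bigr => t _ /=.
rewrite rmorph_sum mulr_sumr raddf_sum; apply: eq_bigr => u _ /=.
by rewrite rmorphM /= indicI /coef !ReImE /=; ring.
Qed.

Lemma l2norm_lfun s : l2norm (lfun s) = hn (lvec s).
Proof.
have mI k l : measurable (A k `&` A l) by exact: measurableI.
have I_fin k l : (mu (A k `&` A l) < +oo)%E.
  by apply: le_lt_trans (A_fin k); apply: le_measure; rewrite ?inE//; exact: subIsetl.
have ind_int k l : mu.-integrable setT (fun x => (\1_(A k `&` A l) x : R)%:E).
  apply/integrableP; split; first exact/measurable_EFinP/measurable_indic.
  by under eq_integral do rewrite gee0_abs ?lee_fin//; rewrite integral_indic// setIT.
have int_coef (r : R) k l : mu.-integrable setT (fun x => (r%:E * (\1_(A k `&` A l) x)%:E)%E).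
  exact: (integrableZl measurableT).
apply/eqP; rewrite -(@eqrXn2 _ 2) ?l2norm_ge0//; apply/eqP/EFin_inj.
rewrite -integral_cnorm2; last exact: lfun_cL2.
rewrite hnorm_lvec_sqr.
transitivity (\int[mu]_x (\sum_(t <- s) \sum_(u <- s)
   ((coef t.1 u.1)%:E * (\1_(A t.2 `&` A u.2) x)%:E)))%E.
  apply: eq_integral => x _; rewrite cnorm2_lfun -sumEFin; apply: eq_bigr => t _.
  by rewrite -sumEFin; apply: eq_bigr => u _; rewrite EFinM.
rewrite integral_sum//; last by move=> t; apply: integrable_sum.
rewrite -sumEFin; apply: eq_bigr => t _.
rewrite integral_sum// -sumEFin; apply: eq_bigr => u _.
by rewrite integralZl// integral_indic// setIT EFinM fineK// ge0_fin_numE.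
Qed.

Lemma l2norm_lfun_dist s t :
  l2norm (fun x => lfun s x - lfun t x) = hn (lvec s - lvec t).
Proof.
have -> : lvec s - lvec t = lvec (lscale (-1) t ++ s) by rewrite lvec_lin scaleN1r addrC.
rewrite -l2norm_lfun; congr l2norm.
by apply/funext => x; rewrite lfun_lin mulN1r addrC.
Qed.

Definition represents (h : V) (f : X -> C) : Prop := cL2 mu f /\
  exists2 s, hcvg ip (fun n => lvec (s n)) h & l2cvg mu (fun n => lfun (s n)) f.

Lemma represents_vec k : represents (vec k) (cindic R (A k)).
Proof.
split; first exact: cL2_indic.
exists (fun=> [:: (1, k)]).
  by rewrite /lvec big_seq1 scale1r; exact: hcvg_cst.
rewrite /l2cvg; under eq_fun do under [X in l2norm X]eq_fun do rewrite /lfun big_seq1 mul1r subrr.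
by rewrite l2norm0; exact: cvg_cst.
Qed.

Lemma represents_lin a h f k g : represents h f -> represents k g ->
  represents (a *: h + k) (fun x => a * f x + g x).
Proof.
move=> [L2f [s sh sf]] [L2g [t tk tg]]; split; first by apply: cL2D => //; exact: cL2Z.
exists (fun n => lscale a (s n) ++ t n).
  under eq_fun do rewrite lvec_lin; exact: hcvgD (hcvgZ a sh) tk.
rewrite (_ : (fun n => _) = (fun n x => a * lfun (s n) x + lfun (t n) x)); last first.
  by apply/funext => n; apply/funext => x; rewrite lfun_lin.
by apply: l2cvg_lin => // n; exact: lfun_cL2.
Qed.

Lemma represents_isometry h f : represents h f -> l2norm f = hn h.
Proof.
move=> [L2f [s sh sf]].
have := l2cvg_l2norm (fun n => lfun_cL2 (s n)) L2f sf.
under eq_fun do rewrite l2norm_lfun.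
by move=> sf_norm; exact: (cvg_unique _ sf_norm (hcvg_hnorm sh)).
Qed.

Lemma represents_unique h f g : represents h f -> represents h g ->
  {ae mu, forall x, f x = g x}.
Proof.
move=> hf hg; have fg := represents_lin (-1) hf hg.
have := represents_isometry fg; rewrite scaleN1r addNr hnorm0 => /(l2norm_eq0 fg.1).
by apply: filterS => x /eqP; rewrite mulN1r addrC subr_eq0 => /eqP.
Qed.

Lemma represents_exists h : hclosure ip (fun h => exists s, h = lvec s) h ->
  exists f, represents h f.
Proof.
move=> h_lim.
have /choice[s sh] : forall n, exists s, hn (lvec s - h) < 4^-1 ^+ n.
  move=> n; have [|_ [s ->] ?] := hclosure_dist h_lim (e := 4^-1 ^+ n).
    by rewrite exprn_gt0 ?invr_gt0.
  by exists s.
have [|n|f L2f sf] := @l2_complete _ _ _ mu (fun n => lfun (s n)) 2.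
- by move=> n; exact: lfun_cL2.
- rewrite l2norm_lfun_dist; apply: le_trans (hnorm_dist_triangle ip h _ _) _.
  have := sh n; have := sh n.+1; rewrite (hnorm_distC ip h) exprS.
  by have : 0 <= 4^-1 ^+ n :> R by [rewrite exprn_ge0 ?invr_ge0]; lra.
exists f; split=> //; exists s => //.
apply: (@hcvg_majorized _ _ _ _ _ (geometric 1 4^-1)) => [n|].
  by rewrite /= mul1r ltW.
by apply: cvg_geometric; rewrite ger0_norm ?invr_ge0// invf_lt1// ltr1n.
Qed.

End IsometryFromGenerators.

Theorem l2_isometry_exists (R : realType) (V : lmodType R[i]) (ip : hilbertForm V)
    (d : measure_display) (X : measurableType d) (mu : {measure set X -> \bar R})
    (K : Type) (vec : K -> V) (A : K -> set X) :
  (forall k, measurable (A k)) -> (forall k, (mu (A k) < +oo)%E) ->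
  (forall k l, ip (vec k) (vec l) = (fine (mu (A k `&` A l)))%:C) ->
  (forall x, (forall k, ip x (vec k) = 0) -> x = 0) ->
  exists2 gamma, l2_isometry ip mu gamma &
    forall k, {ae mu, forall x, gamma (vec k) x = cindic R (A k) x}.
Proof.
move=> mA A_fin ip_vec vec_total.
have span_closed := closed_subspace_hclosure ip (lvec_subspace vec).
have /choice[gamma gammaP] : forall h, exists f, represents ip mu vec A h f.
  move=> h; apply: (represents_exists mA A_fin ip_vec).
  apply: (closed_subspace_total span_closed) => x x_orth; apply: vec_total => k.
  apply: x_orth; exists (fun=> vec k) => [|_]; first exact: hcvg_cst.
  by exists [:: (1, k)]; rewrite /lvec big_seq1 scale1r.
exists gamma; first split.
- by move=> h; case: (gammaP h).
- move=> a h k; apply: (represents_unique mA A_fin ip_vec) => //.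
  by apply: (represents_lin mA A_fin).
- by move=> h; exact: (represents_isometry mA A_fin ip_vec).
move=> k; apply: (represents_unique mA A_fin ip_vec (gammaP _)).
exact: represents_vec.
Qed.

Section AlmostEverywhere.
Context {d : measure_display} {X : measurableType d} {R : realType}.
Variable mu : {measure set X -> \bar R}.

Lemma aeI (P Q : X -> Prop) : {ae mu, forall x, P x} -> {ae mu, forall x, Q x} ->
  {ae mu, forall x, P x /\ Q x}.
Proof. exact: filterI. Qed.

Lemma semifinite_ae (Q : X -> Prop) : semifinite mu -> measurable [set x | Q x] ->
  (forall A, measurable A -> (mu A < +oo)%E -> {ae mu, forall x, A x -> Q x}) ->
  {ae mu, forall x, Q x}.
Proof.
move=> mu_semifinite mQ Q_fin; pose N := ~` [set x | Q x].
have mN : measurable N := measurableC mQ.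
have N_null A : measurable A -> A `<=` N -> (mu A < +oo)%E -> mu A = 0%E.
  move=> mA AN A_fin; have [Z [mZ Z0 AZ]] := Q_fin A mA A_fin.
  apply/eqP; rewrite eq_le measure_ge0 andbT -Z0 le_measure ?inE// => x Ax.
  by apply: AZ => /= AQ; exact: (AN x Ax (AQ Ax)).
exists N; split=> //; have [N_fin|] := ltP (mu N) +oo%E; first exact: N_null.
rewrite leye_eq => /eqP /(mu_semifinite _ mN)[A [mA AN /andP[A0 A_fin]]].
by rewrite (N_null A) ?ltxx in A0.
Qed.

End AlmostEverywhere.

Section IsometryTheory.
Variables (R : realType) (V : lmodType R[i]) (ip : innerProduct V).
Context {d : measure_display} {X : measurableType d}.
Variable mu : {measure set X -> \bar R}.
Local Notation C := R[i].
Local Notation hn := (hnorm ip).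
Local Notation l2norm := (l2norm mu).
Variable gamma : V -> X -> C.
Hypothesis gammaP : l2_isometry ip mu gamma.

Let gamma_cL2 h : cL2 mu (gamma h). Proof. by case: gammaP. Qed.
Let gamma_meas h : cmeasurable (gamma h). Proof. by case: (gamma_cL2 h). Qed.

Lemma isometry_lin a h k :
  {ae mu, forall x, gamma (a *: h + k) x = a * gamma h x + gamma k x}.
Proof. by case: gammaP. Qed.

Lemma isometry_l2norm h : l2norm (gamma h) = hn h.
Proof. by case: gammaP. Qed.

Lemma isometryB h k : {ae mu, forall x, gamma (h - k) x = gamma h x - gamma k x}.
Proof.
by apply: filterS (isometry_lin (-1) k h) => x; rewrite scaleN1r mulN1r ![- _ + _]addrC.
Qed.

Lemma isometry_dist h k : l2norm (fun x => gamma h x - gamma k x) = hn (h - k).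
Proof.
rewrite -isometry_l2norm.
by have [|_ ->] := l2norm_ae_eq (gamma_cL2 _) _ (isometryB h k); first exact: cmeasurableB.
Qed.

Lemma isometry0 : {ae mu, forall x, gamma 0 x = 0}.
Proof. by apply: filterS (isometryB 0 0) => x; rewrite !subrr. Qed.

Definition diagonalizes (N : V -> V) (g : X -> C) : Prop :=
  cmeasurable g /\ forall h, {ae mu, forall x, gamma (N h) x = g x * gamma h x}.

Lemma diagonalizes_comp N N' g g' : diagonalizes N g -> diagonalizes N' g' ->
  diagonalizes (N \o N') (fun x => g x * g' x).
Proof.
move=> [mg Ng] [mg' Ng']; split=> [|h]; first exact: cmeasurableM.
by apply: filterS (aeI (Ng (N' h)) (Ng' h)) => x [-> ->]; rewrite mulrA.
Qed.

Lemma diagonalizes_iter N g k : diagonalizes N g -> diagonalizes (iter k N) (fun x => g x ^+ k).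
Proof.
move=> Ng; elim: k => [|k IH].
  under eq_fun do rewrite expr0; split=> [|h]; first exact: cmeasurable_cst.
  by apply: nearW => x; rewrite mul1r.
by under eq_fun do rewrite exprS; exact: (diagonalizes_comp Ng IH).
Qed.

Lemma diagonalizesZ a N g : diagonalizes N g ->
  diagonalizes (fun h => a *: N h) (fun x => a * g x).
Proof.
move=> [mg Ng]; split=> [|h]; first exact: cmeasurableZ.
apply: filterS (aeI (Ng h) (aeI isometry0 (isometry_lin a (N h) 0))) => x [Nhx [x0]].
by rewrite addr0 => ->; rewrite x0 addr0 Nhx mulrA.
Qed.

Lemma diagonalizesB N N' g g' : diagonalizes N g -> diagonalizes N' g' ->
  diagonalizes (fun h => N h - N' h) (fun x => g x - g' x).
Proof.
move=> [mg Ng] [mg' Ng']; split=> [|h]; first exact: cmeasurableB.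
apply: filterS (aeI (isometryB (N h) (N' h)) (aeI (Ng h) (Ng' h))) => x [-> [-> ->]].
by rewrite mulrBl.
Qed.

Lemma diagonal_defect_le N g K (M : R) A h k : linear_op N -> bounded_by ip K N ->
  cmeasurable g -> measurable A -> (forall x, A x -> normc (g x) <= M) -> 0 <= M ->
  {ae mu, forall x, gamma (N k) x = g x * gamma k x} ->
  cL2 mu (fun x => cindic R A x * (gamma (N h) x - g x * gamma h x)) /\
  l2norm (fun x => cindic R A x * (gamma (N h) x - g x * gamma h x)) <= (K + M) * hn (k - h).
Proof.
move=> N_lin NK mg mA gM M0 Nk; have mind := cmeasurable_indic (R := R) mA.
pose p x := cindic R A x * (gamma (N h) x - gamma (N k) x).
pose q x := (cindic R A x * g x) * (gamma k x - gamma h x).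
have [L2p p_le] : cL2 mu p /\ l2norm p <= 1 * l2norm (fun x => gamma (N h) x - gamma (N k) x).
  by apply: l2norm_mul_le => //; [apply: nearW => x; exact: normc_cindic_le1|exact: cL2B].
have [L2q q_le] : cL2 mu q /\ l2norm q <= M * l2norm (fun x => gamma k x - gamma h x).
  apply: l2norm_mul_le => //; [exact: cmeasurableM| |exact: cL2B].
  apply: nearW => x; have [Ax|Ax] := pselect (A x); first by rewrite cindic_in// mul1r gM.
  by rewrite cindic_out// mul0r normc0.
have [L2pq pq_le] := l2normD_le L2p L2q.
have [||L2D ->] := l2norm_ae_eq L2pq
  (g := fun x => cindic R A x * (gamma (N h) x - g x * gamma h x)); last split=> //.
- by apply: cmeasurableM => //; apply: cmeasurableB => //; exact: cmeasurableM.
- by apply: filterS Nk => x Nkx; rewrite /p /q Nkx; ring.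
rewrite mulrDl (le_trans pq_le)// lerD ?(le_trans p_le) ?(le_trans q_le)//.
  by rewrite mul1r isometry_dist hnorm_distC -linopB.
by rewrite isometry_dist.
Qed.

Lemma diagonalizes_closed N g K : linear_op N -> bounded_by ip K N -> cmeasurable g ->
  closed_subspace ip (fun h => {ae mu, forall x, gamma (N h) x = g x * gamma h x}).
Proof.
move=> N_lin NK mg; split; first split.
- by rewrite (linop0 N_lin); apply: filterS isometry0 => x ->; rewrite mulr0.
- move=> a h k Nh Nk; rewrite N_lin.
  apply: filterS (aeI (aeI Nh Nk) (aeI (isometry_lin a h k) (isometry_lin a (N h) (N k)))).
  by move=> x [[Nhx Nkx] [-> ->]]; rewrite Nhx Nkx mulrDr mulrCA.
move=> u l ul Nu; pose A (M : nat) := [set x | normc (g x) <= M%:R].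
have mA M : measurable (A M).
  have := measurable_normc mg measurableT (measurable_itv `]-oo, M%:R]%R).
  by rewrite setTI; congr measurable; apply/seteqP; split=> x; rewrite /= in_itv.
have defect M k := diagonal_defect_le l N_lin NK mg (mA M) (fun x Ax => Ax) (ler0n R M) (Nu k).
have defect0 M : {ae mu, forall x, cindic R (A M) x * (gamma (N l) x - g x * gamma l x) = 0}.
  apply: l2norm_eq0; first exact: (defect M 0).1.
  apply/le_anti; rewrite l2norm_ge0 andbT.
  apply: (@cvg0_le _ (fun k => (K + M%:R) * hn (u k - l))) => [|k].
    by rewrite -(mulr0 (K + M%:R)); exact: cvgMr.
  by rewrite add0r (defect M k).2.
apply: filterS (ae_foralln defect0) => x /(_ (Num.truncn (normc (g x))).+1).
rewrite cindic_in; last exact/ltW/truncnS_gt.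
by rewrite mul1r => /eqP; rewrite subr_eq0 => /eqP.
Qed.

Definition in_range (f : X -> C) : Prop := exists h, {ae mu, forall x, gamma h x = f x}.

Lemma in_range_lin a f g : in_range f -> in_range g -> in_range (fun x => a * f x + g x).
Proof.
move=> [h hf] [k kg]; exists (a *: h + k).
by apply: filterS (aeI (isometry_lin a h k) (aeI hf kg)) => x [-> [-> ->]].
Qed.

Lemma in_range0 : in_range (fun=> 0).
Proof. by exists 0; exact: isometry0. Qed.

Lemma in_rangeZ a f : in_range f -> in_range (fun x => a * f x).
Proof. by move=> /(in_range_lin a)/(_ in_range0); under eq_fun do rewrite addr0. Qed.

Lemma in_rangeB f g : in_range f -> in_range g -> in_range (fun x => f x - g x).
Proof.
move=> rf rg; have := in_range_lin (-1) rg rf.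
by under eq_fun do rewrite mulN1r addrC.
Qed.

Lemma in_range_sum (I : eqType) (r : seq I) (F : I -> X -> C) :
  (forall i, i \in r -> in_range (F i)) -> in_range (fun x => \sum_(i <- r) F i x).
Proof.
elim: r => [_|i r IH rF]; first by under eq_fun do rewrite big_nil; exact: in_range0.
under eq_fun do rewrite big_cons -[F i _]mul1r.
apply: in_range_lin; first by apply: rF; rewrite mem_head.
by apply: IH => j jr; apply: rF; rewrite inE jr orbT.
Qed.

End IsometryTheory.

Section IsometryRange.
Variables (R : realType) (V : lmodType R[i]) (ip : hilbertForm V).
Context {d : measure_display} {X : measurableType d}.
Variable mu : {measure set X -> \bar R}.
Local Notation C := R[i].
Local Notation hn := (hnorm ip).
Local Notation l2norm := (l2norm mu).
Variable gamma : V -> X -> C.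
Hypothesis gammaP : l2_isometry ip mu gamma.
Local Notation in_range := (in_range mu gamma).

Let gamma_cL2 h : cL2 mu (gamma h). Proof. by case: gammaP. Qed.

Lemma in_range_closed (f : nat -> X -> C) g : (forall n, cL2 mu (f n)) -> cL2 mu g ->
  (forall n, in_range (f n)) -> l2cvg mu f g -> in_range g.
Proof.
move=> L2f L2g rf fg; have /choice[u uf] := rf.
have dist n k : hn (u n - u k) = l2norm (fun x => f n x - f k x).
  rewrite -(isometry_dist gammaP); have [||_ ->] := l2norm_ae_eq
    (cL2B (L2f n) (L2f k)) (g := fun x => gamma (u n) x - gamma (u k) x) => //.
    by case: (cL2B (gamma_cL2 (u n)) (gamma_cL2 (u k))).
  by apply: filterS (aeI (uf n) (uf k)) => x [-> ->].
have [h uh] : exists h, hcvg ip u h.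
  apply: hcauchy_cvg => e e0; have e2 : 0 < e / 2 by rewrite divr_gt0.
  have [N fN] := (cvg0_ltP (fun n => l2norm_ge0 _ _)).1 fg _ e2.
  exists N => k Nk; rewrite dist (le_trans (l2norm_dist_triangle (L2f k) L2g (L2f N)))//.
  by rewrite [e]splitr lerD ?ltW ?fN// l2norm_distC fN.
exists h; have L2d : cL2 mu (fun x => gamma h x - g x) := cL2B (gamma_cL2 h) L2g.
suff d0 : l2norm (fun x => gamma h x - g x) = 0.
  by apply: filterS (l2norm_eq0 L2d d0) => x /eqP; rewrite subr_eq0 => /eqP.
apply/le_anti; rewrite l2norm_ge0 andbT.
apply: (@cvg0_le _ (fun n => hn (u n - h) + l2norm (fun x => f n x - g x))) => [|n].
  by rewrite -[X in _ --> X](addr0 0); exact: cvgD.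
rewrite add0r (le_trans (l2norm_dist_triangle (gamma_cL2 h) (gamma_cL2 (u n)) L2g))//.
rewrite (isometry_dist gammaP) hnorm_distC lerD2l.
have [||_ ->] := l2norm_ae_eq (cL2B (L2f n) L2g) (g := fun x => gamma (u n) x - g x) => //.
  by case: (cL2B (gamma_cL2 (u n)) L2g).
by apply: filterS (uf n) => x ->.
Qed.

Lemma in_range_bigcup (F : (set X)^nat) : (forall n, measurable (F n)) ->
  nondecreasing_seq F -> (mu (\bigcup_n F n) < +oo)%E ->
  (forall n, in_range (cindic R (F n))) -> in_range (cindic R (\bigcup_n F n)).
Proof.
move=> mF F_nd F_fin rF; set U := \bigcup_n F n; have FU n : F n `<=` U by exact: bigcup_sup.
have mU : measurable U by exact: bigcup_measurable.
have L2U : cL2 mu (cindic R U) by exact: cL2_indic.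
apply: (in_range_closed (f := fun n => cindic R (F n))) => // [n|].
  apply: cL2_indic => //; apply: le_lt_trans F_fin.
  by rewrite le_measure ?inE.
apply: (l2_dominated (G := cindic R U)) => //.
- by move=> n; exact: cmeasurable_indic.
- exact: cmeasurable_indic.
- apply: nearW => x n; rewrite normc_distC -cindicD//.
  have [Ux|Ux] := pselect (U x); first by rewrite (cindic_in R Ux) normc1 normc_cindic_le1.
  by rewrite !cindic_out// => -[].
- apply: nearW => x; have [[k _ Fkx]|Ux] := pselect (U x).
    have Ux : U x by exists k.
    rewrite /ccvg (cindic_in R Ux).
    apply: cvg_near_cst; exists k => // n kn.
    have Fnx : F n x by have /subsetPset := F_nd _ _ kn; exact.
    by rewrite (cindic_in R Fnx) subrr normc0.
  rewrite /ccvg (cindic_out R Ux); apply: cvg_near_cst; apply: nearW => n.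
  have Fnx : ~ F n x by move=> /FU.
  by rewrite (cindic_out R Fnx) subrr normc0.
Qed.

Section OntoFromIndicators.
Hypothesis range_indic : forall A, measurable A -> (mu A < +oo)%E -> in_range (cindic R A).

Import HBNNSimple.

Lemma in_range_nnsfun (s : {nnsfun X >-> R}) : cL2 mu (fun x => (s x)%:C) ->
  in_range (fun x => (s x)%:C).
Proof.
move=> L2s; have sE x : (s x)%:C =
    \sum_(y <- finmap.enum_fset (fset_set (range s))) y%:C * cindic R (s @^-1` [set y]) x.
  by rewrite {1}fimfunE fsbig_finite//= rmorph_sum; apply: eq_bigr => y _; rewrite rmorphM.
rewrite (funext sE); apply: (in_range_sum gammaP) => y _; set B := s @^-1` [set y].
have mB : measurable B by exact: measurable_sfunP.
have [->|y0] := eqVneq y 0; first by under eq_fun do rewrite mul0r; exact: (in_range0 gammaP).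
apply/(in_rangeZ gammaP)/range_indic => //; rewrite -(integral_cnorm2_indic (R := R) mu mB).
suff s_ge : {ae mu, forall x, normc (cindic R B x) <= `|y|^-1 * normc (s x)%:C}.
  by have [|[]] := l2norm_ae_le (cmeasurable_indic mB) L2s _ s_ge; rewrite ?invr_ge0.
apply: nearW => x; have [Bx|nBx] := pselect (B x); last first.
  by rewrite cindic_out// normc0 mulr_ge0 ?invr_ge0 ?normc_ge0.
by rewrite cindic_in// normc1 normc_real Bx mulVf ?normr_eq0.
Qed.

Lemma in_range_nonneg (u : X -> R) : measurable_fun setT u -> (forall x, 0 <= u x) ->
  cL2 mu (fun x => (u x)%:C) -> in_range (fun x => (u x)%:C).
Proof.
move=> mu_ u0 L2u; have mEu : measurable_fun setT (EFin \o u) by exact/measurable_EFinP.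
pose s n : {nnsfun X >-> R} := nnsfun_approx measurableT mEu n.
have s_cvg x : (fun n => s n x) @ \oo --> u x.
  have /fine_cvgP[_] := @cvg_nnsfun_approx _ _ _ _ measurableT _ mEu
    (fun x _ => u0 x : (0 <= (EFin \o u) x)%E) x Logic.I.
  exact.
have s_le n x : s n x <= u x.
  rewrite -(cvg_lim _ (s_cvg x))//; apply: nondecreasing_cvgn_le.
    by move=> k l kl; have /lefP := nd_nnsfun_approx measurableT mEu kl; exact.
  by apply/cvg_ex; exists (u x).
have ms n : cmeasurable (fun x => (s n x)%:C) by apply: cmeasurable_real.
have s0 n x : 0 <= s n x by [].
have L2s n : cL2 mu (fun x => (s n x)%:C).
  have [|//] := l2norm_le (ms n) L2u; apply: nearW => x.
  by rewrite !normc_real !ger0_norm.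
apply: (in_range_closed L2s L2u) => [n|]; first exact: in_range_nnsfun.
apply: (l2_dominated ms L2u.1 L2u); apply: nearW => x.
  move=> n; rewrite -rmorphB !normc_real ler0_norm ?subr_le0// opprB ger0_norm//.
  by rewrite gerBl.
apply: ccvg_ReIm => //=; exact: cvg_cst.
Qed.

Lemma in_range_real (u : X -> R) : measurable_fun setT u ->
  cL2 mu (fun x => (u x)%:C) -> in_range (fun x => (u x)%:C).
Proof.
move=> mu_ L2u; have part (v : X -> R) : measurable_fun setT v -> (forall x, 0 <= v x) ->
    (forall x, v x <= `|u x|) -> in_range (fun x => (v x)%:C).
  move=> mv v0 vu; apply: in_range_nonneg => //.
  have [|//] := l2norm_le (cmeasurable_real mv) L2u; apply: nearW => x.
  by rewrite !normc_real ger0_norm.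
have := in_rangeB gammaP (part (fun x => Num.max (u x) 0) _ _ _)
  (part (fun x => Num.max (- u x) 0) _ _ _).
rewrite (_ : (fun x => _) = (fun x => (u x)%:C)); last first.
  apply/funext => x; rewrite -rmorphB; congr (_%:C); have [u_le0|u_gt0] := leP (u x) 0.
    by rewrite max_l ?oppr_ge0// sub0r opprK.
  by rewrite max_r ?oppr_le0 ?ltW// subr0.
apply.
- exact: measurable_maxr.
- by move=> x; rewrite le_max lexx orbT.
- by move=> x; rewrite ge_max ler_norm normr_ge0.
- by apply: measurable_maxr => //; exact: measurableT_comp.
- by move=> x; rewrite le_max lexx orbT.
- by move=> x; rewrite ge_max -normrN ler_norm normr_ge0.
Qed.

Lemma in_range_cL2 f : cL2 mu f -> in_range f.
Proof.
move=> L2f; have [[Re_f Im_f] _] := L2f.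
have L2Re : cL2 mu (fun x => (complex.Re (f x))%:C).
  have [|//] := l2norm_le (cmeasurable_real Re_f) L2f; apply: nearW => x.
  by rewrite normc_real Re_le_normc.
have L2Im : cL2 mu (fun x => (complex.Im (f x))%:C).
  have [|//] := l2norm_le (cmeasurable_real Im_f) L2f; apply: nearW => x.
  by rewrite normc_real Im_le_normc.
have := in_range_lin gammaP 'i%C (in_range_real Im_f L2Im) (in_range_real Re_f L2Re).
by congr in_range; apply/funext => x; rewrite addrC -complexE.
Qed.

End OntoFromIndicators.
End IsometryRange.

Section Unitary.
Variables (R : realType) (V : lmodType R[i]) (ip : innerProduct V).
Context {d : measure_display} {X : measurableType d}.
Variable mu : {measure set X -> \bar R}.
Variable gamma : V -> X -> R[i].

Lemma unitary_to_L2P : unitary_to_L2 mu ip gamma <->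
  l2_isometry ip mu gamma /\ forall f, cL2 mu f -> in_range mu gamma f.
Proof.
split=> [[L2g lin isom onto]|[[L2g lin isom] onto]].
  split=> //; split=> // h; have := isom h; rewrite integral_cnorm2// => -[].
  by apply: pexpIrn; rewrite ?nnegrE ?l2norm_ge0 ?hnorm_ge0.
by split=> // h; rewrite integral_cnorm2// isom.
Qed.

Hypothesis gamma_unitary : unitary_to_L2 mu ip gamma.
Hypothesis mu_semifinite : semifinite mu.

Lemma diagonalizes_unique N g g' : diagonalizes mu gamma N g -> diagonalizes mu gamma N g' ->
  {ae mu, forall x, g x = g' x}.
Proof.
have [gammaP onto] := unitary_to_L2P.1 gamma_unitary.
move=> [mg Ng] [mg' Ng']; suff : {ae mu, forall x, g x - g' x = 0}.
  by apply: filterS => x /eqP; rewrite subr_eq0 => /eqP.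
apply: (semifinite_ae mu_semifinite); first exact/cmeasurable_eq0/cmeasurableB.
move=> A mA A_fin; have [h hA] := onto _ (cL2_indic mA A_fin).
apply: filterS (aeI hA (aeI (Ng h) (Ng' h))) => x [hAx [Nhx]].
by rewrite Nhx hAx => + Ax; rewrite cindic_in// !mulr1 => ->; rewrite subrr.
Qed.

Lemma diagonalizes_contraction N g : contraction ip N -> diagonalizes mu gamma N g ->
  {ae mu, forall x, cnorm2 (g x) <= 1}.
Proof.
have [gammaP onto] := unitary_to_L2P.1 gamma_unitary.
move=> N_contr [mg Ng]; have mcg := measurable_normc mg.
pose D m := [set x | 1 + m.+1%:R^-1 <= normc (g x)].
have mD m : measurable (D m).
  have := mcg measurableT _ (measurable_itv `[1 + m.+1%:R^-1, +oo[%R).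
  by rewrite setTI; congr measurable; apply/seteqP; split=> x; rewrite /= in_itv /= andbT.
suff D_null : {ae mu, forall x, forall m, ~ D m x}.
  apply: filterS D_null => x nD; rewrite cnorm2E -[leRHS](expr1n _ 2).
  rewrite ler_sqr ?nnegrE ?normc_ge0// leNgt; apply/negP => g_gt1.
  have d0 : 0 < normc (g x) - 1 by rewrite subr_gt0.
  apply: (nD (Num.truncn (normc (g x) - 1)^-1)); rewrite /D /= -lerBrDl.
  by rewrite -[leRHS]invrK lef_pV2 ?posrE ?invr_gt0// ltW// truncnS_gt.
apply: ae_foralln => m; apply: (semifinite_ae mu_semifinite); first exact/measurableC/mD.
move=> A mA A_fin; pose B := A `&` D m; have mB : measurable B by exact: measurableI.
have B_fin : (mu B < +oo)%E.
  by apply: le_lt_trans A_fin; rewrite le_measure ?inE//; exact: subIsetl.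
have [h hB] := onto _ (cL2_indic mB B_fin); have [L2g _ _] := gammaP.
have r1 : 1 < 1 + m.+1%:R^-1 :> R by rewrite ltrDl.
have B_le : {ae mu, forall x,
    normc (cindic R B x) <= (1 + m.+1%:R^-1)^-1 * normc (gamma (N h) x)}.
  apply: filterS (aeI hB (Ng h)) => x [hBx ->]; rewrite normcM hBx.
  have [Bx|nBx] := pselect (B x); last by rewrite cindic_out// normc0 !mulr0.
  rewrite cindic_in// normc1 mulr1 ler_pdivlMl ?mulr1 ?(lt_trans ltr01)//.
  by case: Bx.
have [|_ B_leN] := l2norm_ae_le (cmeasurable_indic mB) (L2g (N h)) _ B_le.
  by rewrite invr_ge0 ltW// (lt_trans ltr01).
have B0 : l2norm mu (cindic R B) = 0.
  have [_ hBnorm] := l2norm_ae_eq (L2g h) (cmeasurable_indic mB) hB.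
  apply/le_anti; rewrite l2norm_ge0 andbT leNgt; apply/negP => B_gt0.
  have r_inv1 : (1 + m.+1%:R^-1)^-1 < 1 :> R by rewrite invf_lt1 ?(lt_trans ltr01).
  suff : (1 + m.+1%:R^-1)^-1 * l2norm mu (gamma (N h)) < l2norm mu (cindic R B).
    by rewrite ltNge B_leN.
  apply: (@le_lt_trans _ _ ((1 + m.+1%:R^-1)^-1 * l2norm mu (cindic R B))).
    by rewrite hBnorm !(isometry_l2norm gammaP) ler_wpM2l// invr_ge0 ltW// (lt_trans ltr01).
  by rewrite gtr_pMl.
apply: filterS (l2norm_eq0 (cL2_indic mB B_fin) B0) => x x0 Ax Dx; move: x0.
by rewrite cindic_in// => /eqP; rewrite oner_eq0.
Qed.

End Unitary.

(** * Direct sums of measure spaces *)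

Section DirectSum.
Variables (J : pointedType) (d : J -> measure_display) (T : forall j, measurableType (d j)).

Definition dsum : Type := {j : J & T j}.

HB.instance Definition _ := Choice.on dsum.
HB.instance Definition _ := isPointed.Build dsum (existT T point point).

Definition dsum_inj (j : J) (t : T j) : dsum := existT T j t.

Definition dsum_measurable : set (set dsum) :=
  [set A | forall j, measurable (@dsum_inj j @^-1` A)].

Let dsum_measurable0 : dsum_measurable set0.
Proof. by move=> j; rewrite preimage_set0. Qed.

Let dsum_measurableC A : dsum_measurable A -> dsum_measurable (~` A).
Proof. by move=> mA j; rewrite preimage_setC; exact/measurableC/mA. Qed.

Let dsum_measurable_bigcup (F : (set dsum)^nat) : (forall i, dsum_measurable (F i)) ->
  dsum_measurable (\bigcup_i (F i)).
Proof. by move=> mF j; rewrite preimage_bigcup; apply: bigcup_measurable => i _; exact: mF. Qed.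

HB.instance Definition _ := @isMeasurable.Build default_measure_display dsum
  dsum_measurable dsum_measurable0 dsum_measurableC dsum_measurable_bigcup.

Lemma dsum_measurableE (A : set dsum) :
  measurable A = forall j, measurable (@dsum_inj j @^-1` A).
Proof. by []. Qed.

Lemma measurable_fibrewise d' (Y : measurableType d') (F : J -> dsum -> Y) :
  (forall j, measurable_fun setT (F j)) -> measurable_fun setT (fun x : dsum => F (tag x) x).
Proof.
move=> mF _ A mA; rewrite setTI dsum_measurableE => j.
by have := mF j measurableT A mA; rewrite setTI dsum_measurableE; exact.
Qed.

Lemma measurable_tag (S : set J) : measurable [set x : dsum | S (tag x)].
Proof.
rewrite dsum_measurableE => j; have [Sj|Sj] := pselect (S j).
  by rewrite (_ : _ @^-1` _ = setT)//; apply/seteqP; split.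
by rewrite (_ : _ @^-1` _ = set0)// -subset0.
Qed.

Lemma preimage_dsum_injK j B : @dsum_inj j @^-1` (@dsum_inj j @` B) = B.
Proof.
apply/seteqP; split=> [t [t' Bt' e]|t Bt]; last by exists t.
by have /eqP/= <- := etrans (esym (eq_Tagged (u := dsum_inj t') t)) (introT eqP e).
Qed.

Lemma image_dsum_injK j (A : set dsum) : A `<=` [set x | tag x = j] ->
  @dsum_inj j @` (@dsum_inj j @^-1` A) = A.
Proof.
move=> Aj; apply/seteqP; split=> [_ [t At <-]//|[i t] At].
by have /= ij := Aj _ At; subst i; exists t.
Qed.

Lemma image_dsum_injD j A B :
  @dsum_inj j @` (A `\` B) = @dsum_inj j @` A `\` @dsum_inj j @` B.
Proof.
have -> : A `\` B = @dsum_inj j @^-1` (@dsum_inj j @` A `\` @dsum_inj j @` B).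
  by rewrite -{1}(preimage_dsum_injK A) -{1}(preimage_dsum_injK B).
by rewrite image_dsum_injK// => _ [[t _ <-]].
Qed.

Lemma preimage_dsum_inj_neq i j B : i != j -> @dsum_inj i @^-1` (@dsum_inj j @` B) = set0.
Proof. by move=> ij; rewrite -subset0 => t [t' _ /(congr1 tag)/= ji]; rewrite -ji eqxx in ij. Qed.

Lemma measurable_dsum_image j B : measurable B -> measurable (@dsum_inj j @` B).
Proof.
move=> mB; rewrite dsum_measurableE => i; have [->|ij] := eqVneq i j.
  by rewrite preimage_dsum_injK.
by rewrite preimage_dsum_inj_neq.
Qed.

Context {R : realType}.
Variables (m : forall j, {measure set (T j) -> \bar R}) (S : set J).

Definition dsum_measure (A : set dsum) : \bar R :=
  \esum_(j in S) m j (@dsum_inj j @^-1` A).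

Let dsum_measure0 : dsum_measure set0 = 0%E.
Proof. by rewrite /dsum_measure esum1// => j _; rewrite preimage_set0 measure0. Qed.

Let dsum_measure_ge0 A : (0 <= dsum_measure A)%E.
Proof. by apply: esum_ge0 => j _; exact: measure_ge0. Qed.

Let dsum_measure_sigma_additive : semi_sigma_additive dsum_measure.
Proof.
move=> F mF tF mU.
have -> : dsum_measure (\bigcup_n F n) = (\sum_(n <oo) dsum_measure (F n))%E.
  rewrite nneseries_esumT// /dsum_measure esum_esum; last by move=> *; exact: measure_ge0.
  rewrite (reindex_esum (S `*`` (fun=> [set: nat])) _ (fun p => (p.2, p.1))); last first.
    split=> [[j n] []//|[j n] [j' n'] _ _ /= [-> ->]//|[n j] [] /= _ Sj].
    by exists (j, n).
  rewrite -(esum_esum (J := fun=> setT)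
    (a := fun j n => m j (@dsum_inj j @^-1` F n))); last by move=> *; exact: measure_ge0.
  apply: eq_esum => j Sj; rewrite -nneseries_esumT; last by move=> n; exact: measure_ge0.
  rewrite preimage_bigcup measure_bigcup//.
  - by apply: eq_eseriesl => i; rewrite in_setT.
  - by move=> n _; exact: mF.
  - apply/trivIsetP => i k _ _ ik; rewrite -preimage_setI.
    by have /trivIsetP/(_ i k Logic.I Logic.I ik) -> := tF; rewrite preimage_set0.
exact: is_cvg_nneseries.
Qed.

HB.instance Definition _ := isMeasure.Build _ _ _ dsum_measure
  dsum_measure0 dsum_measure_ge0 dsum_measure_sigma_additive.

Lemma dsum_measure_fibre j A : S j -> A `<=` [set x | tag x = j] ->
  dsum_measure A = m j (@dsum_inj j @^-1` A).
Proof.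
move=> Sj Aj; rewrite /dsum_measure (esumID [set j]); last by move=> *; exact: measure_ge0.
have -> : S `&` [set j] = [set j] by apply/setIidPr => _ ->.
rewrite esum_set1 ?measure_ge0// esum1 ?adde0// => i [_ /= ij].
by rewrite (_ : _ @^-1` A = set0) ?measure0// -subset0 => t /Aj.
Qed.

Lemma dsum_measure_image j B : S j -> dsum_measure (@dsum_inj j @` B) = m j B.
Proof. by move=> Sj; rewrite (dsum_measure_fibre Sj) ?preimage_dsum_injK// => _ [t _ <-]. Qed.

Lemma semifinite_dsum : (forall j, (m j setT < +oo)%E) -> semifinite dsum_measure.
Proof.
move=> m_fin A mA A_oo.
have [j Sj Aj] : exists2 j, S j & m j (@dsum_inj j @^-1` A) != 0%E.
  apply: contrapT => /forall2NP A0; move: A_oo; rewrite /= /dsum_measure esum1// => j Sj.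
  by have [//|/negP/negPn/eqP] := A0 j.
exists (@dsum_inj j @` (@dsum_inj j @^-1` A)); split.
- exact/measurable_dsum_image/mA.
- by move=> _ [t At <-].
- rewrite -[X in (0 < X < _)%E]/(dsum_measure _) dsum_measure_image// lt0e Aj measure_ge0 /=.
  by apply: le_lt_trans (m_fin j); rewrite le_measure ?inE.
Qed.

Lemma dsum_measure_finite_fibres A (e : R) : measurable A -> 0 < e ->
  (dsum_measure A < +oo)%E -> exists2 F : set J, finite_set F /\ F `<=` S &
    (dsum_measure (A `\` [set x | F (tag x)]) < e%:E)%E.
Proof.
move=> mA e0 A_fin; pose a j := m j (@dsum_inj j @^-1` A).
have fA : dsum_measure A \is a fin_num by rewrite ge0_fin_numE.
have [_ [F [F_fin FS] <-] F_gt] := ub_ereal_sup_adherent e0 fA.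
exists F => //.
have AE : dsum_measure A = (\esum_(j in S `&` F) a j + \esum_(j in S `&` ~` F) a j)%E.
  by rewrite /dsum_measure (esumID F).
have -> : dsum_measure (A `\` [set x | F (tag x)]) = \esum_(j in S `&` ~` F) a j.
  rewrite esum_mkcondr; apply: eq_esum => j Sj; case: ifPn; rewrite ?inE ?notin_setE /= => jF.
    by rewrite /a; congr (m j _); apply/seteqP; split=> t //= [].
  by rewrite (_ : _ @^-1` _ = set0) ?measure0// -subset0 => t [_]; exact.
have FE : \esum_(j in S `&` F) a j = (\sum_(j \in F) a j)%E.
  by rewrite (_ : S `&` F = F) ?esum_fset//; apply/setIidPr.
have F_real : (\sum_(j \in F) a j)%E \is a fin_num.
  rewrite -FE ge0_fin_numE ?esum_ge0//; apply: le_lt_trans A_fin; rewrite AE.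
  by rewrite leeDl// esum_ge0.
have {}F_gt : (dsum_measure A - e%:E < \sum_(j \in F) a j)%E by exact: F_gt.
by move: F_gt; rewrite AE FE lteBlDr// lteD2lE.
Qed.

Section Range.
Variables (V : lmodType R[i]) (ip : hilbertForm V) (gamma : V -> dsum -> R[i]).
Hypothesis gammaP : l2_isometry ip dsum_measure gamma.
Hypothesis range_fibre : forall j A, S j -> measurable A -> A `<=` [set x : dsum | tag x = j] ->
  in_range dsum_measure gamma (cindic R A).

Lemma in_range_finite_fibres (F : set J) A : finite_set F -> F `<=` S -> measurable A ->
  in_range dsum_measure gamma (cindic R (A `&` [set x : dsum | F (tag x)])).
Proof.
move=> F_fin FS mA; pose s := finmap.enum_fset (fset_set F).
have sF j : j \in s -> F j by rewrite in_fset_set// inE.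
have -> : cindic R (A `&` [set x | F (tag x)]) =
    fun x => \sum_(j <- s) cindic R (A `&` [set x | tag x = j]) x.
  apply/funext => x; have [[Ax Fx]|AFx] := pselect ((A `&` [set x | F (tag x)]) x).
    rewrite cindic_in// (bigD1_seq (tag x)) ?finmap.fset_uniq//=; last first.
      by rewrite in_fset_set// inE.
    rewrite cindic_in// big1 ?addr0// => j /eqP jx.
    by rewrite cindic_out// => -[_ /= xj]; rewrite xj in jx.
  rewrite cindic_out// big1_seq// => j /andP[_ /sF Fj].
  by rewrite cindic_out// => -[Ax /= xj]; apply: AFx; split=> //=; rewrite xj.
apply: (in_range_sum gammaP) => j /sF/FS Sj; apply: (range_fibre Sj).
  by apply: measurableI => //; exact: (measurable_tag [set j]).
by move=> x [].
Qed.

Lemma in_range_dsum A : measurable A -> (dsum_measure A < +oo)%E ->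
  in_range dsum_measure gamma (cindic R A).
Proof.
move=> mA A_fin.
have L2A : cL2 dsum_measure (cindic R A) by exact: cL2_indic.
have /choice[F F_approx] : forall n, exists F : set J, [/\ finite_set F, F `<=` S &
    (dsum_measure (A `\` [set x : dsum | F (tag x)]) < (n.+1%:R^-1 ^+ 2)%:E)%E].
  move=> n; have [|F [F_fin FS] F_lt] :=
    dsum_measure_finite_fibres (e := n.+1%:R^-1 ^+ 2) mA _ A_fin; first by rewrite exprn_gt0.
  by exists F.
have mF n : measurable (A `&` [set x : dsum | F n (tag x)]).
  by apply: measurableI => //; exact: measurable_tag.
apply: (in_range_closed gammaP (f := fun n => cindic R (A `&` [set x | F n (tag x)]))) => // n.
- apply: cL2_indic => //; apply: le_lt_trans A_fin.
  by rewrite le_measure ?inE//; exact: subIsetl.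
- by have [F_fin FS _] := F_approx n; exact: in_range_finite_fibres.
apply: (squeeze_cvg0 _ (@cvg_harmonic R)) => k; rewrite l2norm_ge0 l2norm_distC /=.
have [_ _ F_lt] := F_approx k; pose D := A `\` (A `&` [set x : dsum | F k (tag x)]).
have mD : measurable D by exact: measurableD.
rewrite (_ : (fun x => _) = cindic R D); last first.
  by apply/funext => x; rewrite cindicD//; exact: subIsetl.
apply: (proj2 (cL2_l2norm_le _ _ _)); first exact: cmeasurable_indic.
  by rewrite invr_ge0.
by rewrite integral_cnorm2_indic// /D setDIr setDv set0U ltW.
Qed.

End Range.

End DirectSum.

(** * The spectral model of a countable family of commuting projections *)

Section TreeModel.
Variables (R : realType) (V : lmodType R[i]) (ip : hilbertForm V).
Variable P : nat -> V -> V.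
Hypothesis P_comm : commuting_oprojs ip P.
Variable S : set V.
Hypothesis S_orth : orthogonal_cyclic ip P S.
Hypothesis S_total : cyclic_total ip P S.
Local Notation hn := (hnorm ip).
Local Notation E := (treeproj P 0).
Local Notation I := (tree_itv ip P 0).

Definition tree_sets (v : V) : set (set R) := [set B | B = set0 \/ exists p, B = I p v].

Lemma setI_closed_tree_sets v : setI_closed (tree_sets v).
Proof.
move=> B B' [->|[p ->]]; first by left; rewrite set0I.
move=> [->|[q ->]]; first by left; rewrite setI0.
have [[sub _]|[sub _]|[disj _]] := tree_trichotomy P_comm 0 p q v.
- by right; exists p; apply/setIidPl.
- by right; exists q; apply/setIidPr.
- by left.
Qed.

Lemma lebesgue_tree_itv p v : lebesgue_measure (I p v) = (hn (E p v) ^+ 2)%:E.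
Proof.
rewrite /tree_itv lebesgue_measure_itv /= lte_fin ltrDl.
case: ltP => norm_le0; first by rewrite -EFinB addrC addKr.
by congr EFin; apply/eqP; rewrite eq_le sqr_ge0 norm_le0.
Qed.

Definition tree_fibre (v : V) := g_sigma_algebraType (tree_sets v).

Lemma measurable_tree_itv p v : measurable (I p v : set (tree_fibre v)).
Proof. by apply: sub_gen_smallest; right; exists p. Qed.

Lemma tree_fibre_borel v (B : set (tree_fibre v)) :
  measurable B -> measurable (B : set (measurableTypeR R)).
Proof.
move: B; apply: smallest_sub; first exact: sigma_algebra_measurable.
by move=> B [->|[p ->]]; [exact: measurable0|exact: measurable_itv].
Qed.

Definition fibre_measure (v : V) (B : set (tree_fibre v)) : \bar R :=
  lebesgue_measure (B `&` I [::] v).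

Section FibreMeasure.
Variable v : V.

Let fibre_measure0 : @fibre_measure v set0 = 0%E.
Proof. by rewrite /fibre_measure set0I measure0. Qed.

Let fibre_measure_ge0 B : (0 <= @fibre_measure v B)%E.
Proof. exact: measure_ge0. Qed.

Let fibre_measure_sigma_additive : semi_sigma_additive (@fibre_measure v).
Proof.
have mI : measurable (I [::] v : set (measurableTypeR R)) by exact: measurable_itv.
move=> F mF tF mU; apply: (measure_semi_sigma_additive (s := mrestr lebesgue_measure mI)) => //.
  by move=> n; exact: tree_fibre_borel.
exact: (tree_fibre_borel mU).
Qed.

HB.instance Definition _ := isMeasure.Build _ _ _ (@fibre_measure v)
  fibre_measure0 fibre_measure_ge0 fibre_measure_sigma_additive.

End FibreMeasure.

Lemma fibre_measure_setT v : @fibre_measure v setT = (hn v ^+ 2)%:E.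
Proof. by rewrite /fibre_measure setTI lebesgue_tree_itv. Qed.

Lemma fibre_measure_tree_itv p v :
  @fibre_measure v (I p v) = (hn (E p v) ^+ 2)%:E.
Proof.
rewrite /fibre_measure; have /setIidPl -> := tree_itv_sub P_comm (k := 0) (p := p) (x := v).
exact: lebesgue_tree_itv.
Qed.

Definition tree_index : pointedType := HB.pack_for pointedType V (isPointed.Build V 0).

Definition tree_space := @dsum tree_index _ tree_fibre.

Definition tree_measure : {measure set tree_space -> \bar R} :=
  @dsum_measure tree_index _ tree_fibre R (fun v => @fibre_measure v) S.

Lemma semifinite_tree_measure : semifinite tree_measure.
Proof. by apply: semifinite_dsum => v; rewrite /= fibre_measure_setT ltry. Qed.

Definition tree_base (v : V) : set tree_space := [set x : tree_space | tag x = v].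

Lemma measurable_tree_base v : measurable (tree_base v).
Proof. exact: (@measurable_tag tree_index _ tree_fibre [set v]). Qed.

Lemma tree_measure_fibre v A : S v -> A `<=` tree_base v ->
  tree_measure A = fibre_measure (@dsum_inj tree_index _ tree_fibre v @^-1` A).
Proof. exact: dsum_measure_fibre. Qed.

Lemma tree_measure_base v : S v -> tree_measure (tree_base v) = (hn v ^+ 2)%:E.
Proof.
move=> Sv; rewrite (tree_measure_fibre Sv)// -fibre_measure_setT.
by congr fibre_measure; apply/seteqP; split.
Qed.

Definition tree_region (p : seq bool) : set tree_space :=
  [set x : tree_space | I p (tag x) (tagged x)].

Definition tree_cell (v : V) (p : seq bool) : set tree_space :=
  tree_base v `&` tree_region p.

Lemma measurable_tree_region p : measurable (tree_region p).
Proof. by rewrite dsum_measurableE => v; exact: measurable_tree_itv. Qed.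

Lemma measurable_tree_cell v p : measurable (tree_cell v p).
Proof. by apply: measurableI; [exact: measurable_tree_base|exact: measurable_tree_region]. Qed.

Lemma tree_measure_cell v p : S v -> tree_measure (tree_cell v p) = (hn (E p v) ^+ 2)%:E.
Proof.
move=> Sv; rewrite (tree_measure_fibre Sv) => [|x []//].
rewrite -fibre_measure_tree_itv; congr fibre_measure.
by apply/seteqP; split=> [r []//|r Ir]; split.
Qed.

Lemma tree_cell_trichotomy v p q :
  [\/ tree_cell v p `&` tree_cell v q = tree_cell v p /\ E p (E q v) = E p v,
      tree_cell v p `&` tree_cell v q = tree_cell v q /\ E p (E q v) = E q v |
      tree_cell v p `&` tree_cell v q = set0 /\ E p (E q v) = 0].
Proof.
have cell_sub p' q' : I p' v `<=` I q' v -> tree_cell v p' `<=` tree_cell v q'.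
  by move=> sub x [xv]; split=> //; move: b; rewrite /tree_region /= xv; exact: sub.
have [[sub ->]|[sub ->]|[disj ->]] := tree_trichotomy P_comm 0 p q v.
- by apply: Or31; split=> //; apply/setIidPl/cell_sub.
- by apply: Or32; split=> //; apply/setIidPr/cell_sub.
apply: Or33; split=> //; rewrite -subset0 => x [[xv xp] [_ xq]].
have : (I p v `&` I q v) (tagged x) by rewrite -xv.
by rewrite disj.
Qed.

Lemma ip_treeproj_cell v w p q : S v -> S w ->
  ip (E p v) (E q w) = (fine (tree_measure (tree_cell v p `&` tree_cell w q)))%:C.
Proof.
move=> Sv Sw; have [_ _ ->] := treeproj_oproj P_comm 0 p.
have [<-|vw] := eqVneq v w.
  have [[-> ->]|[-> ->]|[-> ->]] := tree_cell_trichotomy v p q.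
  - by rewrite tree_measure_cell ?ip_treeproj.
  - by rewrite tree_measure_cell ?ip_treeproj.
  - by rewrite measure0 ip0r.
have -> : tree_cell v p `&` tree_cell w q = set0.
  rewrite -subset0 => x [[/= xv _] [/= xw _]].
  by rewrite -xv -xw eqxx in vw.
rewrite measure0; have [[_ ->]|[_ ->]|[_ ->]] := tree_trichotomy P_comm 0 p q w.
- exact: S_orth.
- exact: S_orth.
- exact: ip0r.
Qed.

Definition cell_index : Type := {vp : V * seq bool | S vp.1}.

Lemma tree_isometry_exists : exists2 gamma, l2_isometry ip tree_measure gamma &
  forall v p, S v -> {ae tree_measure, forall x, gamma (E p v) x = cindic R (tree_cell v p) x}.
Proof.
have [||||gamma gammaP gamma_gen] := @l2_isometry_exists _ _ ip _ _ tree_measure cell_index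
  (fun k => E (sval k).2 (sval k).1) (fun k => tree_cell (sval k).1 (sval k).2).
- by move=> k; exact: measurable_tree_cell.
- by move=> [[v p] Sv]; rewrite tree_measure_cell// ltry.
- by move=> [[v p] Sv] [[w q] Sw]; exact: ip_treeproj_cell.
- by move=> x x_orth; apply: S_total => v p Sv; exact: (x_orth (exist _ (v, p) Sv)).
by exists gamma => // v p Sv; exact: (gamma_gen (exist _ (v, p) Sv)).
Qed.

Section Isometry.
Variable gamma : V -> tree_space -> R[i].
Hypothesis gammaP : l2_isometry ip tree_measure gamma.
Hypothesis gamma_cell : forall v p, S v ->
  {ae tree_measure, forall x, gamma (E p v) x = cindic R (tree_cell v p) x}.

Lemma diagonalizes_tree N g : linear_op N -> contraction ip N -> cmeasurable g ->
  (forall v p, S v ->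
    {ae tree_measure, forall x, gamma (N (E p v)) x = g x * cindic R (tree_cell v p) x}) ->
  diagonalizes tree_measure gamma N g.
Proof.
move=> N_lin N_contr mg N_cell; split=> //.
apply: (closed_subspace_total (diagonalizes_closed gammaP N_lin (contraction_bounded N_contr) mg)).
move=> w w_orth; apply: S_total => v p Sv; apply: w_orth.
by apply: filterS (aeI (N_cell v p Sv) (gamma_cell p Sv)) => x [-> ->].
Qed.

Lemma diagonalizes_treeproj p :
  diagonalizes tree_measure gamma (E p) (cindic R (tree_region p)).
Proof.
have [p_lin _ _] := treeproj_oproj P_comm 0 p.
apply: diagonalizes_tree => //.
- exact/oproj_contraction/treeproj_oproj.
- exact: (cmeasurable_indic (measurable_tree_region p)).
move=> v q Sv.
have regionI x : cindic R (tree_region p) x * cindic R (tree_cell v q) x =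
    cindic R (tree_cell v p `&` tree_cell v q) x.
  by rewrite -cindicI /tree_cell setIACA setIid setICA.
suff : {ae tree_measure, forall x,
    gamma (E p (E q v)) x = cindic R (tree_cell v p `&` tree_cell v q) x}.
  by apply: filterS => x ->.
have [[-> ->]|[-> ->]|[-> ->]] := tree_cell_trichotomy v p q.
- exact: gamma_cell.
- exact: gamma_cell.
by apply: filterS (isometry0 gammaP) => x ->; rewrite cindic_out.
Qed.

Lemma gamma_fixed_tree_base N v : subordinate ip P N -> S v ->
  {ae tree_measure, forall x, gamma (N v) x = cindic R (tree_base v) x * gamma (N v) x}.
Proof.
move=> [_ N_inv] Sv.
pose W h := {ae tree_measure, forall x, gamma h x = cindic R (tree_base v) x * gamma h x}.
have W_closed : closed_subspace ip W.
  apply: (diagonalizes_closed gammaP (N := id) (K := 1)) => //.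
    by apply: contraction_bounded => x.
  exact: (cmeasurable_indic (measurable_tree_base v)).
apply: (N_inv W) => // [k h Wh|].
  apply: (subspace_treeproj P_comm W_closed.1 k (k := 0)) => p.
  apply: filterS (aeI Wh ((diagonalizes_treeproj p).2 h)) => x [hx ->].
  by rewrite mulrCA -hx.
apply: filterS (gamma_cell [::] Sv) => x; rewrite /= => ->.
by rewrite -cindicI (setIidPr _ _).2// => y [].
Qed.

Theorem subordinate_diagonalizes N : linear_op N -> contraction ip N -> subordinate ip P N ->
  exists g, diagonalizes tree_measure gamma N g.
Proof.
move=> N_lin N_contr N_sub; pose g (x : tree_space) := gamma (N (tag x)) x.
exists g; have [L2g _ _] := gammaP.
have mg : cmeasurable g.
  split.
    apply: (@measurable_fibrewise tree_index _ tree_fibre _ _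
      (fun v x => complex.Re (gamma (N v) x))) => v; exact: (L2g (N v)).1.1.
  apply: (@measurable_fibrewise tree_index _ tree_fibre _ _
    (fun v x => complex.Im (gamma (N v) x))) => v; exact: (L2g (N v)).1.2.
apply: diagonalizes_tree => // v p Sv; rewrite -(treeproj_comm _ _ N_lin N_sub.1).
have [_ /(_ (N v)) p_diag] := diagonalizes_treeproj p.
apply: filterS (aeI p_diag (gamma_fixed_tree_base N_sub Sv)) => x [-> ->].
rewrite mulrA -cindicI setIC.
have [[xv xp]|x_out] := pselect (tree_cell v p x); last by rewrite cindic_out// mul0r mulr0.
by rewrite cindic_in// mul1r mulr1 /g xv.
Qed.

Lemma in_range_tree_base v : S v -> in_range tree_measure gamma (cindic R (tree_base v)).
Proof.
move=> Sv; exists v; pose Z := tree_base v `\` tree_cell v [::].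
have mZ : measurable Z.
  by apply: measurableD; [exact: measurable_tree_base|exact: measurable_tree_cell].
have Z_null : {ae tree_measure, forall x, ~ Z x}.
  exists Z; split=> //; last by move=> x; apply: contrapT.
  rewrite (tree_measure_fibre Sv) => [|x []//]; rewrite /fibre_measure.
  rewrite (_ : _ `&` _ = set0) ?measure0// -subset0 => r [[_ nr] Ir].
  by apply: nr; split.
apply: filterS (aeI Z_null (gamma_cell [::] Sv)) => x [nZ /= ->].
have [[xv xI]|nC] := pselect (tree_cell v [::] x); first by rewrite !cindic_in.
by rewrite !cindic_out// => xv; exact: nZ.
Qed.

Lemma in_range_fibre v A : S v -> measurable A -> A `<=` tree_base v ->
  in_range tree_measure gamma (cindic R A).
Proof.
move=> Sv mA Av; pose inj := @dsum_inj tree_index _ tree_fibre v.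
pose H := [set B : set (tree_fibre v) | measurable B /\
  in_range tree_measure gamma (cindic R (inj @` B))].
suff : <<s tree_sets v >> `<=` H.
  rewrite -(@image_dsum_injK tree_index _ tree_fibre v A Av).
  by move=> /(_ _ (mA v))[].
apply: lambda_system_subset => //; first exact: setI_closed_tree_sets; last first.
  move=> _ [->|[p ->]]; split=> //.
  - rewrite image_set0; exists 0; apply: filterS (isometry0 gammaP) => x ->.
    by rewrite cindic_out.
  - exact: measurable_tree_itv.
  - exists (E p v); rewrite (_ : _ @` _ = tree_cell v p); first exact: gamma_cell.
    apply/seteqP; split=> [_ [r Ir <-]//|[w r] [/= wv Ir]].
    by have {}wv : w = v := wv; subst w; exists r.
split=> //.
- split; first exact: measurableT.
  have := in_range_tree_base Sv.
  rewrite -(@image_dsum_injK tree_index _ tree_fibre v (tree_base v))//.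
  by rewrite (_ : _ @^-1` _ = setT)//; apply/seteqP; split.
- move=> B B' B'B [mB rB] [mB' rB']; split; first exact: measurableD.
  have injB'B : inj @` B' `<=` inj @` B by exact: image_subset.
  have := in_rangeB gammaP rB rB'; congr in_range; apply/funext => x.
  by rewrite -cindicD// -image_dsum_injD.
- move=> F F_nd HF; have mF n : measurable (F n : set (tree_fibre v)) by case: (HF n).
  have minjF n : measurable (inj @` F n : set tree_space).
    exact: (@measurable_dsum_image tree_index _ tree_fibre v _ (mF n)).
  split; first exact: bigcupT_measurable.
  rewrite image_bigcup; apply: (in_range_bigcup gammaP) => [n|m n mn||n].
  + exact: minjF.
  + apply/subsetPset/image_subset; exact/subsetPset/F_nd.
  + apply: (@le_lt_trans _ _ (tree_measure (tree_base v))).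
      rewrite le_measure ?inE//; last by move=> _ [n _ [t _ <-]].
      - exact: bigcupT_measurable.
      - exact: measurable_tree_base.
    by rewrite tree_measure_base// ltry.
  + by case: (HF n).
Qed.

End Isometry.

Theorem cyclic_diagonalization :
  exists d (X : measurableType d) (mu : {measure set X -> \bar R}) gamma,
  [/\ semifinite mu, unitary_to_L2 mu ip gamma &
    forall N, linear_op N -> contraction ip N -> subordinate ip P N ->
      exists g, diagonalizes mu gamma N g].
Proof.
have [gamma gammaP gamma_cell] := tree_isometry_exists.
exists _, tree_space, tree_measure, gamma; split.
- exact: semifinite_tree_measure.
- apply/unitary_to_L2P; split=> //; apply: (in_range_cL2 gammaP).
  apply: (in_range_dsum gammaP) => v A Sv mA Av; exact: (in_range_fibre gammaP gamma_cell Sv).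
- by move=> N N_lin N_contr N_sub; exact: (subordinate_diagonalizes gammaP gamma_cell).
Qed.

End TreeModel.

(** * Averages of contractive semigroups *)

Section Dyadic.
Variable R : realType.

Definition dyad (m : nat) : R := 2^-1 ^+ m.

Lemma dyad_gt0 m : 0 < dyad m. Proof. by rewrite exprn_gt0 ?invr_gt0. Qed.

Lemma dyad_ge0 m : 0 <= dyad m. Proof. exact/ltW/dyad_gt0. Qed.

Lemma dyad0 : dyad 0 = 1. Proof. exact: expr0. Qed.

Lemma dyadS m : dyad m.+1 + dyad m.+1 = dyad m.
Proof. by rewrite /dyad exprS; field. Qed.

Lemma dyad_le M m : (M <= m)%N -> dyad m <= dyad M.
Proof. by move=> Mm; apply: ler_wiXn2l => //; rewrite ?invr_ge0// invf_le1// ler1n. Qed.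

Lemma dyad_cvg0 : dyad @ \oo --> (0 : R).
Proof.
by apply: cvg_expr; rewrite ger0_norm ?invr_ge0// invf_lt1// ltr1n.
Qed.

Lemma dyad_small (e : R) : 0 < e -> exists M, dyad M < e.
Proof.
move=> e0; have [N dN] := (cvg0_ltP dyad_ge0).1 dyad_cvg0 e e0.
by exists N; exact: dN.
Qed.

End Dyadic.
Arguments dyad {R} m.

Section DyadicTimes.
Variables (R : realType) (V : lmodType R[i]) (ip : innerProduct V).

Lemma semigroup_dyad_iter (T : R -> V -> V) m k h : contractive_semigroup ip T ->
  T (k%:R * dyad m) h = iter k (T (dyad m)) h.
Proof.
move=> [_ _ T0 T_add _]; elim: k => [|k IH]; first by rewrite mul0r T0.
by rewrite -natr1 mulrDl mul1r addrC T_add ?mulr_ge0 ?dyad_ge0// IH.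
Qed.

Lemma semigroup_dyad_comm (T : R -> V -> V) A m l : contractive_semigroup ip T ->
  op_comm A (T (dyad (m + l))) -> op_comm A (T (dyad m)).
Proof.
move=> [_ _ _ T_add _]; elim: l => [|l IH] AT; first by move: AT; rewrite addn0.
by apply: IH => x; rewrite -dyadS -addnS !T_add ?dyad_ge0// !AT.
Qed.

Lemma semigroups_dyad_comm (T1 T2 : R -> V -> V) m1 m2 :
  contractive_semigroup ip T1 -> contractive_semigroup ip T2 -> semigroups_commute T1 T2 ->
  op_comm (T1 (dyad m1)) (T2 (dyad m2)).
Proof.
move=> T1P T2P T12; apply: (semigroup_dyad_comm (l := m1) T2P) => x; symmetry.
rewrite addnC; apply: (semigroup_dyad_comm (l := m2) T1P) => {}x; symmetry.
by apply: T12; exact: dyad_ge0.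
Qed.

End DyadicTimes.

Section SemigroupAverage.
Variables (R : realType) (V : lmodType R[i]) (ip : hilbertForm V).
Local Notation hn := (hnorm ip).
Variable T : R -> V -> V.
Hypothesis T_semigroup : contractive_semigroup ip T.
Local Notation D := (@dyad R).

Let T_lin s : 0 <= s -> linear_op (T s). Proof. by case: T_semigroup => h *; exact: h. Qed.
Let T_contr s : 0 <= s -> contraction ip (T s).
Proof. by case: T_semigroup => _ h * x; exact: h. Qed.
Let T_add s t x : 0 <= s -> 0 <= t -> T (s + t) x = T s (T t x).
Proof. by case: T_semigroup => _ _ _ h *; exact: h. Qed.

Lemma semigroup_near0 x (e : R) : 0 < e ->
  exists M, forall s, 0 <= s <= D M -> hn (T s x - x) <= e.
Proof.
move=> e0; have [_ _ T0 _ T_cont] := T_semigroup.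
have [d d0 Td] := T_cont x 0 (lexx 0) e e0; have [M Md] := dyad_small d0.
exists M => s /andP[s0 sM]; have := Td s s0; rewrite subr0 ger0_norm// T0.
by move=> /(_ (le_lt_trans sM Md))/ltW.
Qed.

(* [dyadic_average M l] applies the mean of [T] over the multiples of
   [dyad (M + l)] in [0, dyad M[: it is a Riemann sum of the normalized
   integral of [T] over [0, dyad M]. *)
Fixpoint dyadic_average (M l : nat) (x : V) : V :=
  if l is l'.+1 then
    dyadic_average M l' ((2^-1)%:C *: x + (2^-1)%:C *: T (D (M + l)) x)
  else x.
Local Notation Q := dyadic_average.

Lemma dyadic_average_lin M l : linear_op (Q M l).
Proof.
elim: l => //= l IH; apply: (linear_op_comp IH).
by apply: linear_op_lincomb => //; exact/T_lin/dyad_ge0.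
Qed.

Lemma midpoint_norm_le x y (e : R) : hn x <= e -> hn y <= e ->
  hn ((2^-1)%:C *: x + (2^-1)%:C *: y) <= e.
Proof.
move=> xe ye; rewrite -scalerDr hnormZr ger0_norm ?invr_ge0//.
have := hnormD_le ip x y; lra.
Qed.

Lemma dyadic_average_contraction M l : contraction ip (Q M l).
Proof.
elim: l => //= l IH x; apply: le_trans (IH _) _.
by apply: midpoint_norm_le => //; exact/T_contr/dyad_ge0.
Qed.

Lemma dyadic_average_comm S M l : linear_op S -> (forall m, op_comm S (T (D m))) ->
  op_comm S (Q M l).
Proof.
by move=> S_lin ST; elim: l => //= l IH x; rewrite IH (linopD S_lin) !(linopZ S_lin) ST.
Qed.

Lemma semigroup_comm s t : 0 <= s -> 0 <= t -> op_comm (T s) (T t).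
Proof. by move=> s0 t0 x; rewrite -!T_add// addrC. Qed.

Lemma semigroup_dyadic_average_comm M l s : 0 <= s -> op_comm (T s) (Q M l).
Proof.
by move=> s0; apply: dyadic_average_comm (T_lin s0) _ => m; exact/semigroup_comm/dyad_ge0.
Qed.

Lemma dyadic_average_split M l x : Q 0 (M + l) x = Q 0 M (Q M l x).
Proof.
elim: l x => [|l IH] x; first by rewrite addn0.
by rewrite addnS /= IH add0n addnS.
Qed.

Lemma dyadic_average_telescope m x :
  T (D m) (Q 0 m x) - Q 0 m x = (D m)%:C *: (T 1 x - x).
Proof.
elim: m x => [|m IH] x; first by rewrite /= dyad0 scale1r.
have d0 := dyad_ge0 R m.+1; have Q_lin := dyadic_average_lin 0 m.
rewrite (semigroup_dyadic_average_comm _ _ d0) -linopB; last exact: dyadic_average_lin.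
rewrite /= add0n (_ : _ + _ = (2^-1)%:C *: (T (D m) x - x)); last first.
  rewrite (linopB (T_lin d0)) -T_add// dyadS !scalerBr.
  by rewrite [LHS]addrC addrA subrK.
rewrite (linopZ Q_lin) (linopB Q_lin) -semigroup_dyadic_average_comm ?dyad_ge0// IH.
by rewrite scalerA -rmorphM /dyad exprS.
Qed.

Lemma dyadic_average_near M x (e : R) : (forall s, 0 <= s <= D M -> hn (T s x - x) <= e) ->
  forall l, hn (Q M l x - x) <= e.
Proof.
move=> Tx l; have [_ _ T0 _ _] := T_semigroup.
suff Qnear s : 0 <= s <= D (M + l) -> hn (Q M l (T s x) - x) <= e.
  by rewrite -[X in Q M l X]T0 Qnear// lexx dyad_ge0.
elim: l s => [|l IH] s; first by rewrite addn0; exact: Tx.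
rewrite addnS => /andP[s0 sl]; have d0 := dyad_ge0 R (M + l).+1; have dS := dyadS R (M + l).
have Q_lin := dyadic_average_lin M l.
rewrite /= addnS -T_add// (linopD Q_lin) !(linopZ Q_lin).
have half2 : (2^-1)%:C + (2^-1)%:C = 1 :> R[i].
  by rewrite -rmorphD (_ : _ + _ = 1) ?rmorph1//; field.
rewrite -[in X in _ - X](scale1r x) -half2 scalerDl opprD addrACA -!scalerBr.
apply: midpoint_norm_le; apply: IH; first by rewrite s0 /=; lra.
by rewrite addr_ge0//=; lra.
Qed.

Lemma dyadic_average_cvg : exists B, strong_lim ip (Q 0) B.
Proof.
suff /choice[B QB] : forall x, exists l, hcvg ip (fun m => Q 0 m x) l by exists B.
move=> x; apply: hcauchy_cvg => e /(semigroup_near0 x)[M Tx]; exists M => m Mm.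
rewrite -(subnKC Mm) dyadic_average_split -(linopB (dyadic_average_lin 0 M)).
by rewrite (le_trans (dyadic_average_contraction _ _ _))// dyadic_average_near.
Qed.

Lemma average_derivative B x : strong_lim ip (Q 0) B ->
  hcvg ip (fun m => (D m)^-1%:C *: (T (D m) (B x) - B x)) (T 1 x - x).
Proof.
move=> QB; set y := T 1 x - x; apply/hcvgP => e e0.
have [N Ty] := semigroup_near0 y (divr_gt0 e0 (ltr0Sn R 1)); exists N => M NM.
have {}Ty s : 0 <= s <= D M -> hn (T s y - y) <= e / 2.
  by move=> /andP[s0 sM]; apply: Ty; rewrite s0 (le_trans sM)// dyad_le.
pose A z := (D M)^-1%:C *: (T (D M) z - z); have dM := dyad_ge0 R M.
have A_lin : linear_op A.
  move=> a u w; rewrite /A (T_lin dM) opprD addrACA -scalerBr.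
  by rewrite scalerDr !scalerA mulrC.
have A_bounded : bounded_by ip ((D M)^-1 * 2) A.
  move=> z; rewrite /A hnormZr ger0_norm ?invr_ge0// -mulrA ler_wpM2l ?invr_ge0//.
  by have := hnormB_le ip (T (D M) z) z; have := T_contr dM z; lra.
have QMB : hcvg ip (fun l => Q 0 (M + l) x) (B x).
  by apply: (hcvg_subseq (phi := addn M)) (QB x) => l; exact: leq_addl.
have Ay := hcvgD (hcvg_op A_lin A_bounded QMB) (hcvg_cst ip (- y)).
apply: (@le_lt_trans _ _ (e / 2)); last lra.
apply: (hcvg_hnorm_le Ay) => l.
suff -> : A (Q 0 (M + l) x) = Q M l y by exact: dyadic_average_near.
rewrite /A dyadic_average_split dyadic_average_telescope scalerA -rmorphM.
rewrite mulVf ?gt_eqF ?dyad_gt0// scale1r /y (linopB (dyadic_average_lin M l)).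
by rewrite semigroup_dyadic_average_comm.
Qed.

Theorem semigroup_average_exists : exists B,
  [/\ linear_op B, contraction ip B,
      forall S K, linear_op S -> bounded_by ip K S ->
        (forall m, op_comm S (T (D m))) -> op_comm S B,
      forall W, closed_subspace ip W -> (forall m, invariant (T (D m)) W) -> invariant B W &
      forall x, hcvg ip (fun m => (D m)^-1%:C *: (T (D m) (B x) - B x)) (T 1 x - x)].
Proof.
have [B QB] := dyadic_average_cvg; exists B; split=> [|||W [W_sub W_closed] TW x Wx|x].
- by apply: strong_lim_linear QB _ => k; exact: dyadic_average_lin.
- by apply: strong_lim_contraction QB _ => k; exact: dyadic_average_contraction.
- move=> S K S_lin SK ST; apply: (strong_lim_comm QB S_lin SK) => k.
  exact: dyadic_average_comm.
- apply: (W_closed _ _ (QB x)) => k; elim: k x Wx => //= k IH x Wx; apply: IH.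
  by apply: subspaceD => //; apply: subspaceZ => //; exact: TW.
- exact: average_derivative.
Qed.

End SemigroupAverage.

Section DampedSemigroup.
Variables (R : realType) (V : lmodType R[i]) (ip : innerProduct V).
Local Notation hn := (hnorm ip).

Definition damp (T : R -> V -> V) (s : R) (x : V) : V := (expR (- s))%:C *: T s x.

Lemma damp_semigroup T : contractive_semigroup ip T -> contractive_semigroup ip (damp T).
Proof.
move=> [T_lin T_contr T0 T_add T_cont].
have exp_le1 s : 0 <= s -> `|expR (- s)| <= 1 :> R.
  by move=> s0; rewrite ger0_norm ?expR_ge0// -expR0 ler_expR oppr_le0.
split=> [s s0 a x y|s x s0|x|s t x s0 t0|x t t0 e e0].
- by rewrite /damp T_lin// scalerDr !scalerA mulrC.
- rewrite /damp hnormZr -[leRHS]mul1r.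
  by apply: ler_pM; rewrite ?hnorm_ge0 ?exp_le1 ?T_contr.
- by rewrite /damp T0 oppr0 expR0 scale1r.
- rewrite /damp (linopZ (T_lin _ s0)) scalerA T_add//; congr (_ *: _).
  by rewrite -rmorphM -expRD opprD.
have [d1 d1_gt0 Td] := T_cont x t t0 _ (divr_gt0 e0 (ltr0Sn R 1)).
have x1 : 0 < hn x + 1 by rewrite ltr_wpDl ?hnorm_ge0.
have expN_cont : (fun s => expR (- s)) @ t --> expR (- t).
  by apply: continuous_comp; [exact: opp_continuous|exact: continuous_expR].
have /cvgrPdistC_lt/(_ _ (divr_gt0 (divr_gt0 e0 (ltr0Sn R 1)) x1))[d2 /= d2_gt0 expNd] := expN_cont.
exists (Num.min d1 d2) => [|s s0]; rewrite ?lt_min ?d1_gt0// => /andP[sd1 sd2].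
have -> : damp T s x - damp T t x =
    (expR (- s))%:C *: (T s x - T t x) + (expR (- s) - expR (- t))%:C *: T t x.
  by rewrite /damp rmorphB scalerBl scalerBr addrA subrK.
apply: le_lt_trans (hnormD_le ip _ _) _; rewrite !hnormZr [e]splitr; apply: ltr_leD.
  by apply: le_lt_trans (Td s s0 sd1); rewrite ler_piMl ?hnorm_ge0 ?exp_le1.
apply: (@le_trans _ _ (`|expR (- s) - expR (- t)| * (hn x + 1))).
  by rewrite ler_wpM2l// (le_trans (T_contr _ _ t0))// lerDl.
by rewrite -ler_pdivlMr// ltW// expNd//= distrC.
Qed.

End DampedSemigroup.

(** * Cluster values and roots of the exponential *)

Section Clusters.
Variable R : realType.
Implicit Types u v : nat -> R.

Definition clusters0 u : Prop :=
  forall e, 0 < e -> forall N, exists2 n, (N <= n)%N & u n < e.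

Lemma clusters0_le u u' v (K : R) M : 0 <= K ->
  (forall n, (M <= n)%N -> u' n <= K * u n + v n) -> v @ \oo --> (0 : R) ->
  clusters0 u -> clusters0 u'.
Proof.
move=> K0 u'_le v0 u0 e e0 N; have e2 : 0 < e / 2 by rewrite divr_gt0.
have K1 : 0 < K + 1 by rewrite ltr_wpDl.
have /cvgrPdist_lt/(_ _ e2)[N' _ vN'] := v0.
have [n] := u0 _ (divr_gt0 e2 K1) (maxn M (maxn N N')).
rewrite !geq_max => /and3P[Mn Nn N'n] un; exists n => //.
have := vN' n N'n; rewrite sub0r normrN => /(le_lt_trans (ler_norm _)) vn.
have Kun : K * u n <= e / 2.
  apply: (@le_trans _ _ (K * (e / 2 / (K + 1)))); first by rewrite ler_wpM2l// ltW.
  by rewrite mulrCA ler_piMr ?ltW// ltr_pdivrMr// mul1r ltrDl.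
by have := u'_le n Mn; lra.
Qed.

Lemma clusters0_cst (c : R) : clusters0 (fun=> c) -> c <= 0.
Proof.
move=> c0; rewrite leNgt; apply/negP => c_gt0.
by have [_ _] := c0 c c_gt0 0%N; rewrite ltxx.
Qed.

Lemma clusters0_cst_le u v (c : R) M : (forall n, (M <= n)%N -> c <= u n + v n) ->
  v @ \oo --> (0 : R) -> clusters0 u -> c <= 0.
Proof.
move=> c_le v0 u0; apply: clusters0_cst.
apply: (clusters0_le (K := 1) (M := M) _ _ v0 u0) => // n Mn.
by rewrite mul1r; exact: c_le Mn.
Qed.

End Clusters.

Section ComplexExponential.
Variable R : realType.
Implicit Types z w a : R[i].

Lemma cexpD z w : cexp (z + w) = cexp z * cexp w.
Proof. by rewrite /cexp !ReImE expRD cosD sinD; apply: complex_ext; rewrite !ReImE /=; ring. Qed.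

Lemma cexp0 : cexp (0 : R[i]) = 1.
Proof. by rewrite /cexp /= expR0 cos0 sin0 mulr1 mulr0. Qed.

Lemma cexpMn n z : cexp (n%:R * z) = cexp z ^+ n.
Proof.
elim: n => [|n IH]; first by rewrite mul0r cexp0.
by rewrite exprS -IH -cexpD mulrSr mulrDl mul1r addrC.
Qed.

Lemma normc_cexp z : normc (cexp z) = expR (complex.Re z).
Proof. by rewrite /= !exprMn -mulrDr cos2Dsin2 mulr1 sqrtr_sqr ger0_norm// expR_ge0. Qed.

Lemma cexp_scale (s : R) a : cexp (s%:C * a) =
  (expR (s * complex.Re a) * cos (s * complex.Im a)) +i*
  (expR (s * complex.Re a) * sin (s * complex.Im a)).
Proof. by rewrite /cexp !ReImE /= !mul0r subr0 addr0. Qed.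

Lemma normc_exprB_le n z w : normc z <= 1 -> normc w <= 1 ->
  normc (z ^+ n - w ^+ n) <= n%:R * normc (z - w).
Proof.
move=> z1 w1; elim: n => [|n IH]; first by rewrite !expr0 subrr mul0r normc0.
have -> : z ^+ n.+1 - w ^+ n.+1 = z * (z ^+ n - w ^+ n) + (z - w) * w ^+ n.
  by rewrite !exprS; ring.
apply: le_trans (le_normcD _ _) _; rewrite !normcM normcX -natr1 mulrDl mul1r.
apply: lerD; first by apply: le_trans IH; rewrite ler_piMl ?normc_ge0.
by rewrite ler_piMr ?normc_ge0// exprn_ile1 ?normc_ge0.
Qed.

Lemma cexp_cvg (s : nat -> R) (t : R) a : s @ \oo --> t ->
  ccvg (fun m => cexp ((s m)%:C * a)) (cexp (t%:C * a)).
Proof.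
move=> st; have sr (r : R) : (fun m => s m * r) @ \oo --> t * r by exact: cvgMl.
have exp_cvg : (fun m => expR (s m * complex.Re a)) @ \oo --> expR (t * complex.Re a).
  by apply: continuous_cvg => //; exact: continuous_expR.
apply: ccvg_ReIm; rewrite cexp_scale; under eq_fun do rewrite cexp_scale.
- by apply: cvgM => //; apply: continuous_cvg => //; exact: continuous_cos.
- by apply: cvgM => //; apply: continuous_cvg => //; exact: continuous_sin.
Qed.

Lemma dyad_derivative (f : R -> R) (l : R) : is_derive (0 : R) (1 : R) f l ->
  (fun m => (dyad m)^-1 * (f (dyad m) - f 0)) @ \oo --> l.
Proof.
move=> [df <-]; have dyad_cvg : @dyad R @ \oo --> (0 : R)^'.
  move=> A [e /= e0 eA]; have [N dN] := (cvg0_ltP (@dyad_ge0 R)).1 (@dyad_cvg0 R) e e0.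
  exists N => // m Nm; apply: eA; last by rewrite gt_eqF ?dyad_gt0.
  by rewrite /ball_/= sub0r normrN ger0_norm ?dyad_ge0 ?dN.
have := cvg_comp _ _ dyad_cvg df.
by under [X in X @ _]eq_fun do rewrite /= addr0 /GRing.scale /= mulr1.
Qed.

Lemma is_derive_scale (r : R) : is_derive (0 : R) (1 : R) (fun t => t * r) r.
Proof.
have := @is_deriveZ R R R id r 0 1 1 (is_derive_id (0 : R) (1 : R)).
rewrite /GRing.scale /= mulr1; congr (is_derive _ _ _ _).
by apply/funext => t /=; rewrite mulrC.
Qed.

Lemma is_derive_exp_cos (r i : R) :
  is_derive (0 : R) (1 : R) (fun t => expR (t * r) * cos (t * i)) r.
Proof.
have dr := is_derive_scale r; have di := is_derive_scale i.
have dexp : is_derive (0 : R) (1 : R) (expR \o (fun t => t * r)) (expR (0 * r) * r).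
  exact: is_derive1_comp.
have dcos : is_derive (0 : R) (1 : R) (cos \o (fun t => t * i)) (- sin (0 * i) * i).
  exact: is_derive1_comp.
have := is_deriveM dexp dcos.
by rewrite /= !mul0r expR0 cos0 sin0 oppr0 mul0r scaler0 add0r mul1r /GRing.scale /= mul1r.
Qed.

Lemma is_derive_exp_sin (r i : R) :
  is_derive (0 : R) (1 : R) (fun t => expR (t * r) * sin (t * i)) i.
Proof.
have dr := is_derive_scale r; have di := is_derive_scale i.
have dexp : is_derive (0 : R) (1 : R) (expR \o (fun t => t * r)) (expR (0 * r) * r).
  exact: is_derive1_comp.
have dsin : is_derive (0 : R) (1 : R) (sin \o (fun t => t * i)) (cos (0 * i) * i).
  exact: is_derive1_comp.
have := is_deriveM dexp dsin.
by rewrite /= !mul0r expR0 cos0 sin0 mul1r scale0r addr0 /GRing.scale /= mul1r.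
Qed.

Lemma cexp_dyad_derivative a :
  ccvg (fun m => (dyad m)^-1%:C * (cexp ((dyad m)%:C * a) - 1)) a.
Proof.
apply: ccvg_ReIm.
  under eq_fun do rewrite cexp_scale !ReImE /= mul0r subr0.
  have := dyad_derivative (is_derive_exp_cos (complex.Re a) (complex.Im a)).
  by rewrite /= !mul0r expR0 cos0 mulr1.
under eq_fun do rewrite cexp_scale !ReImE /= mul0r addr0.
have := dyad_derivative (is_derive_exp_sin (complex.Re a) (complex.Im a)).
by rewrite /= !mul0r expR0 sin0 mulr0.
Qed.

(* If [z (m+1)] is a square root of [z m], comparing the [2^(n-m)]-th powers of
   [z n] and [cexp (dyad n * a)] costs a factor [2^(n-m)], which the difference
   quotients at [dyad n] absorb. *)
Lemma root_sequence_cexp (z : nat -> R[i]) a :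
  (forall m, z m.+1 ^+ 2 = z m) -> (forall m, normc (z m) <= 1) ->
  clusters0 (fun m => normc ((dyad m)^-1%:C * (z m - 1) - a)) ->
  forall m, z m = cexp ((dyad m)%:C * a).
Proof.
move=> z_root z1 za m; pose w n := cexp ((dyad n)%:C * a).
have d_gt0 n := dyad_gt0 R n; have w_deriv := cexp_dyad_derivative a.
have root_iter (v : nat -> R[i]) : (forall m, v m.+1 ^+ 2 = v m) ->
    forall k, v (m + k)%N ^+ (2 ^ k) = v m.
  move=> v_root; elim=> [|k IH]; first by rewrite addn0.
  by rewrite addnS expnS exprM v_root.
have w_root k : w k.+1 ^+ 2 = w k.
  by rewrite /w expr2 -cexpD -mulrDl -rmorphD dyadS.
have Re_a : complex.Re a <= 0.
  apply: (clusters0_cst_le (M := 0) _ (cvg_cst 0) za) => n _; rewrite addr0.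
  have := le_trans (ler_norm _) (Re_le_normc (- ((dyad n)^-1%:C * (z n - 1) - a))).
  rewrite normcN; apply: le_trans; rewrite !ReImE /= mul0r subr0 opprB lerBrDr gerDl.
  rewrite mulr_ge0_le0 ?invr_ge0 ?dyad_ge0// subr_le0.
  exact: le_trans (le_trans (ler_norm _) (Re_le_normc (z n))) (z1 n).
have w1 n : normc (w n) <= 1.
  by rewrite normc_cexp -expR0 ler_expR ReImE /= mul0r subr0 mulr_ge0_le0// dyad_ge0.
apply/eqP; rewrite -subr_eq0; apply/eqP/eq0_normc/le_anti; rewrite normc_ge0 andbT.
apply: (clusters0_cst_le (M := m) _ w_deriv za) => n /subnKC <-; set k := (n - m)%N.
rewrite -/(w m) -(root_iter z z_root k) -(root_iter w w_root k).
apply: le_trans (normc_exprB_le _ (z1 _) (w1 _)) _.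
pose q (v : nat -> R[i]) := (dyad (m + k))^-1%:C * (v (m + k)%N - 1) - a.
have -> : z (m + k)%N - w (m + k)%N = (dyad (m + k))%:C * (q z - q w).
  by rewrite /q opprB addrA subrK -mulrBr mulrA -rmorphM mulfV ?gt_eqF// mul1r opprB addrA subrK.
rewrite normcM normc_real ger0_norm ?dyad_ge0// mulrA.
apply: (@le_trans _ _ (normc (q z - q w))).
  rewrite ler_piMl ?normc_ge0// natrX /dyad exprD mulrCA -exprMn mulfV ?expr1n ?mulr1 ?pnatr_eq0//.
  by rewrite exprn_ile1 ?invr_ge0// invf_le1// ler1n.
by apply: le_trans (le_normcD _ _) _; rewrite normcN.
Qed.

End ComplexExponential.

(** * The cogenerator of a diagonalized semigroup *)

Section ClustersInL2.
Context {d : measure_display} {X : measurableType d} {R : realType}.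
Variable mu : {measure set X -> \bar R}.
Local Notation C := R[i].
Local Notation einf u := (limn_einf (fun n => (cnorm2 (u n))%:E)).

Lemma clusters0_limn_einfP (u : nat -> C) :
  clusters0 (fun n => normc (u n)) <-> (einf u <= 0)%E.
Proof.
split=> [u0|u0 e e0 N].
  apply/lee_addgt0Pr => e e0; rewrite add0e limn_einf_lim.
  apply: lime_le; first exact: is_cvg_einfs.
  apply: nearW => N; have sqrt_e0 : 0 < Num.sqrt e by rewrite sqrtr_gt0.
  have [n Nn un] := u0 _ sqrt_e0 N.
  apply: ge_ereal_inf; exists (cnorm2 (u n))%:E; first by exists n.
  by rewrite lee_fin cnorm2E -(sqr_sqrtr (ltW e0)) ler_sqr ?nnegrE ?normc_ge0 ?ltW.
have [|n Nn un] := limn_einf_lt_frequently (_ : einf u < (e ^+ 2)%:E)%E N.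
  by rewrite (le_lt_trans u0)// lte_fin exprn_gt0.
by exists n => //; rewrite -ltr_sqr ?nnegrE ?normc_ge0 ?ltW// -cnorm2E.
Qed.

Lemma measurable_clusters0 (f : nat -> X -> C) : (forall n, cmeasurable (f n)) ->
  measurable [set x | clusters0 (fun n => normc (f n x))].
Proof.
move=> mf; have mF : measurable_fun setT (fun x => einf (f ^~ x)).
  by apply: measurable_limn_einf => n; exact/measurable_EFinP/measurable_cnorm2.
have := mF measurableT _ (emeasurable_itv `]-oo, 0%E]%R).
by rewrite setTI; congr measurable; apply/seteqP; split=> x /=;
  rewrite in_itv /= => /clusters0_limn_einfP.
Qed.

Lemma l2norm_cvg0_clusters0 (f : nat -> X -> C) : (forall n, cL2 mu (f n)) ->
  (fun n => l2norm mu (f n)) @ \oo --> (0 : R) ->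
  {ae mu, forall x, clusters0 (fun n => normc (f n x))}.
Proof.
move=> L2f f0; have mf n : measurable_fun setT (fun x => (cnorm2 (f n x))%:E).
  by apply/measurable_EFinP/measurable_cnorm2; case: (L2f n).
have mF : measurable_fun setT (fun x => einf (f ^~ x)) by exact: measurable_limn_einf.
have F_ge0 x : (0 <= einf (f ^~ x))%E.
  by apply: limn_einf_ge0 => n; rewrite lee_fin cnorm2E sqr_ge0.
have F0 : (\int[mu]_x einf (f ^~ x) = 0)%E.
  apply/le_anti; rewrite integral_ge0// andbT.
  apply: le_trans (fatou mu measurableT mf _) _;
    first by move=> n x _; rewrite lee_fin cnorm2E sqr_ge0.
  have sqr0 : (fun n => \int[mu]_x (cnorm2 (f n x))%:E)%E @ \oo --> 0%E.
    under eq_fun do rewrite integral_cnorm2//.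
    apply: cvg_EFin; first exact: nearW.
    by under eq_fun do rewrite expr2; rewrite -(mulr0 (0 : R)); exact: cvgM.
  by rewrite is_cvg_limn_einfE ?(cvg_lim _ sqr0)//; apply/cvg_ex; exists 0%E.
have : ae_eq mu setT (fun x => einf (f ^~ x)) (cst 0%E).
  by apply/ae_eq_integral_abs => //; under eq_integral do rewrite gee0_abs//.
by apply: filterS => x /(_ Logic.I) /= Fx; apply/clusters0_limn_einfP; rewrite Fx.
Qed.

Lemma l2cvg_ae_unique (f : nat -> X -> C) g g' : (forall n, cL2 mu (f n)) -> cL2 mu g ->
  l2cvg mu f g -> {ae mu, forall x, ccvg (fun n => f n x) (g' x)} ->
  {ae mu, forall x, g x = g' x}.
Proof.
move=> L2f L2g fg fg'.
have fg_clusters := l2norm_cvg0_clusters0 (fun n => cL2B (L2f n) L2g) fg.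
apply: filterS (aeI fg_clusters fg') => x [fgx fgx'].
apply/eqP; rewrite -subr_eq0; apply/eqP/eq0_normc/le_anti; rewrite normc_ge0 andbT.
apply: (clusters0_cst_le (M := 0) _ fgx' fgx) => n _.
rewrite [normc (f n x - g x)]normc_distC; apply: le_trans (le_normcD _ _).
by rewrite addrA subrK.
Qed.

End ClustersInL2.

Section Generator.
Variables (R : realType) (V : lmodType R[i]) (ip : innerProduct V).
Context {d : measure_display} {X : measurableType d}.
Variables (mu : {measure set X -> \bar R}) (gamma : V -> X -> R[i]).
Hypothesis mu_semifinite : semifinite mu.
Hypothesis gamma_unitary : unitary_to_L2 mu ip gamma.
Variable T : R -> V -> V.
Hypothesis T_semigroup : contractive_semigroup ip T.
Variable z : nat -> X -> R[i].
Hypothesis z_diag : forall m, diagonalizes mu gamma (T (dyad m)) (z m).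

Let gammaP : l2_isometry ip mu gamma.
Proof. by have [] := (unitary_to_L2P ip mu gamma).1 gamma_unitary. Qed.

Lemma multiplier_root : {ae mu, forall x, forall m, z m.+1 x ^+ 2 = z m x}.
Proof.
have [_ _ _ T_add _] := T_semigroup; apply: ae_foralln => m.
apply: (diagonalizes_unique gamma_unitary mu_semifinite (N := iter 2 (T (dyad m.+1)))).
  exact: diagonalizes_iter.
have [mz zm] := z_diag m; split=> // h.
by rewrite /= -T_add ?dyad_ge0// dyadS.
Qed.

Lemma multiplier_contraction : {ae mu, forall x, forall m, normc (z m x) <= 1}.
Proof.
have [_ T_contr _ _ _] := T_semigroup; apply: ae_foralln => m.
have T_m : contraction ip (T (dyad m)) by move=> x; exact/T_contr/dyad_ge0.
apply: filterS (diagonalizes_contraction gamma_unitary mu_semifinite T_m (z_diag m)) => x.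
by rewrite cnorm2E expr_le1 ?normc_ge0.
Qed.

Variables (B : V -> V) (b : X -> R[i]).
Hypothesis B_derivative :
  forall x, hcvg ip (fun m => (dyad m)^-1%:C *: (T (dyad m) (B x) - B x)) (T 1 x - x).
Hypothesis b_diag : diagonalizes mu gamma B b.

Let quotient m x := (dyad m)^-1%:C * (z m x * b x - b x) - (z 0%N x - 1).

Let quotient_diag m : diagonalizes mu gamma
  (fun h => (dyad m)^-1%:C *: (T (dyad m) (B h) - B h) - (T 1 h - h)) (quotient m).
Proof.
have id_diag : diagonalizes mu gamma id (fun=> 1).
  by split=> [|h]; [exact: cmeasurable_cst|apply: nearW => x; rewrite mul1r].
have T1_diag : diagonalizes mu gamma (T 1) (z 0%N) by rewrite -dyad0.
apply: (diagonalizesB gammaP); last exact: (diagonalizesB gammaP).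
by apply/(diagonalizesZ gammaP)/(diagonalizesB gammaP) => //; exact: diagonalizes_comp.
Qed.

Lemma difference_quotient_clusters : {ae mu, forall x, clusters0 (fun m => normc (quotient m x))}.
Proof.
have [_ onto] := (unitary_to_L2P ip mu gamma).1 gamma_unitary; have [L2g _ _] := gammaP.
apply: (semifinite_ae mu_semifinite).
  by apply: measurable_clusters0 => m; case: (quotient_diag m).
move=> A mA A_fin; have [h hA] := onto _ (cL2_indic mA A_fin).
have := l2norm_cvg0_clusters0 (fun m => L2g _) _ (f := fun m =>
  gamma ((dyad m)^-1%:C *: (T (dyad m) (B h) - B h) - (T 1 h - h))).
under eq_fun do rewrite (isometry_l2norm gammaP).
move=> /(_ (B_derivative h)) h_clusters.
have h_quotient : {ae mu, forall x, forall m,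
    gamma ((dyad m)^-1%:C *: (T (dyad m) (B h) - B h) - (T 1 h - h)) x = quotient m x * gamma h x}.
  by apply: ae_foralln => m; exact: (quotient_diag m).2.
apply: filterS (aeI hA (aeI h_clusters h_quotient)) => x [hAx [+ hx]] Ax.
by under eq_fun do rewrite hx hAx cindic_in// mulr1.
Qed.

Theorem multiplier_cexp : {ae mu, forall x, z 0%N x != 1 -> b x != 0 /\
  forall m, z m x = cexp ((dyad m)%:C * ((z 0%N x - 1) / b x))}.
Proof.
apply: filterS (aeI difference_quotient_clusters (aeI multiplier_root multiplier_contraction)).
move=> x [q0 [z_root z1]] z_neq1.
have b_neq0 : b x != 0.
  apply: contraNneq z_neq1 => b0; rewrite -subr_eq0; apply/eqP/eq0_normc/le_anti.
  rewrite normc_ge0 andbT; apply: clusters0_cst; move: q0.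
  by under eq_fun do rewrite /quotient b0 mulr0 subrr mulr0 sub0r normcN.
split=> //; apply: root_sequence_cexp => //.
apply: (clusters0_le (K := normc (b x)^-1) (M := 0) (normc_ge0 _) _ (cvg_cst 0) q0) => m _.
have -> : (dyad m)^-1%:C * (z m x - 1) - (z 0%N x - 1) / b x = (b x)^-1 * quotient m x.
  by rewrite /quotient; field; rewrite b_neq0 fmorph_eq0 gt_eqF ?dyad_gt0.
by rewrite addr0 normcM.
Qed.

End Generator.

Section Cogenerator.
Variables (R : realType) (V : lmodType R[i]) (ip : innerProduct V).
Context {d : measure_display} {X : measurableType d}.
Variables (mu : {measure set X -> \bar R}) (gamma : V -> X -> R[i]).
Hypothesis mu_semifinite : semifinite mu.
Hypothesis gamma_unitary : unitary_to_L2 mu ip gamma.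
Variable T : R -> V -> V.
Hypothesis T_semigroup : contractive_semigroup ip T.
Variable g : nat -> X -> R[i].
Hypothesis g_diag : forall m, diagonalizes mu gamma (T (dyad m)) (g m).
Variables (B : V -> V) (b : X -> R[i]).
Hypothesis B_derivative : forall x,
  hcvg ip (fun m => (dyad m)^-1%:C *: (damp T (dyad m) (B x) - B x)) (damp T 1 x - x).
Hypothesis b_diag : diagonalizes mu gamma B b.

Let gammaP : l2_isometry ip mu gamma.
Proof. by have [] := (unitary_to_L2P ip mu gamma).1 gamma_unitary. Qed.

Let c x : R[i] := (expR (- 1))%:C * g 0 x - 1.

(* Off a null set the generator of [T] is multiplication by [c x / b x + 1]; its
   Cayley transform is [1 + 2 b x / c x]. *)
Definition cogenerator (x : X) : R[i] := 1 + 2%:R * (b x / c x).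

Lemma cayley (u v : R[i]) : u != 0 -> v != 0 ->
  [/\ 1 + 2%:R * (u / v) != 1 :> R[i],
      (1 + 2%:R * (u / v) + 1) / (1 + 2%:R * (u / v) - 1) = v / u + 1 &
      complex.Re (v / u + 1) <= 0 -> cnorm2 (1 + 2%:R * (u / v)) <= 1].
Proof.
move=> u0 v0; have two : 2%:R != 0 :> R[i] by rewrite pnatr_eq0.
have w1 : 1 + 2%:R * (u / v) != 1 :> R[i].
  by rewrite -subr_eq0 addrAC subrr add0r !mulf_neq0 ?invr_neq0.
split=> // [|Re_a].
  have -> : 1 + 2%:R * (u / v) + 1 = 2%:R * (u / v) * (v / u + 1) :> R[i].
    by field; rewrite u0 v0.
  rewrite [1 + _ - 1]addrAC subrr add0r mulrAC divff ?mul1r//.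
  by rewrite !mulf_neq0 ?invr_neq0.
set a := v / u + 1 in Re_a.
have aE : a - 1 = v / u by rewrite /a addrK.
have -> : 1 + 2%:R * (u / v) = (a + 1) / (a - 1) by rewrite aE /a; field; rewrite u0 v0.
have a1 : 0 < normc (a - 1).
  rewrite lt0r normc_ge0 andbT; apply/eqP => /eq0_normc/eqP.
  by rewrite aE mulf_eq0 invr_eq0 (negbTE u0) (negbTE v0).
rewrite cnorm2E normcM normcV exprMn exprVn ler_pdivrMr ?exprn_gt0// mul1r.
clearbody a; rewrite -!cnorm2E /cnorm2 !ReImE /=; lra.
Qed.

Theorem cogenerator_ae : {ae mu, forall x, [/\ b x != 0, c x != 0,
  complex.Re (c x / b x + 1) <= 0 &
  forall m, g m x = cexp ((dyad m)%:C * (c x / b x + 1))]}.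
Proof.
pose z m x := (expR (- dyad m))%:C * g m x.
have z_diag m : diagonalizes mu gamma (damp T (dyad m)) (z m).
  exact: (diagonalizesZ gammaP).
have z0E x : z 0%N x - 1 = c x by rewrite /z dyad0.
have := multiplier_cexp mu_semifinite gamma_unitary (damp_semigroup T_semigroup) z_diag
  B_derivative b_diag.
have g_le1 := multiplier_contraction mu_semifinite gamma_unitary T_semigroup g_diag.
apply: filterS2 g_le1 => x g1 /=; rewrite z0E.
have z_le m : normc (z m x) <= expR (- dyad m).
  by rewrite normcM normc_real ger0_norm ?expR_ge0// ler_piMr ?expR_ge0.
have c0 : c x != 0.
  apply/negP => /eqP c0; have := z_le 0%N.
  have -> : z 0%N x = 1 by apply/eqP; rewrite -subr_eq0 z0E c0.
  by rewrite normc1 dyad0 leNgt expR_lt1 oppr_lt0 ltr01.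
have -> : z 0%N x != 1 by rewrite -subr_eq0 z0E.
move=> /(_ isT)[b0 zE]; split=> // [|m].
  have := z_le 0%N; rewrite zE normc_cexp dyad0 mul1r ler_expR => Re_le.
  by rewrite Re_add [complex.Re 1]/= -lerBrDr sub0r.
have gE : g m x = (expR (dyad m))%:C * z m x.
  by rewrite mulrA -rmorphM -expRD subrr expR0 mul1r.
rewrite gE zE mulrDr cexpD mulrC; congr (_ * _).
by rewrite cexp_scale /= mulr1 mulr0 cos0 sin0 mulr1 mulr0.
Qed.

Lemma cogenerator_Linf : Linf_ball mu cogenerator /\ mu [set x | cogenerator x = 1] = 0%E.
Proof.
have mc : cmeasurable c.
  by apply: cmeasurableB; [apply: cmeasurableZ; case: (g_diag 0)|exact: cmeasurable_cst].
have m_cogen : cmeasurable cogenerator.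
  apply: cmeasurableD; first exact: cmeasurable_cst.
  by apply/cmeasurableZ/cmeasurableM; [case: b_diag|exact: cmeasurableV].
split; first split=> //.
  by apply: filterS cogenerator_ae => x [b0 c0 Re_a _]; have [_ _] := cayley b0 c0; exact.
have m_eq1 : measurable [set x | cogenerator x = 1].
  rewrite (_ : [set _ | _] = [set x | cogenerator x - 1 = 0]).
    exact/cmeasurable_eq0/cmeasurableB/cmeasurable_cst.
  by apply/seteqP; split=> x /= /eqP; rewrite ?subr_eq0 => /eqP // ->; rewrite subrr.
apply/measure_negligible => //.
apply: negligibleS (_ : mu.-negligible _); last exact: cogenerator_ae.
move=> x /= cogen1 [b0 c0 _ _]; have [] := cayley b0 c0.
by rewrite -/(cogenerator x) cogen1 eqxx.
Qed.

Theorem semigroup_phi_cogenerator t h : 0 <= t ->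
  {ae mu, forall x, gamma (T t h) x = phi t (cogenerator x) * gamma h x}.
Proof.
move=> t0; have [L2g _ _] := gammaP; have [_ _ _ _ T_cont] := T_semigroup.
pose k m := Num.truncn (t / dyad m); pose s m : R := (k m)%:R * dyad m.
have s_near m : 0 <= t - s m <= dyad m.
  have d0 := dyad_gt0 R m.
  have /andP[] : (k m)%:R <= t / dyad m < (k m).+1%:R by apply: truncn_itv; rewrite divr_ge0// ltW.
  rewrite ler_pdivlMr// ltr_pdivrMr// -natr1 mulrDl mul1r /s => lo hi.
  by apply/andP; split; lra.
have s_cvg : s @ \oo --> t.
  rewrite (_ : s = fun m => t - (t - s m)); last first.
    by apply/funext => m; rewrite opprB addrC subrK.
  rewrite -[X in _ --> X](subr0 t); apply: cvgB; first exact: cvg_cst.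
  exact: squeeze_cvg0 (@dyad_cvg0 R).
have T_cvg : l2cvg mu (fun m => gamma (T (s m) h)) (gamma (T t h)).
  rewrite /l2cvg; under eq_fun do rewrite (isometry_dist gammaP).
  apply/(hcvgP _ _ _) => e e0; have [r r0 Tr] := T_cont h t t0 e e0.
  have /cvgrPdistC_lt/(_ _ r0)[N _ sN] := s_cvg.
  by exists N => m Nm; apply: Tr; [rewrite mulr_ge0 ?dyad_ge0|exact: sN].
apply: (l2cvg_ae_unique (fun m => L2g _) (L2g _) T_cvg).
have iter_diag : {ae mu, forall x, forall m, gamma (T (s m) h) x = g m x ^+ k m * gamma h x}.
  apply: ae_foralln => m; rewrite (semigroup_dyad_iter _ _ _ T_semigroup).
  exact: (diagonalizes_iter (k m) (g_diag m)).2.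
apply: filterS (aeI iter_diag cogenerator_ae) => x [Tx [b0 c0 _ gE]].
have [cogen1 cogenE _] := cayley b0 c0.
rewrite /phi (negbTE cogen1) cogenE; set a := c x / b x + 1 in gE *.
have TxE m : gamma (T (s m) h) x = cexp ((s m)%:C * a) * gamma h x.
  by rewrite Tx gE -cexpMn mulrA rmorphM rmorph_nat.
under eq_fun do rewrite TxE; rewrite /ccvg.
under eq_fun do rewrite -mulrBl normcM.
by rewrite -(mul0r (normc (gamma h x))); apply: cvgMl; exact: cexp_cvg.
Qed.

End Cogenerator.

Section SubordinateAverage.
Variables (R : realType) (V : lmodType R[i]) (ip : hilbertForm V).
Variables (P : nat -> V -> V) (T : R -> V -> V).
Hypothesis P_comm : commuting_oprojs ip P.
Hypothesis T_semigroup : contractive_semigroup ip T.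
Hypothesis T_sub : forall m, subordinate ip P (T (dyad m)).

Lemma subordinate_average_exists : exists B,
  [/\ linear_op B, contraction ip B, subordinate ip P B &
      forall x, hcvg ip (fun m => (dyad m)^-1%:C *: (damp T (dyad m) (B x) - B x))
                  (damp T 1 x - x)].
Proof.
have [B [B_lin B_contr B_comm B_inv B_deriv]] :=
  semigroup_average_exists (damp_semigroup T_semigroup).
exists B; split=> //; split=> [k|W W_closed WP].
  have P_proj := P_comm.1 k; have [P_lin _ _] := P_proj.
  apply: (B_comm _ 1) => // [|m x]; first exact/contraction_bounded/oproj_contraction.
  by rewrite /damp (linopZ P_lin) (T_sub m).1.
apply: B_inv => // m x Wx; apply: (subspaceZ W_closed.1).
exact: (T_sub m).2 Wx.
Qed.

End SubordinateAverage.

Theorem subordinate_diagonalization (R : realType) (V : lmodType R[i]) (ip : hilbertForm V)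
    (P : nat -> V -> V) : commuting_oprojs ip P ->
  exists d (X : measurableType d) (mu : {measure set X -> \bar R}) gamma,
  [/\ semifinite mu, unitary_to_L2 mu ip gamma &
    forall N, linear_op N -> contraction ip N -> subordinate ip P N ->
      exists g, diagonalizes mu gamma N g].
Proof.
move=> P_comm; have [S [S_orth S_total]] := orthogonal_cyclic_total_exists P_comm.
exact: cyclic_diagonalization S_orth S_total.
Qed.

Theorem mainTheorem9 (R : realType) (V : lmodType R[i]) (ip : V -> V -> R[i])
    (HV : is_hilbert ip) (n : nat) (T : 'I_n -> R -> V -> V)
    (HT : forall j, normal_contractive_semigroup ip (T j))
    (Hcomm : forall i j, semigroups_commute (T i) (T j)) :
  exists (d : measure_display) (X : measurableType d)
         (mu : {measure set X -> \bar R}) (psi : 'I_n -> X -> R[i])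
         (gamma : V -> X -> R[i]),
    [/\ semifinite mu,
        (forall j, Linf_ball mu (psi j)),
        (forall j, mu [set x | psi j x = 1] = 0%E),
        unitary_to_L2 mu ip gamma &
        (forall j t (h : V), 0 <= t ->
           {ae mu, forall x, gamma (T j t h) x = phi t (psi j x) * gamma h x})].
Proof.
have [ipP ip_complete] := HV.
pose H : hilbertForm V := @HilbertForm R V (InnerProduct ipP) ip_complete.
have T_semigroup j : contractive_semigroup H (T j) := (HT j).1.
pose N (i : 'I_n * nat) := T i.1 (dyad i.2).
have N_lin i : linear_op (N i) by case: (T_semigroup i.1) => + *; apply; exact: dyad_ge0.
have N_contr i : contraction H (N i).
  by move=> x; case: (T_semigroup i.1) => _ + *; apply; exact: dyad_ge0.
have [||P P_comm N_sub] := spectral_family (ip := H) (N := N) N_lin _ N_contr.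
- by move=> i; apply: (HT i.1).2; exact: dyad_ge0.
- by move=> i j; exact: (semigroups_dyad_comm _ _ (T_semigroup _) (T_semigroup _) (Hcomm _ _)).
have [d [X [mu [gamma [mu_semifinite gamma_unitary diag]]]]] := subordinate_diagonalization P_comm.
have /choice[g g_diag] i : exists g, diagonalizes mu gamma (N i) g by exact: diag.
have /choice[B B_avg] j :=
  subordinate_average_exists P_comm (T_semigroup j) (fun m => N_sub (j, m)).
have /choice[b b_diag] j : exists b, diagonalizes mu gamma (B j) b.
  by have [B_lin B_contr B_sub _] := B_avg j; exact: diag.
have B_deriv j x := let: And4 _ _ _ B_deriv := B_avg j in B_deriv x.
have psi_ball j := cogenerator_Linf mu_semifinite gamma_unitary (T_semigroup j)
  (fun m => g_diag (j, m)) (B_deriv j) (b_diag j).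
exists d, X, mu, (fun j => cogenerator (fun m => g (j, m)) (b j)), gamma.
split=> // [j|j|j t h t0]; [by case: (psi_ball j)|by case: (psi_ball j)|].
exact: (semigroup_phi_cogenerator mu_semifinite gamma_unitary (T_semigroup j)
  (fun m => g_diag (j, m)) (B_deriv j) (b_diag j)).
Qed.
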